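(* Let $r = D + C^T(J-L_A(x))^{-1}C$ be a minimal symmetric descriptor realization with $r(0)=D+C^TJC\succ 0$. \begin{itemize} \item[(lim)] If the sequence $\mathfrak{P}_r=(\mathfrak{P}_r(n))_n$ is bounded and $\mathfrak{P}_r(n)$ is convex for every positive integer $n$, then there exist a positive integer $m$ and a tuple $\mathbb{A}\in\mathbb{S}_m(\mathbb{R}^g)$ such that, for every positive integer $n$ and every $X\in\mathbb{S}_n(\mathbb{R}^g)$, one has $X\in\mathfrak{P}_r(n)$ if and only if $I-L_{\mathbb{A}}(X)\succ 0$. \item[(alg)] If the sequence $\mathcal{D}_r=(\mathcal{D}_r(n))_n$ is bounded and $\mathcal{D}_r(n)$ is convex for every positive integer $n$, then there exist a positive integer $m$ and a tuple $\mathbb{A}\in\mathbb{S}_m(\mathbb{R}^g)$ such that, for every positive integer $n$ and every $X\in\mathbb{S}_n(\mathbb{R}^g)$, one has $X\in\mathcal{D}_r(n)$ if and only if $I-L_{\mathbb{A}}(X)\succ 0$. \end{itemize}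
   Context: Fix a positive integer $g$. $\mathbb{S}_n(\mathbb{R}^g)$ is the set of $g$-tuples $X=(X_1,\dots,X_g)$ of real symmetric $n\times n$ matrices. For a symmetric matrix $Y$, $Y\succ 0$ (resp. $Y\succeq 0$) means positive definite (resp. semidefinite). For $A=(A_1,\dots,A_g)\in\mathbb{S}_d(\mathbb{R}^g)$, $L_A(x)=\sum_{j=1}^g A_jx_j$, where $x=(x_1,\dots,x_g)$ are freely noncommuting variables, evaluated at $X\in\mathbb{S}_n(\mathbb{R}^g)$ by $L_A(X)=\sum_j A_j\otimes X_j$ (Kronecker product). For a $d\times d$ matrix $J$, $J-L_A(X)$ means $J\otimes I_n-L_A(X)$; in particular $I-L_{\mathbb{A}}(X)=I_m\otimes I_n-\sum_j\mathbb{A}_j\otimes X_j$. Symmetric descriptor realization: an expression $r=D+C^T(J-L_A(x))^{-1}C$, where $J$ is a $d\times d$ real matrix with $J=J^T$, $J^2=I$, $A\in\mathbb{S}_d(\mathbb{R}^g)$, $C$ is a real $d\times\ell$ matrix and $D$ is a real $\ell\times\ell$ matrix. Its invertibility set is $\mathfrak{I}_{J-L_A(x)}(n)=\{X\in\mathbb{S}_n(\mathbb{R}^g): J-L_A(X)\text{ is invertible}\}$ (open and dense in $\mathbb{S}_n(\mathbb{R}^g)$), and for $X$ in this set $r(X)=D\otimes I_n+(C^T\otimes I_n)(J-L_A(X))^{-1}(C\otimes I_n)$. The realization is minimal if $\{(JA)^wJC\mathtt{h}: w\text{ a word},\ \mathtt{h}\in\mathbb{R}^\ell\}$ spans $\mathbb{R}^d$;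 here words are elements of the free semigroup with identity on $x_1,\dots,x_g$, $JA=(JA_1,\dots,JA_g)$, and for a word $w=x_{i_1}\cdots x_{i_k}$ and a tuple $M$, $M^w=M_{i_1}\cdots M_{i_k}$ (identity for the empty word). Hidden singularities and limit domain: $\chi\in\mathbb{S}_n(\mathbb{R}^g)\setminus\mathfrak{I}_{J-L_A(x)}(n)$ is a hidden singularity of $r$ if $r(\chi):=\lim_{X\to\chi}r(X)$ exists, the limit being taken through $X\in\mathfrak{I}_{J-L_A(x)}(n)$. $\mathrm{Domlim}(r,n)$ is the union of $\mathfrak{I}_{J-L_A(x)}(n)$ and the set of hidden singularities of $r$ in $\mathbb{S}_n(\mathbb{R}^g)$. Set $\mathfrak{P}_r(n)=\{X\in\mathrm{Domlim}(r,n): r(X)\succ 0\}$. Rational expressions (analytic at $0$) and algebraic domain: rational expressions are defined recursively. Matrix-valued free polynomials $p=\sum_w P_w w$ (finite sums, real $k_1\times k_2$ coefficients, evaluated by $p(X)=\sum_w P_w\otimes X^w$) are rational expressions, as are formal sums and products of rational expressions of compatible matrix sizes, and the formal inverse $s^{-1}$ of a square-matrix-valued rational expression $s$ whose value $s(0)$ at $0$ is invertible (with $s^{-1}(0)=s(0)^{-1}$). The formal domain $\mathrm{Domfor}(s,n)\subseteq\mathbb{S}_n(\mathbb{R}^g)$ is the set of $X$ at which every inverse appearing in the construction of $s$ can be evaluated (i.e. the matrix to be inverted is invertible); it is all of $\mathbb{S}_n(\mathbb{R}^g)$ for a polynomial. Two rational expressions $s,t$ are equivalent if $s(X)=t(X)$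 for all $n$ and all $X\in\mathrm{Domfor}(s,n)\cap\mathrm{Domfor}(t,n)$. A descriptor realization $r$ is a rational expression with formal domain $\mathfrak{I}_{J-L_A(x)}(n)$. The algebraic domain $\mathrm{Domalg}(r,n)$ is the union of $\mathrm{Domfor}(s,n)$ over all rational expressions $s$ (analytic at $0$) equivalent to $r$; one has $\mathrm{Domalg}(r,n)\subseteq\mathrm{Domlim}(r,n)$, and for $X\in\mathrm{Domfor}(s,n)$ with $s$ equivalent to $r$, $r(X)=s(X)$. $\mathcal{D}_r(n)$ is the connected component containing $0$ of $\{X\in\mathrm{Domalg}(r,n): r(X)\succ 0\}$. A sequence $(\mathcal{D}(n))_n$ with $\mathcal{D}(n)\subseteq\mathbb{S}_n(\mathbb{R}^g)$ is bounded if there is $R\in\mathbb{R}$ such that $X_1^2+\dots+X_g^2\preceq R I_n$ for every $n$ and every $X\in\mathcal{D}(n)$. *)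

(* Defs.v *)
From mathcomp Require Import all_boot all_order all_algebra.
From mathcomp Require Import mxtens.
From mathcomp Require Import all_classical all_reals all_analysis.

Set Implicit Arguments.
Unset Strict Implicit.
Unset Printing Implicit Defensive.

Import Order.TTheory GRing.Theory Num.Theory.
Import numFieldNormedType.Exports.
(* Tuples of matrices ['I_g -> 'M[R]_n] carry the product topology, which, the
   index set being finite, is the Euclidean one. *)
Import ArrowAsProduct.

Local Open Scope classical_set_scope.
Local Open Scope ring_scope.

Definition symmetric (R : realType) (n : nat) (Y : 'M[R]_n) : Prop := Y^T = Y.

Definition posdef (R : realType) (n : nat) (Y : 'M[R]_n) : Prop :=
  symmetric Y /\
  forall v : 'cV[R]_n, v != 0 -> 0 < (v^T *m Y *m v) 0 0.

Definition possemidef (R : realType) (n : nat) (Y : 'M[R]_n) : Prop :=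
  symmetric Y /\ forall v : 'cV[R]_n, 0 <= (v^T *m Y *m v) 0 0.

Definition sym_tuples (R : realType) (g n : nat) : set ('I_g -> 'M[R]_n) :=
  [set X | forall j, symmetric (X j)].
Arguments sym_tuples {R g} n.

Definition word_eval (R : realType) (g n : nat) (X : 'I_g -> 'M[R]_n)
    (w : seq 'I_g) : 'M[R]_n :=
  \big[mulmx/1%:M]_(j <- w) X j.

Definition linear_pencil (R : realType) (g d n : nat) (A : 'I_g -> 'M[R]_d)
    (X : 'I_g -> 'M[R]_n) : 'M[R]_(d * n) :=
  \sum_(j < g) (A j *t X j).

(* [J - L_A(X)], the constant [J] being evaluated as its Kronecker product with
   the identity of size [n]. *)
Definition pencil (R : realType) (g d n : nat) (J : 'M[R]_d)
    (A : 'I_g -> 'M[R]_d) (X : 'I_g -> 'M[R]_n) : 'M[R]_(d * n) :=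
  J *t 1%:M - linear_pencil A X.

Record realization (R : realType) (g d l : nat) := Realization {
  rJ : 'M[R]_d;
  rA : 'I_g -> 'M[R]_d;
  rC : 'M[R]_(d, l);
  rD : 'M[R]_l;
  rJ_sym : symmetric rJ;
  rJ_sq : rJ *m rJ = 1%:M;
  rA_sym : sym_tuples d rA }.

Definition linear_span (K : fieldType) (V : vectType K) (S : set V) : set V :=
  [set v | exists s : seq V, (forall u, u \in s -> S u) /\ v \in span s].

Definition minimal (R : realType) (g d l : nat) (r : realization R g d l) :=
  linear_span [set v : 'cV[R]_d | exists (w : seq 'I_g) (h : 'cV[R]_l),
     v = word_eval (fun j => rJ r *m rA r j) w *m rJ r *m rC r *m h]
  = setT.

Definition inv_set (R : realType) (g d l : nat) (r : realization R g d l)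
    (n : nat) : set ('I_g -> 'M[R]_n) :=
  [set X | sym_tuples n X /\ pencil (rJ r) (rA r) X \in unitmx].
Arguments inv_set {R g d l} r n.

Definition reval (R : realType) (g d l : nat) (r : realization R g d l)
    (n : nat) (X : 'I_g -> 'M[R]_n) : 'M[R]_(l * n) :=
  rD r *t 1%:M
  + ((rC r)^T *t 1%:M) *m invmx (pencil (rJ r) (rA r) X) *m (rC r *t 1%:M).
Arguments reval {R g d l} r n X.

Definition hidden_singularity (R : realType) (g d l : nat)
    (r : realization R g d l) (n : nat) : set ('I_g -> 'M[R]_n) :=
  [set X | [/\ sym_tuples n X, ~ inv_set r n X &
     cvg (reval r n @ within (inv_set r n) (nbhs X))]].
Arguments hidden_singularity {R g d l} r n.

Definition Domlim (R : realType) (g d l : nat) (r : realization R g d l)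
    (n : nat) : set ('I_g -> 'M[R]_n) :=
  inv_set r n `|` hidden_singularity r n.
Arguments Domlim {R g d l} r n.

(* The value [r(X)] for [X] in [Domlim r n]. *)
Definition rvalue (R : realType) (g d l : nat) (r : realization R g d l)
    (n : nat) (X : 'I_g -> 'M[R]_n) : 'M[R]_(l * n) :=
  if `[< inv_set r n X >] then reval r n X
  else lim (reval r n @ within (inv_set r n) (nbhs X)).
Arguments rvalue {R g d l} r n X.

Definition Plim (R : realType) (g d l : nat) (r : realization R g d l)
    (n : nat) : set ('I_g -> 'M[R]_n) :=
  [set X | Domlim r n X /\ posdef (rvalue r n X)].
Arguments Plim {R g d l} r n.

(* A matrix-valued free polynomial is given by a finite list of terms
   [(w, P_w)]; words may repeat, in which case the terms add up. *)
Inductive rexpr (R : realType) (g : nat) : nat -> nat -> Type :=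
| RPoly k1 k2 of seq (seq 'I_g * 'M[R]_(k1, k2)) : rexpr R g k1 k2
| RAdd k1 k2 of rexpr R g k1 k2 & rexpr R g k1 k2 : rexpr R g k1 k2
| RMul k1 k2 k3 of rexpr R g k1 k2 & rexpr R g k2 k3 : rexpr R g k1 k3
| RInv k of rexpr R g k k : rexpr R g k k.

Fixpoint rexpr_eval (R : realType) (g k1 k2 : nat) (s : rexpr R g k1 k2)
    (n : nat) (X : 'I_g -> 'M[R]_n) : 'M[R]_(k1 * n, k2 * n) :=
  match s with
  | RPoly _ _ p => \sum_(t <- p) (t.2 *t word_eval X t.1)
  | RAdd _ _ s1 s2 => rexpr_eval s1 X + rexpr_eval s2 X
  | RMul _ _ _ s1 s2 => rexpr_eval s1 X *m rexpr_eval s2 X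
  | RInv _ s1 => invmx (rexpr_eval s1 X)
  end.

(* The value [s(0)], as a [k1 x k2] matrix. *)
Fixpoint rexpr_at0 (R : realType) (g k1 k2 : nat) (s : rexpr R g k1 k2) :
    'M[R]_(k1, k2) :=
  match s with
  | RPoly _ _ p => \sum_(t <- p | t.1 == [::]) t.2
  | RAdd _ _ s1 s2 => rexpr_at0 s1 + rexpr_at0 s2
  | RMul _ _ _ s1 s2 => rexpr_at0 s1 *m rexpr_at0 s2
  | RInv _ s1 => invmx (rexpr_at0 s1)
  end.

Fixpoint analytic_at0 (R : realType) (g k1 k2 : nat) (s : rexpr R g k1 k2) :
    Prop :=
  match s with
  | RPoly _ _ _ => True
  | RAdd _ _ s1 s2 => analytic_at0 s1 /\ analytic_at0 s2
  | RMul _ _ _ s1 s2 => analytic_at0 s1 /\ analytic_at0 s2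
  | RInv _ s1 => analytic_at0 s1 /\ rexpr_at0 s1 \in unitmx
  end.

Fixpoint evaluable (R : realType) (g k1 k2 : nat) (s : rexpr R g k1 k2)
    (n : nat) (X : 'I_g -> 'M[R]_n) : Prop :=
  match s with
  | RPoly _ _ _ => True
  | RAdd _ _ s1 s2 => evaluable s1 X /\ evaluable s2 X
  | RMul _ _ _ s1 s2 => evaluable s1 X /\ evaluable s2 X
  | RInv _ s1 => evaluable s1 X /\ rexpr_eval s1 X \in unitmx
  end.

Definition Domfor (R : realType) (g k1 k2 : nat) (s : rexpr R g k1 k2)
    (n : nat) : set ('I_g -> 'M[R]_n) :=
  [set X | sym_tuples n X /\ evaluable s X].
Arguments Domfor {R g k1 k2} s n.

Definition rexpr_equiv (R : realType) (g k1 k2 : nat)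
    (s t : rexpr R g k1 k2) : Prop :=
  forall n : nat, (0 < n)%N -> forall X : 'I_g -> 'M[R]_n,
    Domfor s n X -> Domfor t n X -> rexpr_eval s X = rexpr_eval t X.

Definition RConst (R : realType) (g k1 k2 : nat) (P : 'M[R]_(k1, k2)) :
    rexpr R g k1 k2 :=
  RPoly [:: ([::], P)].

Definition RPencil (R : realType) (g d : nat) (J : 'M[R]_d)
    (A : 'I_g -> 'M[R]_d) : rexpr R g d d :=
  RPoly (([::], J) :: [seq ([:: j], - A j) | j <- index_enum 'I_g]).

Definition realization_rexpr (R : realType) (g d l : nat)
    (r : realization R g d l) : rexpr R g l l :=
  RAdd (RConst g (rD r))
    (RMul (RMul (RConst g (rC r)^T) (RInv (RPencil (rJ r) (rA r))))
          (RConst g (rC r))).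

Definition Domalg (R : realType) (g d l : nat) (r : realization R g d l)
    (n : nat) : set ('I_g -> 'M[R]_n) :=
  [set X | exists s : rexpr R g l l,
     [/\ analytic_at0 s, rexpr_equiv s (realization_rexpr r) & Domfor s n X]].
Arguments Domalg {R g d l} r n.

Definition Dalg (R : realType) (g d l : nat) (r : realization R g d l)
    (n : nat) : set ('I_g -> 'M[R]_n) :=
  connected_component [set X | Domalg r n X /\ posdef (rvalue r n X)]
    (fun=> 0).
Arguments Dalg {R g d l} r n.

Definition bounded_seq (R : realType) (g : nat)
    (D : forall n, set ('I_g -> 'M[R]_n)) : Prop :=
  exists rho : R, forall n : nat, (0 < n)%N -> forall X : 'I_g -> 'M[R]_n,
    D n X -> possemidef (rho%:M - \sum_(j < g) X j *m X j).

(* The formal expression attached to a realization is analytic at [0] and has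
   the formal domain and the values of the realization. *)

Lemma rexpr_eval_const (R : realType) (g k1 k2 : nat) (P : 'M[R]_(k1, k2))
    (n : nat) (X : 'I_g -> 'M[R]_n) :
  rexpr_eval (RConst g P) X = P *t 1%:M.
Proof. by rewrite /RConst /= /word_eval big_cons !big_nil addr0. Qed.

Lemma rexpr_eval_pencil (R : realType) (g d : nat) (J : 'M[R]_d)
    (A : 'I_g -> 'M[R]_d) (n : nat) (X : 'I_g -> 'M[R]_n) :
  rexpr_eval (RPencil J A) X = pencil J A X.
Proof.
rewrite /= big_cons big_map /word_eval big_nil /pencil /linear_pencil.
congr (_ + _); rewrite -sumrN; apply: eq_bigr => j _ /=.
rewrite big_cons big_nil mulmx1; apply/matrixP => a b.
by rewrite !mxE mulNr.
Qed.

Lemma rexpr_eval_realization (R : realType) (g d l : nat)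
    (r : realization R g d l) (n : nat) (X : 'I_g -> 'M[R]_n) :
  rexpr_eval (realization_rexpr r) X = reval r n X.
Proof.
rewrite /realization_rexpr /reval -rexpr_eval_pencil.
by rewrite -!(rexpr_eval_const _ X).
Qed.

Lemma Domfor_realization (R : realType) (g d l : nat)
    (r : realization R g d l) (n : nat) :
  Domfor (realization_rexpr r) n = inv_set r n.
Proof.
rewrite /Domfor /inv_set; apply/seteqP; split=> X /= [sX].
  by case=> _ [[_ [_ +]] _]; rewrite -rexpr_eval_pencil.
by rewrite -rexpr_eval_pencil.
Qed.

Lemma analytic_at0_realization (R : realType) (g d l : nat)
    (r : realization R g d l) : analytic_at0 (realization_rexpr r).
Proof.
do 2!split => //=; split=> //; split=> //.
rewrite big_cons /= big_map /= big_pred0_eq addr0.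
by case: (mulmx1_unit (rJ_sq r)).
Qed.

(* Main.v *)
Require Import Defs.
From mathcomp Require Import all_boot all_order all_algebra.
From mathcomp Require Import mxtens.
From mathcomp Require Import all_classical all_reals all_analysis.
From mathcomp Require Import complex.
From mathcomp Require Import ring lra.
Import Order.TTheory GRing.Theory Num.Theory.
Local Open Scope ring_scope.
Set Implicit Arguments.
Unset Strict Implicit.
Unset Printing Implicit Defensive.

(* Both domains are families of convex sets of symmetric tuples, stable under direct
   sums and compressions to invariant subspaces, open along rays, and whose boundary
   points [X] admit [v <> 0] with [v = sum_j X_j v S_j], [S] being one of two tuples
   coming from the realization.

   Complexify, and split these tuples into irreducible ones.  Suppose that [S] is
   irreducible and singular at all boundary points near some [X] of large size.  For
   [X] generic and [v] of largest rank, first-order perturbation shows that the row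
   space of [v] is [S]-invariant, so [v] has full rank; the derivative of the gauge at
   [X] is then [H |-> tr (y sum_j H_j v S_j)] for a left kernel vector [y].  As it is
   real, there is a positive definite [G] with [S_j G = G S_j^*]; as it is a supporting
   functional, its second-order behaviour along compressions of [X (+) Y] by unitaries
   close to the identity gives [tr ((psi - sum_j Y_j psi S_j) G psi^* ) >= 0].  So [S]
   yields a linear matrix inequality valid on the family and violated beyond any
   boundary point where [S] is singular.  Finitely many closed singular sets cover
   the boundary, so every boundary point, padded by zeros, is detected by such an [S]. *)

(** Complexification is forced by duality: Hermitian matrices span all complex matrices, so the
    functional [H |-> tr (y sum_j H_j v S_j)] on Hermitian tuples determines each product [v S_j y],
    whereas real symmetric test matrices would miss its antisymmetric part. The boundary carries no
    smooth structure, so genericity means maximality of two integers, the rank of [1 - Lam] and then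
    that of a kernel vector, among nearby boundary points; the paths obtained are only controlled to
    order [t] for [t > 0], and comparison of orders replaces differentiation. Zero padding serves a
    dimension count: for [v] of rank [r] and width [k], invariance of its row space follows once
    [N - r > r k], which [N > k^2 + k] guarantees. The delicate closure property is stability under
    direct sums: membership involves limits in one case and expressions depending on the point in
    the other. Both times the remedy is that a ray meets the relevant singular sets in finitely many
    points. *)

(** * Entrywise norm of complex matrices *)

Section Mx1Norm.
Context {R : rcfType}.
Local Notation C := R[i].
Local Notation normc := (@Normc.normc R).

(** The entrywise l1 norm is submultiplicative and invariant under [mxvec], so estimates pass freely
    between matrices and the operators acting on their vectorisations. *)
Definition mnorm m n (A : 'M[C]_(m, n)) : R := \sum_i \sum_j normc (A i j).

Lemma normc_ge0 (x : C) : 0 <= normc x.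
Proof. by case: x => a b; apply: sqrtr_ge0. Qed.

Lemma normc_real (x : R) : normc x%:C%C = `|x|.
Proof. by rewrite /= expr0n /= addr0 sqrtr_sqr. Qed.

Lemma normc_sum (I : Type) (r : seq I) (P : pred I) (F : I -> C) :
  normc (\sum_(i <- r | P i) F i) <= \sum_(i <- r | P i) normc (F i).
Proof.
elim/big_ind2: _ => //; first by rewrite Normc.normc0.
by move=> x a y b Ha Hb; apply: le_trans (le_normcD _ _) (lerD Ha Hb).
Qed.

Lemma mnorm_ge0 m n (A : 'M[C]_(m, n)) : 0 <= mnorm A.
Proof. by apply: sumr_ge0 => i _; apply: sumr_ge0 => j _; apply: normc_ge0. Qed.

Lemma mnorm0 m n : mnorm (0 : 'M[C]_(m, n)) = 0.
Proof. by rewrite /mnorm !big1 // => i _; rewrite big1 // => j _; rewrite mxE Normc.normc0. Qed.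

Lemma entry_le_mnorm m n (A : 'M[C]_(m, n)) i j : normc (A i j) <= mnorm A.
Proof.
rewrite /mnorm (bigD1 i) //= (bigD1 j) //= -addrA lerDl addr_ge0 //.
  by apply: sumr_ge0 => ? _; apply: normc_ge0.
by apply: sumr_ge0 => ? _; apply: sumr_ge0 => ? _; apply: normc_ge0.
Qed.

Lemma mnorm_eq0 m n (A : 'M[C]_(m, n)) : mnorm A <= 0 -> A = 0.
Proof.
move=> h; apply/matrixP => i j; rewrite mxE; apply: Normc.eq0_normc.
by apply/eqP; rewrite eq_le normc_ge0 andbT (le_trans (entry_le_mnorm _ _ _) h).
Qed.

Lemma mnormD m n (A B : 'M[C]_(m, n)) : mnorm (A + B) <= mnorm A + mnorm B.
Proof.
rewrite /mnorm -big_split /=; apply: ler_sum => i _; rewrite -big_split /=.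
by apply: ler_sum => j _; rewrite mxE le_normcD.
Qed.

Lemma mnorm_sum m n (I : Type) (r : seq I) (P : pred I) (F : I -> 'M[C]_(m, n)) :
  mnorm (\sum_(i <- r | P i) F i) <= \sum_(i <- r | P i) mnorm (F i).
Proof.
elim/big_ind2: _ => //; first by rewrite mnorm0.
by move=> x a y b Ha Hb; apply: le_trans (mnormD _ _) (lerD Ha Hb).
Qed.

Lemma mnormZ m n (a : C) (A : 'M[C]_(m, n)) : mnorm (a *: A) = normc a * mnorm A.
Proof.
rewrite /mnorm mulr_sumr; apply: eq_bigr => i _; rewrite mulr_sumr.
by apply: eq_bigr => j _; rewrite mxE Normc.normcM.
Qed.

Lemma mnormN m n (A : 'M[C]_(m, n)) : mnorm (- A) = mnorm A.
Proof. by apply: eq_bigr => i _; apply: eq_bigr => j _; rewrite mxE normcN. Qed.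

Lemma mnormM m n p (A : 'M[C]_(m, n)) (B : 'M[C]_(n, p)) :
  mnorm (A *m B) <= mnorm A * mnorm B.
Proof.
rewrite /mnorm mulr_suml; apply: ler_sum => i _; rewrite mulr_suml.
have le1 j : normc ((A *m B) i j) <= \sum_k normc (A i k) * normc (B k j).
  rewrite mxE; apply: le_trans (normc_sum _ _ _) _.
  by apply: ler_sum => k _; rewrite Normc.normcM.
apply: le_trans (ler_sum _ (fun j _ => le1 j)) _.
rewrite exchange_big /=; apply: ler_sum => k _; rewrite -mulr_sumr.
apply: ler_wpM2l; first exact: normc_ge0.
rewrite [leRHS](bigD1 k) //= lerDl.
by apply: sumr_ge0 => ? _; apply: sumr_ge0 => ? _; apply: normc_ge0.
Qed.

Lemma mnorm_mxvec m n (A : 'M[C]_(m, n)) : mnorm (mxvec A) = mnorm A.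
Proof.
rewrite /mnorm big_ord1 (reindex _ (curry_mxvec_bij m n)) /= pair_bigA /=.
by apply: eq_bigr => -[i j] _; rewrite mxvecE.
Qed.

Lemma mnorm_trace n (A : 'M[C]_n) : normc (\tr A) <= mnorm A.
Proof.
rewrite /mxtrace; apply: le_trans (normc_sum _ _ _) _; apply: ler_sum => i _.
by rewrite (bigD1 i) //= lerDl; apply: sumr_ge0 => ? _; apply: normc_ge0.
Qed.

End Mx1Norm.

(** * One-sided asymptotics at zero *)

Section BigO.
Context {R : rcfType}.
Local Notation C := R[i].
Local Notation normc := (@Normc.normc R).

(** Only [t > 0] is considered and no continuity is asked: the paths to be estimated are produced by
    choice, separately for each [t]. *)
Definition isO (e : nat) m n (F : R -> 'M[C]_(m, n)) : Prop :=
  exists c d : R, [/\ 0 <= c, 0 < d & forall t, 0 < t -> t < d -> mnorm (F t) <= c * t ^+ e].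

Definition isOs (e : nat) (a : R -> C) : Prop :=
  exists c d : R, [/\ 0 <= c, 0 < d & forall t, 0 < t -> t < d -> normc (a t) <= c * t ^+ e].

Lemma isO_near e m n (F G : R -> 'M[C]_(m, n)) (d : R) : 0 < d ->
  (forall t, 0 < t -> t < d -> F t = G t) -> isO e F -> isO e G.
Proof.
move=> d0 FG [c [d' [c0 d'0 H]]]; exists c, (Num.min d d').
split=> //; first by rewrite lt_min d0.
by move=> t t0; rewrite lt_min => /andP[td td']; rewrite -FG // H.
Qed.

Lemma isO_eq e m n (F G : R -> 'M[C]_(m, n)) : F =1 G -> isO e F -> isO e G.
Proof. by move=> FG; apply: (@isO_near _ _ _ _ _ 1). Qed.

Lemma isO_cst m n (A : 'M[C]_(m, n)) : isO 0 (fun=> A).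
Proof. by exists (mnorm A), 1; split=> // [|t _ _]; rewrite ?mnorm_ge0 // expr0 mulr1. Qed.

Lemma isO0 e m n : isO e (fun=> 0 : 'M[C]_(m, n)).
Proof. by exists 0, 1; split=> // t _ _; rewrite mnorm0 mul0r. Qed.

Lemma isOD e m n (F G : R -> 'M[C]_(m, n)) :
  isO e F -> isO e G -> isO e (fun t => F t + G t).
Proof.
move=> [c [d [c0 d0 H]]] [c' [d' [c0' d0' H']]].
exists (c + c'), (Num.min d d'); split; [exact: addr_ge0|by rewrite lt_min d0|].
move=> t t0; rewrite lt_min => /andP[td td'].
by rewrite mulrDl; apply: le_trans (mnormD _ _) (lerD (H _ _ _) (H' _ _ _)).
Qed.

Lemma isON e m n (F : R -> 'M[C]_(m, n)) : isO e F -> isO e (fun t => - F t).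
Proof. by move=> [c [d [c0 d0 H]]]; exists c, d; split=> // t; rewrite mnormN; apply: H. Qed.

Lemma isOB e m n (F G : R -> 'M[C]_(m, n)) :
  isO e F -> isO e G -> isO e (fun t => F t - G t).
Proof. by move=> hF hG; apply: isOD => //; apply: isON. Qed.

Lemma isO_sum e m n (I : Type) (r : seq I) (F : I -> R -> 'M[C]_(m, n)) :
  (forall i, isO e (F i)) -> isO e (fun t => \sum_(i <- r) F i t).
Proof.
move=> H; elim: r => [|i r IH].
  by apply: isO_eq (isO0 e m n) => t; rewrite big_nil.
by apply: isO_eq (isOD (H i) IH) => t; rewrite big_cons.
Qed.

Lemma isOM e e' m n p (F : R -> 'M[C]_(m, n)) (G : R -> 'M[C]_(n, p)) :
  isO e F -> isO e' G -> isO (e + e') (fun t => F t *m G t).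
Proof.
move=> [c [d [c0 d0 H]]] [c' [d' [c0' d0' H']]].
exists (c * c'), (Num.min d d'); split; [exact: mulr_ge0|by rewrite lt_min d0|].
move=> t t0; rewrite lt_min => /andP[td td'].
rewrite exprD mulrACA; apply: le_trans (mnormM _ _) _.
by apply: ler_pM; rewrite ?mnorm_ge0 ?H ?H'.
Qed.

Lemma isOZ e e' m n (a : R -> C) (G : R -> 'M[C]_(m, n)) :
  isOs e a -> isO e' G -> isO (e + e') (fun t => a t *: G t).
Proof.
move=> [c [d [c0 d0 H]]] [c' [d' [c0' d0' H']]].
exists (c * c'), (Num.min d d'); split; [exact: mulr_ge0|by rewrite lt_min d0|].
move=> t t0; rewrite lt_min => /andP[td td'].
rewrite exprD mulrACA mnormZ.
by apply: ler_pM; rewrite ?mnorm_ge0 ?normc_ge0 ?H ?H'.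
Qed.

Lemma isO_le e e' m n (F : R -> 'M[C]_(m, n)) : (e' <= e)%N -> isO e F -> isO e' F.
Proof.
move=> ee [c [d [c0 d0 H]]]; exists c, (Num.min d 1).
split=> //; first by rewrite lt_min d0 ltr01.
move=> t t0; rewrite lt_min => /andP[td t1].
apply: le_trans (H t t0 td) _; apply: ler_wpM2l => //.
by apply: ler_wiXn2l => //; apply: ltW.
Qed.

Lemma isOs_t : isOs 1 (fun t => t%:C%C).
Proof.
exists 1, 1; split=> // t t0 _.
by rewrite normc_real mul1r expr1 ger0_norm // ltW.
Qed.

Lemma isOs_mx e (a : R -> C) : isOs e a -> isO e (fun t => (a t)%:M : 'M[_]_1).
Proof.
move=> [c [d [c0 d0 H]]]; exists c, d; split=> // t t0 td.
by rewrite /mnorm !big_ord1 mxE /= mulr1n H.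
Qed.

Lemma isO_trace e n (F : R -> 'M[C]_n) : isO e F -> isOs e (fun t => \tr (F t)).
Proof.
move=> [c [d [c0 d0 H]]]; exists c, d; split=> // t t0 td.
exact: le_trans (mnorm_trace _) (H _ _ _).
Qed.

Lemma isO_mxvec e m n (F : R -> 'M[C]_(m, n)) : isO e F -> isO e (fun t => mxvec (F t)).
Proof.
by move=> [c [d [c0 d0 H]]]; exists c, d; split=> // t t0 td; rewrite mnorm_mxvec H.
Qed.

(** This replaces differentiation: a leading coefficient vanishes once its term is known to be of
    higher order. *)
Lemma isO_lim0 e m n (A : 'M[C]_(m, n)) :
  isO e.+1 (fun t => (t%:C%C) ^+ e *: A) -> A = 0.
Proof.
move=> [c [d [c0 d0 H]]]; apply: mnorm_eq0; rewrite leNgt; apply/negP => A0.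
set t := Num.min (d / 2) (mnorm A / (c + 1) / 2).
have c1 : 0 < c + 1 by rewrite ltr_wpDl.
have t0 : 0 < t by rewrite /t lt_min !divr_gt0 ?mulr_gt0 ?invr_gt0.
have td : t < d.
  by apply: le_lt_trans (_ : d / 2 < d); [rewrite /t ge_min lexx|lra].
have := H t t0 td.
rewrite mnormZ -rmorphXn normc_real ger0_norm; last by rewrite exprn_ge0 // ltW.
rewrite (exprS t e) mulrC mulrA ler_pM2r ?exprn_gt0 // => h.
have : c * t < mnorm A.
  have ht : t <= mnorm A / (c + 1) / 2 by rewrite /t ge_min lexx orbT.
  have : (c + 1) * t <= mnorm A / 2.
    apply: le_trans (ler_wpM2l (ltW c1) ht) _.
    by rewrite [(mnorm A / _) / 2]mulrAC mulrCA mulfV ?mulr1 // gt_eqF.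
  nra.
by rewrite ltNge h.
Qed.

(** Once [F t - 1] has norm at most 1/2, a row vector killed by [F t] satisfies
    [mnorm x <= mnorm x / 2]; the same identity for the inverse bounds it by twice the norm of the
    identity matrix. *)
Lemma isO_invmx n (F : R -> 'M[C]_n) : isO 1 (fun t => F t - 1%:M) ->
  (exists2 d, 0 < d & forall t, 0 < t -> t < d -> F t \in unitmx) /\
  isO 0 (fun t => invmx (F t)).
Proof.
move=> [c [d [c0 d0 H]]].
pose d' := Num.min d (1 / (2 * (c + 1))).
have c1 : 0 < c + 1 by rewrite ltr_wpDl.
have d'0 : 0 < d' by rewrite lt_min d0 divr_gt0 // mulr_gt0.
have small t : 0 < t -> t < d' -> mnorm (F t - 1%:M) <= 1 / 2.
  rewrite lt_min => t0 /andP[td]; rewrite ltr_pdivlMr ?mulr_gt0 // => h.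
  by apply: le_trans (H t t0 td) _; rewrite expr1; nra.
have unitF t : 0 < t -> t < d' -> F t \in unitmx.
  move=> t0 td; rewrite -row_free_unit -kermx_eq0; apply/eqP/row_matrixP => i.
  rewrite row0; set x := row i _.
  have xF : x *m F t = 0 by apply/sub_kermxP; rewrite row_sub.
  have xE : x = - (x *m (F t - 1%:M)) by rewrite mulmxBr xF mulmx1 sub0r opprK.
  apply: mnorm_eq0; have := small t t0 td.
  have : mnorm x <= mnorm x * mnorm (F t - 1%:M) by rewrite {1}xE mnormN mnormM.
  have := mnorm_ge0 x; nra.
split; first by exists d'.
exists (2 * mnorm (1%:M : 'M[C]_n)), d'; split=> //.
  by rewrite mulr_ge0 ?mnorm_ge0.
move=> t t0 td; rewrite expr0 mulr1; set b := invmx _.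
have bE : b = 1%:M - b *m (F t - 1%:M).
  by rewrite mulmxBr mulVmx ?unitF // mulmx1 opprB addrCA subrr addr0.
have : mnorm b <= mnorm (1%:M : 'M[C]_n) + mnorm b * mnorm (F t - 1%:M).
  by rewrite {1}bE; apply: le_trans (mnormD _ _) _; rewrite mnormN lerD2l mnormM.
have := small t t0 td; have := mnorm_ge0 b; nra.
Qed.

End BigO.

(** * Conjugate transposition *)

Section Adjoint.
Context {R : rcfType}.
Local Notation C := R[i].

Definition adj m n (A : 'M[C]_(m, n)) : 'M[C]_(n, m) := map_mx (@conjc R) A^T.

Lemma adjM m n p (A : 'M[C]_(m, n)) (B : 'M[C]_(n, p)) : adj (A *m B) = adj B *m adj A.
Proof. by rewrite /adj trmx_mul map_mxM. Qed.

Lemma adjD m n (A B : 'M[C]_(m, n)) : adj (A + B) = adj A + adj B.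
Proof. by rewrite /adj linearD map_mxD. Qed.

Lemma adjN m n (A : 'M[C]_(m, n)) : adj (- A) = - adj A.
Proof. by rewrite /adj linearN map_mxN. Qed.

Lemma adjB m n (A B : 'M[C]_(m, n)) : adj (A - B) = adj A - adj B.
Proof. by rewrite adjD adjN. Qed.

Lemma adjZ m n (a : C) (A : 'M[C]_(m, n)) : adj (a *: A) = conjc a *: adj A.
Proof. by rewrite /adj linearZ map_mxZ. Qed.

Lemma adj_realZ m n (a : R) (A : 'M[C]_(m, n)) : adj (a%:C%C *: A) = a%:C%C *: adj A.
Proof. by rewrite adjZ conjc_real. Qed.

Lemma adjK m n (A : 'M[C]_(m, n)) : adj (adj A) = A.
Proof. by apply/matrixP => i j; rewrite !mxE conjcK. Qed.

Lemma adj1 n : adj (1%:M : 'M[C]_n) = 1%:M.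
Proof. by rewrite /adj trmx1 map_mx1. Qed.

Lemma adj0 m n : adj (0 : 'M[C]_(m, n)) = 0.
Proof. by rewrite /adj trmx0 map_mx0. Qed.

Lemma adj_sum m n (I : Type) (r : seq I) (P : pred I) (F : I -> 'M[C]_(m, n)) :
  adj (\sum_(i <- r | P i) F i) = \sum_(i <- r | P i) adj (F i).
Proof. by elim/big_rec2: _ => [|i A B _ <-]; rewrite ?adj0 ?adjD. Qed.

Lemma tr_adj n (A : 'M[C]_n) : \tr (adj A) = conjc (\tr A).
Proof. by rewrite /mxtrace rmorph_sum /=; apply: eq_bigr => i _; rewrite !mxE. Qed.

Lemma trace_pair_eq0 m n (A : 'M[C]_(m, n)) :
  (forall B : 'M[C]_(n, m), \tr (B *m A) = 0) -> A = 0.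
Proof.
move=> H; apply/matrixP => i j; rewrite mxE -(H (delta_mx j i)).
rewrite mxtrace_mulC /mxtrace (bigD1 i) //= mxE (bigD1 j) //= !mxE !eqxx mulr1.
rewrite big1 => [|k /negPf kj]; last by rewrite mxE kj mulr0.
rewrite big1 ?addr0 // => k /negPf ki.
by rewrite mxE big1 // => l _; rewrite mxE ki andbF mulr0.
Qed.

End Adjoint.

(** * Convex sets of Hermitian tuples and their radial boundary *)

Section Tuples.
Context {R : realType} {g : nat}.
Local Notation C := R[i].
Local Notation ctup n := ('I_g -> 'M[C]_n).
Implicit Type N : nat.

Definition hermT N (X : ctup N) : Prop := forall j, adj (X j) = X j.

Definition tscale N (s : R) (X : ctup N) : ctup N :=
  fun j => s%:C%C *: X j.

Definition tadd N (X Y : ctup N) : ctup N := fun j => X j + Y j.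

Definition tnorm N (X : ctup N) : R := \sum_j mnorm (X j).

Lemma tnorm_ge0 N (X : ctup N) : 0 <= tnorm X.
Proof. by apply: sumr_ge0 => j _; apply: mnorm_ge0. Qed.

Lemma tnormZ N s (X : ctup N) : tnorm (tscale s X) = `|s| * tnorm X.
Proof. by rewrite /tnorm mulr_sumr; apply: eq_bigr => j _; rewrite mnormZ normc_real. Qed.

Lemma tnormD N (X Y : ctup N) : tnorm (tadd X Y) <= tnorm X + tnorm Y.
Proof. by rewrite /tnorm -big_split; apply: ler_sum => j _; apply: mnormD. Qed.

Lemma hermT_scale N s (X : ctup N) : hermT X -> hermT (tscale s X).
Proof. by move=> hX j; rewrite adj_realZ hX. Qed.

Lemma hermT_add N (X Y : ctup N) : hermT X -> hermT Y -> hermT (tadd X Y).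
Proof. by move=> hX hY j; rewrite adjD hX hY. Qed.

Lemma tscaleA N s t (X : ctup N) : tscale s (tscale t X) = tscale (s * t) X.
Proof. by apply/funext => j; rewrite /tscale scalerA -rmorphM. Qed.

Lemma tscale1 N (X : ctup N) : tscale 1 X = X.
Proof. by apply/funext => j; rewrite /tscale rmorph1 scale1r. Qed.

(** Openness is required along rays only, which is what can be checked for the two domains; with
    convexity and the ball it suffices to control the gauge of [Q] as in [bdry_perturb]. *)
Record cvx_level N (Q : ctup N -> Prop) : Prop := CvxLevel {
  lvl_herm : forall X, Q X -> hermT X;
  lvl_cvx : forall X Y s, Q X -> Q Y -> 0 <= s -> s <= 1 ->
    Q (tadd (tscale s X) (tscale (1 - s) Y));
  lvl_ball : exists2 r, 0 < r & forall X, hermT X -> tnorm X <= r -> Q X;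
  lvl_open : forall X, Q X -> exists2 th, 1 < th & Q (tscale th X) }.

(** Points of gauge one, the boundary being taken along rays from the origin. *)
Definition bdry N (Q : ctup N -> Prop) (X : ctup N) : Prop :=
  [/\ hermT X, forall s, 0 <= s -> s < 1 -> Q (tscale s X) & ~ Q X].

Lemma lvl_scale N (Q : ctup N -> Prop) X s :
  cvx_level Q -> Q X -> 0 <= s -> s <= 1 -> Q (tscale s X).
Proof.
move=> [QH Qc [r r0 Qb] _] QX s0 s1.
have Q0 : Q (tscale 0 X).
  apply: Qb; first by apply: hermT_scale; apply: QH.
  by rewrite tnormZ normr0 mul0r ltW.
have := Qc _ _ _ QX Q0 s0 s1; congr Q; apply/funext => j.
by rewrite /tadd /tscale !rmorph0 !scale0r scaler0 addr0.
Qed.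

(** The scale is the supremum of all [c > 0] with [c X] in [Q]; it is not attained, since openness
    along the ray would push it further. *)
Lemma bdry_scale_exists N (Q : ctup N -> Prop) (X : ctup N) (a b : R) :
  cvx_level Q -> hermT X -> 0 < a -> (forall c, 0 <= c -> c < a -> Q (tscale c X)) ->
  (forall c, 0 < c -> Q (tscale c X) -> c <= b) ->
  exists2 c, a <= c <= b & bdry Q (tscale c X).
Proof.
move=> lQ hX a0 Ha Hb; have [QH Qc [r r0 Qb] Qo] := lQ.
pose A : set R := [set c | 0 < c /\ Q (tscale c X)]%classic.
have A0 : (A !=set0)%classic by exists (a / 2); split; [lra|apply: Ha; lra].
have Aub : has_ubound A by exists b => c [c0 Qc0]; apply: Hb.
have sA : has_sup A by [].
have below c : 0 <= c -> c < sup A -> Q (tscale c X).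
  move=> c0 csup; have [|e [e0 Qe] ce] := @sup_adherent _ A (sup A - c) _ sA; first lra.
  have {}ce : c <= e by lra.
  have -> : tscale c X = tscale (c / e) (tscale e X).
    by rewrite tscaleA divfK // gt_eqF.
  by apply: lvl_scale => //; [apply: divr_ge0 => //; exact: ltW|rewrite ler_pdivrMr // mul1r].
have supa : a <= sup A.
  rewrite leNgt; apply/negP => sa.
  have : (sup A + a) / 2 <= sup A.
    have h : 0 <= sup A.
      by have [c [c0 Qc0]] := A0; apply: le_trans (ltW c0) (ub_le_sup Aub _).
    by apply: ub_le_sup => //; split; [lra|apply: Ha; lra].
  lra.
exists (sup A).
  by rewrite supa /=; apply: ge_sup => // c [c0 Qc0]; apply: Hb.
split; first exact: hermT_scale.
  move=> s s0 s1; rewrite tscaleA; apply: below; first by rewrite mulr_ge0 //; lra.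
  by rewrite gtr_pMl //; lra.
move=> /Qo[th th1]; rewrite tscaleA => Qth.
have : th * sup A <= sup A by apply: ub_le_sup => //; split=> //; rewrite mulr_gt0 //; lra.
nra.
Qed.

(** The factor [gam] is the gauge of [X + E], so this is a Lipschitz estimate for the gauge at a
    boundary point. *)
Lemma bdry_perturb N (Q : ctup N -> Prop) (X : ctup N) :
  cvx_level Q -> bdry Q X ->
  exists2 K, 0 < K & forall (E : ctup N), hermT E -> K * tnorm E < 1 ->
    exists gam, [/\ 0 < gam, `|gam - 1| <= K * tnorm E &
      bdry Q (tscale gam^-1 (tadd X E))].
Proof.
move=> lQ [hX below QX]; have [QH Qc [r r0 Qb] Qo] := lQ.
(* With [eta = 2 / r * tnorm E], the tuple [E / eta] has norm [r / 2] and lies in the ball contained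
   in [Q]. *)
exists (2 / r) => [|E hE hK]; first by rewrite divr_gt0.
have [E0|Ene0] := eqVneq (tnorm E) 0.
  exists 1; rewrite E0 mulr0 subrr normr0 ltr01 invr1 tscale1; split=> //.
  suff -> : tadd X E = X by [].
  apply/funext => j; rewrite /tadd (_ : E j = 0) ?addr0 //; apply: mnorm_eq0.
  by rewrite -E0 /tnorm (bigD1 j) //= lerDl sumr_ge0 // => i _; apply: mnorm_ge0.
have Epos : 0 < tnorm E by rewrite lt_neqAle eq_sym Ene0 tnorm_ge0.
set eta := 2 / r * tnorm E in hK *.
have eta0 : 0 < eta by rewrite mulr_gt0 // divr_gt0.
have ballE c : `|c| <= 1 -> Q (tscale (c / eta) E).
  move=> c1; apply: Qb; first exact: hermT_scale.
  rewrite tnormZ normrM normfV (ger0_norm (ltW eta0)).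
  have -> : `|c| / eta * tnorm E = `|c| * (r / 2).
    by rewrite /eta; field; rewrite Ene0 /= gt_eqF.
  nra.
(* For small [c], [c (X + E)] is a convex combination of [c (1 + eta) X] and of a multiple of
   [E / eta]. For [c > 1 / (1 - eta)], [X] would be a scaled down convex combination of [c (X + E)]
   and [- E / eta], hence in [Q]. *)
have [c /andP[c1 c2] bc] : exists2 c, (1 + eta)^-1 <= c <= (1 - eta)^-1 &
    bdry Q (tscale c (tadd X E)).
  apply: bdry_scale_exists => //.
  - exact: hermT_add.
  - by rewrite invr_gt0; lra.
  - move=> c c0 clt.
    set s := c * (1 + eta).
    have s0 : 0 <= s by rewrite mulr_ge0 //; lra.
    have s1 : s < 1 by rewrite /s -ltr_pdivlMr ?div1r //; lra.
    have QEs : Q (tscale (s / eta) E) by apply: ballE; rewrite ger0_norm // ltW.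
    have e1 : 0 < 1 + eta by lra.
    have := Qc _ _ (1 + eta)^-1 (below s s0 s1) QEs.
    rewrite invr_ge0 invf_le1 // => /(_ (ltW e1)); rewrite lerDl => /(_ (ltW eta0)).
    congr Q; apply/funext => j; rewrite /tadd /tscale !scalerA -!rmorphM scalerDr.
    by congr (_%:C%C *: _ + _%:C%C *: _); rewrite /s; field; rewrite ?gt_eqF.
  - move=> c c0 QcX.
    rewrite leNgt; apply/negP => cgt; apply: QX.
    have e1 : 0 < 1 - eta by lra.
    have c'1 : c^-1 < 1 - eta.
      by rewrite -[1 - eta]invrK ltf_pV2 // posrE ?invr_gt0.
    have QEs : Q (tscale (-1 / eta) E) by apply: ballE; rewrite normrN normr1.
    set w := c^-1 in c'1.
    have w0 : 0 < w by rewrite invr_gt0.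
    have Qm := Qc _ _ (w / (w + eta)) QcX QEs.
    have we : 0 < w + eta by lra.
    have {Qm} Qm := Qm (ltW (divr_gt0 w0 we)).
    have {Qm} Qm := Qm ltac:(by rewrite ler_pdivrMr // mul1r; lra).
    have := @lvl_scale _ _ _ (w + eta) lQ Qm (ltW we) ltac:(lra).
    congr Q; apply/funext => j; rewrite /tadd /tscale.
    rewrite !scalerDr !scalerA -!rmorphM.
    have -> : (w + eta) * (w / (w + eta)) * c = 1.
      by rewrite [_ * (w / _)]mulrC divfK ?gt_eqF // /w mulVf // gt_eqF.
    have -> : (w + eta) * (1 - w / (w + eta)) * (-1 / eta) = -1.
      by field; rewrite ?gt_eqF.
    by rewrite rmorphN !rmorph1 !scale1r scaleN1r addrK.
have c0 : 0 < c by apply: lt_le_trans c1; rewrite invr_gt0; lra.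
exists c^-1; rewrite invr_gt0 invrK; split=> //.
have h1 : c^-1 <= 1 + eta by rewrite -[1 + eta]invrK lef_pV2 // posrE invr_gt0; lra.
have h2 : 1 - eta <= c^-1 by rewrite -[1 - eta]invrK lef_pV2 // posrE invr_gt0; lra.
by rewrite ler_norml; lra.
Qed.

End Tuples.

(** * Matrices of bounded rank near a fixed matrix *)

Section ConstantRank.
Context {F : fieldType}.

Lemma rank_normal_form m n (M0 : 'M[F]_(m, n)) :
  exists (A0 : 'M[_]_(\rank M0, m)) (B0 : 'M[_]_(n, \rank M0)), A0 *m M0 *m B0 = 1%:M.
Proof.
exists (pinvmx (col_base M0)), (pinvmx (row_base M0)).
have -> : pinvmx (col_base M0) *m M0 = row_base M0.
  by rewrite -[X in _ *m X = _](mulmx_base M0) mulmxA mulVpmx ?col_base_full // mul1mx.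
by rewrite mulmxVp // row_base_free.
Qed.

(** When the rank does not exceed [r], the invertible compression carries all of [M]: its Schur
    complement vanishes. Along a path, this formula turns a bound on ranks into estimates of
    orders. *)
Lemma low_rank_factor m n r (A0 : 'M[F]_(r, m)) (M : 'M[_]_(m, n)) (B0 : 'M[_]_(n, r)) :
  A0 *m M *m B0 \in unitmx -> (\rank M <= r)%N ->
  \rank M = r /\ M *m B0 *m invmx (A0 *m M *m B0) *m (A0 *m M) = M.
Proof.
move=> aU rM.
have rA : \rank (A0 *m M *m B0) = r by apply: mxrank_unit.
have rAM : (r <= \rank (A0 *m M))%N by rewrite -{1}rA mxrankM_maxl.
have rAM' : (\rank (A0 *m M) <= \rank M)%N by rewrite mxrankM_maxr.
have eqr : \rank M = r by apply/eqP; rewrite eqn_leq rM (leq_trans rAM).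
split=> //.
have /submxP[Z ZE] : (M <= A0 *m M)%MS.
  have := mxrank_leqif_sup (submxMl A0 M); move/geq_leqif => <-.
  by rewrite eqr.
have -> : M *m B0 = Z *m (A0 *m M *m B0) by rewrite {1}ZE !mulmxA.
by rewrite mulmxK // -ZE.
Qed.

End ConstantRank.

(** * Persistence of kernel vectors *)

Section KernelPath.
Context {R : rcfType}.
Local Notation C := R[i].

(** The correction subtracted from [v0] is the one dictated by [low_rank_factor]: it makes the
    product with [M t] exactly zero, and it is [O(t)] because [v0 M t = v0 (M t - M0)]. *)
Lemma isO_kernel_path n (M : R -> 'M[C]_n) (M0 : 'M[C]_n) (v0 : 'rV[C]_n) (d : R) :
  0 < d -> isO 1 (fun t => M t - M0) ->
  (forall t, 0 < t -> t < d -> (\rank (M t) <= \rank M0)%N) -> v0 *m M0 = 0 ->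
  exists (v : R -> 'rV[C]_n) (d' : R), [/\ 0 < d', isO 1 (fun t => v t - v0) &
    forall t, 0 < t -> t < d' -> v t *m M t = 0 /\ \rank (M t) = \rank M0].
Proof.
move=> d0 OM rM v0M.
have [A0 [B0 AB]] := rank_normal_form M0.
pose a t := A0 *m M t *m B0.
have Oa : isO 1 (fun t => a t - 1%:M).
  apply: isO_eq (isOM (isOM (isO_cst A0) OM) (isO_cst B0)) => t.
  by rewrite /a mulmxBr mulmxBl AB.
have [[d1 d10 aU] Oinv] := isO_invmx Oa.
exists (fun t => v0 - v0 *m M t *m B0 *m invmx (a t) *m A0), (Num.min d d1).
split; first by rewrite lt_min d0.
  have Ov : isO 1 (fun t => v0 *m M t).
    by apply: isO_eq (isOM (isO_cst v0) OM) => t; rewrite mulmxBr v0M subr0.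
  apply: isO_eq (isON (isOM (isOM (isOM Ov (isO_cst B0)) Oinv) (isO_cst A0))) => t /=.
  by rewrite addrC addKr.
move=> t t0; rewrite lt_min => /andP[td td1].
have [rE fE] := low_rank_factor (aU t t0 td1) (rM t t0 td).
split=> //; apply/eqP; rewrite mulmxBl subr_eq0 -{1}fE; apply/eqP.
by rewrite !mulmxA.
Qed.

End KernelPath.

(** * The operator attached to a pair of tuples and its singularity *)

Section Lam.
Context {F : fieldType} {g : nat}.

Definition Lam N k (X : 'I_g -> 'M[F]_N) (S : 'I_g -> 'M[F]_k) (v : 'M[F]_(N, k)) :=
  \sum_j X j *m v *m S j.

(** The matrix of [Lam X S] on vectorised matrices, where rank and invertibility are available. *)
Definition LamM N k (X : 'I_g -> 'M[F]_N) (S : 'I_g -> 'M[F]_k) : 'M[F]_(N * k) :=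
  \sum_j lin_mulmx (X j) *m lin_mulmxr (S j).

Lemma mul_LamM N k (X : 'I_g -> 'M[F]_N) (S : 'I_g -> 'M[F]_k) v :
  mxvec v *m LamM X S = mxvec (Lam X S v).
Proof.
rewrite /LamM mulmx_sumr /Lam linear_sum; apply: eq_bigr => j _.
by rewrite mulmxA mul_vec_lin mul_vec_lin.
Qed.

Lemma LamD N k (X : 'I_g -> 'M[F]_N) (S : 'I_g -> 'M[F]_k) v w :
  Lam X S (v + w) = Lam X S v + Lam X S w.
Proof. by rewrite /Lam -big_split; apply: eq_bigr => j _; rewrite mulmxDr mulmxDl. Qed.

Lemma LamZ N k (X : 'I_g -> 'M[F]_N) (S : 'I_g -> 'M[F]_k) a v :
  Lam X S (a *: v) = a *: Lam X S v.
Proof. by rewrite /Lam scaler_sumr; apply: eq_bigr => j _; rewrite -scalemxAr -scalemxAl. Qed.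

Lemma LamN N k (X : 'I_g -> 'M[F]_N) (S : 'I_g -> 'M[F]_k) v :
  Lam X S (- v) = - Lam X S v.
Proof. by rewrite -!scaleN1r LamZ. Qed.

Lemma LamB N k (X : 'I_g -> 'M[F]_N) (S : 'I_g -> 'M[F]_k) v w :
  Lam X S (v - w) = Lam X S v - Lam X S w.
Proof. by rewrite LamD LamN. Qed.

Definition sing N k (S : 'I_g -> 'M[F]_k) (X : 'I_g -> 'M[F]_N) : Prop :=
  exists2 v, v != 0 & Lam X S v = v.

Definition lam_rank N k (X : 'I_g -> 'M[F]_N) (S : 'I_g -> 'M[F]_k) : nat :=
  \rank (1%:M - LamM X S).

Lemma sing_unit N k (S : 'I_g -> 'M[F]_k) (X : 'I_g -> 'M[F]_N) :
  sing S X <-> (1%:M - LamM X S) \notin unitmx.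
Proof.
split=> [[v v0 vE]|].
  apply/negP => U; case/eqP: v0; apply: (can_inj mxvecK); rewrite linear0.
  by rewrite -[mxvec v](mulmxK U) mulmxBr mulmx1 mul_LamM vE subrr mul0mx.
rewrite -row_free_unit -kermx_eq0 => /rowV0Pn[w /sub_kermxP wM w0].
exists (vec_mx w).
  by apply: contra_neq w0 => /(congr1 mxvec); rewrite vec_mxK linear0.
apply: (can_inj mxvecK); rewrite -mul_LamM vec_mxK.
by apply/eqP; rewrite eq_sym -subr_eq0 -{1}[w]mulmx1 -mulmxBr wM.
Qed.

Definition irred k (S : 'I_g -> 'M[F]_k) : Prop :=
  (0 < k)%N /\ forall r (U : 'M[F]_(r, k)),
    (forall j, (U *m S j <= U)%MS) -> U = 0 \/ row_full U.

End Lam.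

(** * Paths in the boundary carrying kernel vectors *)

Section BoundaryPath.
Context {R : realType} {g : nat}.
Local Notation C := R[i].
Local Notation ctup n := ('I_g -> 'M[C]_n).

Lemma LamM_tadd N k (X H : ctup N) (S : ctup k) (t : R) :
  LamM (tadd X (tscale t H)) S = LamM X S + t%:C%C *: LamM H S.
Proof.
rewrite /LamM scaler_sumr -big_split; apply: eq_bigr => j _.
by rewrite /tadd /tscale linearD linearZ /= mulmxDl scalemxAl.
Qed.

Lemma Lam_tadd N k (X H : ctup N) (S : ctup k) v :
  Lam (tadd X H) S v = Lam X S v + Lam H S v.
Proof. by rewrite /Lam -big_split; apply: eq_bigr => j _; rewrite !mulmxDl. Qed.

Lemma Lam_tscale N k (X : ctup N) (S : ctup k) (t : R) v :
  Lam (tscale t X) S v = t%:C%C *: Lam X S v.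
Proof. by rewrite /Lam scaler_sumr; apply: eq_bigr => j _; rewrite -!scalemxAl. Qed.

Lemma LamM_tscale N k (X : ctup N) (S : ctup k) (t : R) :
  LamM (tscale t X) S = t%:C%C *: LamM X S.
Proof.
rewrite /LamM scaler_sumr; apply: eq_bigr => j _.
by rewrite /tscale linearZ /= scalemxAl.
Qed.

Lemma exists_max (P : nat -> Prop) b n0 : P n0 -> (forall n, P n -> (n <= b)%N) ->
  exists2 n, P n & forall n', P n' -> (n' <= n)%N.
Proof.
move=> Pn0 Pb.
have ex : exists n, `[< P n >] by exists n0; apply/asboolP.
have ub n : `[< P n >] -> (n <= b)%N by move=> /asboolP /Pb.
case: (ex_maxnP ex ub) => n /asboolP Pn nmax.
by exists n => // n' Pn'; apply: nmax; apply/asboolP.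
Qed.

(** Two successive maximisations of bounded integers stand in for genericity: first the rank of
    [1 - LamM], then the rank of a kernel vector among the points where the first maximum is
    attained. Both maxima range over all of [B], so they bound ranks along any path inside [B]. *)
Lemma generic_point N k (S : ctup k) (B : ctup N -> Prop) X0 :
  B X0 -> (forall X, B X -> sing S X) ->
  exists X v, [/\ B X, v != 0, Lam X S v = v,
    forall X', B X' -> (lam_rank X' S <= lam_rank X S)%N &
    forall X' v', B X' -> lam_rank X' S = lam_rank X S ->
      Lam X' S v' = v' -> (\rank v' <= \rank v)%N].
Proof.
move=> BX0 sB.
have [_ [X1 BX1 ->] maxr] := @exists_max
  (fun n => exists2 X, B X & n = lam_rank X S) (N * k) _
  (ex_intro2 _ _ X0 BX0 erefl)
  ltac:(by move=> n [X _ ->]; apply: rank_leq_row).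
have [v1 v1_0 v1E] := sB _ BX1.
have [rho [[X v] /= [BX [rX [vE vrk]]]] maxrho] := @exists_max
  (fun n => exists Xv : (ctup N) * 'M[_]_(N, k), B Xv.1 /\
    lam_rank Xv.1 S = lam_rank X1 S /\
    Lam Xv.1 S Xv.2 = Xv.2 /\ n = \rank Xv.2) N (\rank v1)
  (ex_intro _ (X1, v1) (conj BX1 (conj erefl (conj v1E erefl))))
  ltac:(by move=> n [Xv [_ [_ [_ ->]]]]; apply: rank_leq_row).
exists X, v; split; [exact: BX| |exact: vE| |].
- rewrite -mxrank_eq0 -lt0n -vrk; apply: leq_trans (maxrho (\rank v1) _).
    by rewrite lt0n mxrank_eq0.
  exact: (ex_intro _ (X1, v1) (conj BX1 (conj erefl (conj v1E erefl)))).
- move=> X' BX'; rewrite rX; apply: maxr.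
  exact: (ex_intro2 _ _ X' BX' erefl).
- move=> X' v' BX' rX' v'E; rewrite -vrk; apply: maxrho.
  exact: (ex_intro _ (X', v') (conj BX' (conj (etrans rX' rX) (conj v'E erefl)))).
Qed.

(** Moving from [X] in the direction [H] and dividing by the gauge stays in the boundary. By
    maximality the rank of [1 - LamM] does not grow there, so [v] is carried along as a kernel
    vector, and its rank does not grow either. *)
Lemma boundary_path N k (Q : ctup N -> Prop) (S : ctup k) X0 X e v H :
  cvx_level Q -> bdry Q X -> tnorm (tadd X (tscale (-1) X0)) < e -> Lam X S v = v ->
  (forall X', bdry Q X' -> tnorm (tadd X' (tscale (-1) X0)) < e ->
    (lam_rank X' S <= lam_rank X S)%N) ->
  (forall X' v', bdry Q X' -> tnorm (tadd X' (tscale (-1) X0)) < e ->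
    lam_rank X' S = lam_rank X S ->
    Lam X' S v' = v' -> (\rank v' <= \rank v)%N) ->
  hermT H ->
  exists (gam : R -> R) (vt : R -> 'M[C]_(N, k)) (d : R),
    [/\ 0 < d, isO 1 (fun t => vt t - v), isOs 1 (fun t => (gam t - 1)%:C%C) &
    forall t, 0 < t -> t < d ->
    [/\ 0 < gam t, bdry Q (tscale (gam t)^-1 (tadd X (tscale t H))),
       (gam t)%:C%C *: vt t = Lam (tadd X (tscale t H)) S (vt t) &
       (\rank (vt t) <= \rank v)%N]].
Proof.
move=> lQ bX Xe vE maxr maxrho hH.
have [K K0 HK] := bdry_perturb lQ bX.
set h := tnorm H; have h0 : 0 <= h by apply: tnorm_ge0.
pose KH := K * h.
have KH0 : 0 <= KH by rewrite mulr_ge0 // ltW.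
set room := e - tnorm (tadd X (tscale (-1) X0)).
have room0 : 0 < room by rewrite subr_gt0.
pose L := 2 * KH * tnorm X + 2 * h.
have L0 : 0 <= L by have := mulr_ge0 KH0 (tnorm_ge0 X); rewrite /L; lra.
(* The first bound gives [KH * t < 1 / 2], hence [gm > 1 / 2] and [gm^-1 < 2]; the second keeps the
   rescaled point within [e] of [X0], [L] being a Lipschitz constant for that motion. *)
pose d0 := Num.min ((2 * (KH + 1))^-1) (room / (L + 1)).
have d0_gt0 : 0 < d0.
  rewrite lt_min; apply/andP; split; first by rewrite invr_gt0; lra.
  by rewrite divr_gt0 // ltr_wpDl.
pose Pg t gm := [/\ 0 < gm, `|gm - 1| <= KH * t,
  bdry Q (tscale gm^-1 (tadd X (tscale t H))) &
  tnorm (tadd (tscale gm^-1 (tadd X (tscale t H))) (tscale (-1) X0)) < e].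
have exg t : exists gm, 0 < t -> t < d0 -> Pg t gm.
  have [t0|] := ltP 0 t; last by exists 0.
  have [td|] := ltP t d0; last by exists 0.
  move: td; rewrite lt_min => /andP[td1 td2].
  have tKH : KH * t < 1 / 2.
    move: td1; rewrite -[_^-1]div1r ltr_pdivlMr; last by lra.
    by move=> td1; nra.
  have nE : K * tnorm (tscale t H) = KH * t.
    by rewrite tnormZ ger0_norm ?(ltW t0) // /KH -/h; ring.
  have [gm [gm0 gm1 bgm]] := HK _ (hermT_scale t hH) ltac:(by rewrite nE; lra).
  exists gm => _ _; rewrite nE in gm1; split=> //.
  have gmh : 1 / 2 < gm by move: gm1; rewrite ler_norml => /andP[]; lra.
  have gi2 : gm^-1 < 2.
    by rewrite -div1r ltr_pdivrMr //; lra.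
  have gi0 : 0 < gm^-1 by rewrite invr_gt0.
  have gi1 : `|gm^-1 - 1| <= 2 * (KH * t).
    have -> : gm^-1 - 1 = gm^-1 * (1 - gm) by rewrite mulrBr mulr1 mulVf // gt_eqF.
    rewrite normrM (ger0_norm (ltW gi0)) distrC; apply: ler_pM => //; exact: ltW.
  have -> : tadd (tscale gm^-1 (tadd X (tscale t H))) (tscale (-1) X0) =
    tadd (tadd X (tscale (-1) X0)) (tadd (tscale (gm^-1 - 1) X) (tscale (gm^-1 * t) H)).
    apply/funext => j; rewrite /tadd /tscale rmorphB rmorphM rmorph1.
    by apply/matrixP => p q; rewrite !mxE; ring.
  apply: le_lt_trans (tnormD _ _) _; rewrite -ltrBrDl -/room.
  apply: le_lt_trans (tnormD _ _) _; rewrite !tnormZ normrM.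
  rewrite (ger0_norm (ltW gi0)) (ger0_norm (ltW t0)) -/h.
  have hL : t * L < room by move: td2; rewrite ltr_pdivlMr; [nra|lra].
  apply: le_lt_trans hL; rewrite /L mulrDr; apply: lerD.
    apply: le_trans (ler_wpM2r (tnorm_ge0 _) gi1) _.
    by rewrite le_eqVlt; apply/orP; left; apply/eqP; ring.
  by have := mulr_ge0 (ltW t0) h0; nra.
have [gam Hgam] := choice exg.
have Og : isOs 1 (fun t => (gam t - 1)%:C%C).
  exists KH, d0; split=> // t t0 td; have [_ h1 _ _] := Hgam t t0 td.
  by rewrite normc_real expr1.
(* Multiplying through by [gam] makes [M t] an [O(t)] perturbation of [1 - LamM X S], while keeping
   the rank of the operator at the rescaled boundary point. *)
pose M t := (gam t)%:C%C *: 1%:M - LamM (tadd X (tscale t H)) S.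
have OM : isO 1 (fun t => M t - (1%:M - LamM X S)).
  have O1 := isOZ Og (isO_cst (1%:M : 'M[C]_(N * k))).
  have O2 := isOZ isOs_t (isO_cst (LamM H S)).
  apply: isO_eq (isOB O1 O2) => t.
  rewrite /M LamM_tadd rmorphB rmorph1; move: (LamM X S) (LamM H S) => A B.
  by apply/matrixP => p q; rewrite !mxE; ring.
have ME t : 0 < t -> t < d0 ->
    M t = (gam t)%:C%C *: (1%:M - LamM (tscale (gam t)^-1 (tadd X (tscale t H))) S).
  move=> t0 td; have [g0 _ _ _] := Hgam t t0 td.
  rewrite LamM_tscale scalerBr scalerA -rmorphM mulfV ?rmorph1 ?scale1r //.
  by rewrite gt_eqF.
have rME t : 0 < t -> t < d0 ->
    \rank (M t) = lam_rank (tscale (gam t)^-1 (tadd X (tscale t H))) S.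
  move=> t0 td; have [g0 _ _ _] := Hgam t t0 td.
  by rewrite /lam_rank ME // mxrank_scale_nz // -[0]/(0%:C%C) eq_complex /= eqxx andbT gt_eqF.
have rM t : 0 < t -> t < d0 -> (\rank (M t) <= lam_rank X S)%N.
  by move=> t0 td; rewrite (rME t t0 td); have [_ _ h2 h3] := Hgam t t0 td; exact: maxr h2 h3.
have vM : mxvec v *m (1%:M - LamM X S) = 0 by rewrite mulmxBr mulmx1 mul_LamM vE subrr.
have [w [d' [d'0 Ow Hw]]] := isO_kernel_path d0_gt0 OM rM vM.
exists gam, (fun t => vec_mx (w t)), (Num.min d0 d'); split=> //.
- by rewrite lt_min d0_gt0.
- have [c [d2 [c0 d20 Hc]]] := Ow; exists c, d2; split=> // t t0 td.
  by rewrite -mnorm_mxvec linearB /= vec_mxK Hc.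
move=> t t0; rewrite lt_min => /andP[td td'].
have [g0 _ h2 h3] := Hgam t t0 td; have [wM rE] := Hw t t0 td'.
have eqw : (gam t)%:C%C *: vec_mx (w t) = Lam (tadd X (tscale t H)) S (vec_mx (w t)).
  apply: (can_inj mxvecK); rewrite linearZ /= -mul_LamM vec_mxK.
  apply/eqP; rewrite -subr_eq0 -{1}[w t]mulmx1 scalemxAr -mulmxBr.
  by apply/eqP.
split; [exact: g0|exact: h2|exact: eqw|].
apply: (maxrho _ _ h2 h3); first by rewrite -(rME t t0 td) rE /lam_rank; reflexivity.
rewrite Lam_tscale -eqw scalerA -rmorphM.
have -> : (gam t)^-1 * gam t = 1 by apply: mulVf; rewrite (gt_eqF g0).
by rewrite rmorph1 scale1r.
Qed.

End BoundaryPath.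

(** * Gram matrices and Hermitian test matrices *)

Section Gram.
Context {R : rcfType}.
Local Notation C := R[i].

Lemma mul_adj_ge0 m n (A : 'M[C]_(m, n)) : 0 <= \tr (A *m adj A).
Proof.
apply: sumr_ge0 => i _; rewrite mxE; apply: sumr_ge0 => j _.
by rewrite !mxE mulcJ_ge0.
Qed.

Lemma mul_adj_eq0 m n (A : 'M[C]_(m, n)) : \tr (A *m adj A) = 0 -> A = 0.
Proof.
move=> h.
have ge0 i j : 0 <= A i j * adj A j i by rewrite !mxE mulcJ_ge0.
have ge1 i : 0 <= (A *m adj A) i i by rewrite mxE; apply: sumr_ge0.
apply/matrixP => i j; rewrite mxE.
have /(psumr_eq0P (fun i _ => ge1 i))/(_ i isT) := h.
rewrite mxE => /(psumr_eq0P (fun j _ => ge0 i j))/(_ j isT).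
rewrite !mxE -sqr_normc => /eqP; rewrite expf_eq0 /= => /eqP/normr0_eq0; exact.
Qed.

Lemma row_free_gram m n (A : 'M[C]_(m, n)) : row_free A -> A *m adj A \in unitmx.
Proof.
move=> fA; rewrite -row_free_unit -kermx_eq0; apply/eqP/row_matrixP => i.
rewrite row0; set x := row i _.
have xA : x *m (A *m adj A) = 0 by apply/sub_kermxP; rewrite row_sub.
have : x *m A = 0.
  apply: mul_adj_eq0; rewrite adjM !mulmxA -(mulmxA x) xA mul0mx; exact: mxtrace0.
by move=> /eqP; rewrite mulmx_free_eq0 // => /eqP.
Qed.

Lemma herm_trace_eq0 n (A : 'M[C]_n) :
  (forall M, adj M = M -> \tr (M *m A) = 0) -> A = 0.
Proof.
move=> H; apply: trace_pair_eq0 => B.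
have e : B = (1 / 2%:R) *: (B + adj B) + ('i%C / 2%:R) *: (- 'i%C *: (B - adj B)).
  rewrite scalerA mulrN mulrAC -expr2 sqr_i.
  by apply/matrixP => p q; rewrite !mxE; field.
have h1 : adj (B + adj B) = B + adj B by rewrite adjD adjK addrC.
have h2 : adj (- 'i%C *: (B - adj B)) = - 'i%C *: (B - adj B).
  rewrite adjZ adjB adjK -opprB scalerN -scaleNr; congr (_ *: _).
  by apply/eqP; rewrite eq_complex /= !oppr0 !opprK !eqxx.
by rewrite e mulmxDl -2!scalemxAl mxtraceD 2!mxtraceZ (H _ h1) (H _ h2) !mulr0 addr0.
Qed.

End Gram.

(** * Invariance of the row space of a generic kernel vector *)

Section Core.
Context {R : realType} {g : nat}.
Local Notation C := R[i].
Local Notation ctup n := ('I_g -> 'M[C]_n).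

Definition path_prop N k (Q : ctup N -> Prop) (S : ctup k) X v H :=
  exists (gam : R -> R) (vt : R -> 'M[C]_(N, k)) (d : R),
    [/\ 0 < d, isO 1 (fun t => vt t - v), isOs 1 (fun t => (gam t - 1)%:C%C) &
    forall t, 0 < t -> t < d ->
    [/\ 0 < gam t, bdry Q (tscale (gam t)^-1 (tadd X (tscale t H))),
       (gam t)%:C%C *: vt t = Lam (tadd X (tscale t H)) S (vt t) &
       (\rank (vt t) <= \rank v)%N]].

Lemma mulmx_Lam N k n (Z : 'M[C]_(n, N)) (X : ctup N) (S : ctup k) v :
  Z *m Lam X S v = \sum_j Z *m X j *m v *m S j.
Proof. by rewrite /Lam mulmx_sumr; apply: eq_bigr => j _; rewrite !mulmxA. Qed.

Lemma perturbed_left_kernel N k n (X H : ctup N) (S : ctup k) (v w : 'M[C]_(N, k))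
    (Z : 'M[C]_(n, N)) (gm : C) (t : R) : Lam X S v = v -> Z *m v = 0 ->
  gm *: (v + w) = Lam (tadd X (tscale t H)) S (v + w) ->
  gm *: (Z *m w) = \sum_j Z *m X j *m w *m S j
    + t%:C%C *: (\sum_j Z *m H j *m v *m S j + \sum_j Z *m H j *m w *m S j).
Proof.
move=> vE Zv e; rewrite -!mulmx_Lam -mulmxDr -LamD.
have -> : Z *m Lam X S w = Z *m Lam X S (v + w) by rewrite LamD vE mulmxDr Zv add0r.
by rewrite !scalemxAr -mulmxDr -Lam_tscale -Lam_tadd -e -!scalemxAr mulmxDr Zv add0r.
Qed.

Lemma tangent_algebra m n (a1 a2 a3 a4 a5 a6 tau : 'M[C]_(m, n)) (gm t : C) :
  gm *: (a1 + a2) = a3 + a4 + a5 + t *: (tau + a6) ->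
  t *: tau = (gm - 1) *: (a1 + a2) + (a2 - a4) - t *: a6 + (a1 - a3 - a5).
Proof.
move=> e; have -> : t *: tau = gm *: (a1 + a2) - (a3 + a4 + a5) - t *: a6.
  by rewrite e; apply/matrixP => i j; rewrite !mxE; ring.
by apply/matrixP => i j; rewrite !mxE; ring.
Qed.

Section Invariance.
Variables (N k : nat) (Q : ctup N -> Prop) (S : ctup k).
Variables (X : ctup N) (v : 'M[C]_(N, k)).
Hypotheses (vE : Lam X S v = v) (pth : forall H, hermT H -> path_prop Q S X v H).

Let b := row_base v.
Let B0 := pinvmx b.
Let A0 := pinvmx (col_base v).
Let Z := row_base (kermx v).
Let z := \rank (kermx v).
Let Y := row_base (Z^C)%MS.
Let y := \rank (Z^C)%MS.
Let r := \rank v.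

(* Perturbing [X] in the directions [H = Z^* h + h^* Z], for which [v^* H v = 0],
   and multiplying the first-order equation of the perturbed
   kernel vector by the left kernel [Z] of [v] leaves only the right-hand space,
   whose dimension does not grow with [N]. *)
Lemma tangent_space (p : ctup z) (q : 'I_g -> 'M[C]_(z, y)) (h : 'I_g -> 'M[C]_(z, N)) :
  (forall j, Z *m X j = p j *m Z + q j *m Y) ->
  (mxvec (\sum_j h j *m v *m S j) <=
    col_mx (lin_mulmxr b - \sum_j lin_mulmx (p j) *m lin_mulmxr (b *m S j))
           (\sum_j lin_mulmx (q j) *m lin_mulmxr (S j)))%MS.
Proof.
move=> pq.
set M1 := (lin_mulmxr b - _); set M2 := (\sum_j _ *m lin_mulmxr (S j)); set Lm := col_mx M1 M2.
have M1E (xi : 'M[C]_(z, r)) :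
    mxvec xi *m M1 = mxvec (xi *m b - \sum_j p j *m xi *m (b *m S j)).
  rewrite mulmxBr mul_vec_lin linearB; congr (_ - _).
  rewrite mulmx_sumr linear_sum; apply: eq_bigr => j _.
  by rewrite mulmxA !mul_vec_lin.
have M2E (eta : 'M[C]_(y, k)) : mxvec eta *m M2 = mxvec (\sum_j q j *m eta *m S j).
  rewrite mulmx_sumr linear_sum; apply: eq_bigr => j _.
  by rewrite mulmxA !mul_vec_lin.
have Zv : Z *m v = 0 by apply/sub_kermxP; rewrite eq_row_base.
have ZU : Z *m adj Z \in unitmx by apply/row_free_gram/row_base_free.
(* Normalising by the Gram matrix of [Z] yields [Z H_j v = h_j v] exactly, since the other term of
   [H_j] ends in [Z v = 0]. *)
have [h' h'E] : exists h' : 'I_g -> 'M[C]_(z, N), forall j, Z *m adj Z *m h' j = h j.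
  by exists (fun j => invmx (Z *m adj Z) *m h j) => j; rewrite mulKVmx.
pose H j := adj Z *m h' j + adj (h' j) *m Z.
have hH : hermT H.
  by move=> j; rewrite /H adjD (adjM (adj Z)) (adjM _ Z) !adjK addrC.
have ZHv j : Z *m H j *m v = h j *m v.
  rewrite /H mulmxDr mulmxDl -[Z *m (adj _ *m Z) *m v]mulmxA -(mulmxA _ Z) Zv !mulmx0 addr0.
  by rewrite mulmxA h'E.
have [gam [vt [d [d0 Ov Og Hpath]]]] := pth hH.
set tau := \sum_j _ *m S j.
(* Multiplying by the cokernel of the right-hand space removes the unknown first-order terms [xi]
   and [eta]; what remains of [t tau] is [O(t^2)], which forces [tau] into that space. *)
pose K := cokermx Lm.
rewrite submxE -/K; apply/eqP; apply: (@isO_lim0 _ 1).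
pose dl t := vt t - v.
pose W := 1%:M - B0 *m b.
pose E t := Z *m dl t *m W.
have bB : b *m B0 = 1%:M by rewrite mulmxVp // row_base_free.
have vW : v *m W = 0.
  by rewrite mulmxBr mulmx1 mulmxA mulmxKpV ?subrr // eq_row_base.
have AvB : A0 *m v *m B0 = 1%:M.
  have : A0 *m (col_base v *m b) = b by rewrite mulmxA mulVpmx ?col_base_full // mul1mx.
  by rewrite mulmx_base => ->.
have Oa : isO 1 (fun t => A0 *m vt t *m B0 - 1%:M).
  apply: isO_eq (isOM (isOM (isO_cst A0) Ov) (isO_cst B0)) => t.
  by rewrite mulmxBr mulmxBl AvB.
have [[d1 d10 aU] Oinv] := isO_invmx Oa.
(* The part of [Z dl] outside the row space of [v] is quadratic: the rank bound writes [vt] as a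
   product whose outer factors, cut by [Z] and [W], both vanish at [t = 0]. *)
have OE : isO 2 E.
  have O1 := isOM (isOM (isO_cst Z) Ov) (isO_cst B0).
  have O2 := isOM (isOM (isO_cst A0) Ov) (isO_cst W).
  have dd : 0 < Num.min d d1 by rewrite lt_min d0.
  apply: isO_near dd _ (isOM (isOM O1 Oinv) O2) => t t0.
  rewrite lt_min => /andP[td td1].
  have [_ _ _ rk] := Hpath t t0 td.
  have [_ fE] := low_rank_factor (aU t t0 td1) rk.
  have zd : Z *m (vt t - v) = Z *m vt t by rewrite mulmxBr Zv subr0.
  have Ad : A0 *m (vt t - v) *m W = A0 *m vt t *m W.
    by rewrite (mulmxBr A0) mulmxBl -(mulmxA _ v) vW mulmx0 subr0.
  rewrite /E zd Ad -[in RHS]fE; move: (invmx _) => iv.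
  by rewrite !mulmxA.
pose rest t := ((gam t - 1)%:C%C *: (Z *m dl t) + (E t - \sum_j p j *m E t *m S j))
  - t%:C%C *: (\sum_j Z *m H j *m dl t *m S j).
have Orest : isO 2 rest.
  apply: isOB.
    apply: isOD; first exact: (isOZ Og (isOM (isO_cst Z) Ov)).
    apply: isOB => //; apply: isO_sum => j.
    exact: (isOM (isOM (isO_cst _) OE) (isO_cst _)).
  apply: (isOZ isOs_t); apply: isO_sum => j.
  exact: (isOM (isOM (isO_cst _) Ov) (isO_cst _)).
apply: isO_near d0 _ (isOM (isO_mxvec Orest) (isO_cst K)) => t t0 td.
have [_ _ vtE _] := Hpath t t0 td.
pose xi := Z *m dl t *m B0; pose eta := Y *m dl t.
have /eqP := mulmx_coker Lm.
rewrite -/K /Lm mul_col_mx col_mx_eq0 => /andP[/eqP M1K /eqP M2K].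
rewrite expr1 scalemxAl -linearZ /=.
have -> : t%:C%C *: tau = rest t +
  ((xi *m b - \sum_j p j *m xi *m (b *m S j)) - \sum_j q j *m eta *m S j); last first.
  have vB (A B : 'M[C]_(z, k)) : mxvec (A - B) = mxvec A - mxvec B by rewrite linearB.
  have vD (A B : 'M[C]_(z, k)) : mxvec (A + B) = mxvec A + mxvec B by rewrite linearD.
  rewrite (vD (rest t)) (vB (xi *m b - _)) mulmxDl (mulmxBl (mxvec _)) -M1E -M2E.
  by rewrite -(mulmxA _ M1) -(mulmxA _ M2) M1K M2K !mulmx0 subrr addr0.
have Zdl : Z *m dl t = xi *m b + E t.
  by rewrite /E /W (mulmxBr (Z *m dl t)) mulmx1 /xi -(mulmxA _ B0) addrC subrK.
have XE : \sum_j Z *m X j *m dl t *m S j = \sum_j p j *m xi *m (b *m S j)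
    + \sum_j p j *m E t *m S j + \sum_j q j *m eta *m S j.
  rewrite -!big_split; apply: eq_bigr => j _ /=.
  rewrite pq mulmxDl -(mulmxA (p j) Z) Zdl mulmxDr !mulmxDl /eta.
  by rewrite !mulmxA.
have vtv : vt t = v + dl t by rewrite /dl addrC subrK.
have tauE : \sum_j Z *m H j *m v *m S j = tau.
  by apply: eq_bigr => j _; rewrite ZHv.
have : (gam t)%:C%C *: (Z *m dl t) = \sum_j Z *m X j *m dl t *m S j
    + t%:C%C *: (tau + \sum_j Z *m H j *m dl t *m S j).
  by rewrite -tauE; apply: perturbed_left_kernel => //; rewrite -vtv.
rewrite XE Zdl => e; rewrite /rest rmorphB rmorph1 Zdl.
exact: tangent_algebra e.
Qed.

(** Let [U1] be the sum of the row spaces of the [v S_j]; it contains that of [v] because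
    [v = Lam X S v]. Every matrix with [z] rows in [U1] occurs as a tangent, so
    [z * rank U1 <= z * r + r * k]. As [r * k < z], the rank of [U1] is at most [r] and the two
    spaces agree. *)
Lemma range_stable : (r * k < z)%N -> forall j, (v *m S j <= v)%MS.
Proof.
move=> zrk.
have yr : y = r.
  rewrite /y mxrank_compl /Z eq_row_base mxrank_ker subKn //.
  exact: rank_leq_row.
have /fin_all_exists[pq Hpq] : forall j, exists pq : 'M[_]_z * 'M[_]_(z, y),
    Z *m X j = pq.1 *m Z + pq.2 *m Y.
  move=> j; apply/sub_addsmxP.
  have -> : (Z + Y :=: Z + Z^C)%MS by apply: adds_eqmx => //; apply: eq_row_base.
  by apply: submx_full; apply: addsmx_compl_full.
have tan h := tangent_space h Hpq; move: tan.
set Lm := col_mx _ _ => tan.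
pose U1 := (\sum_j <<v *m S j>>)%MS.
have subL (M : 'M[_]_(z, k)) : (M <= U1)%MS -> (mxvec M <= Lm)%MS.
  move=> /sub_sumsmxP[u ->].
  have /fin_all_exists[h Hh] : forall j, exists w : 'M[_]_(z, N),
      u j *m <<v *m S j>>%MS = w *m (v *m S j).
    by move=> j; apply/submxP; rewrite mulmx_sub // genmxE.
  under eq_bigr => j _ do rewrite Hh mulmxA.
  exact: tan.
pose T := lin_mulmxr (row_base U1) : 'M[_]_(z * \rank U1, z * k).
have TE (w : 'M[_]_(z, \rank U1)) : mxvec w *m T = mxvec (w *m row_base U1).
  by rewrite mul_vec_lin.
have rT : \rank T = (z * \rank U1)%N.
  apply/eqP; rewrite -/(row_free T) -kermx_eq0; apply/eqP/row_matrixP => i.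
  rewrite row0; set x := row i _.
  have : x *m T = 0 by apply/sub_kermxP; rewrite row_sub.
  rewrite -[x]vec_mxK TE => /eqP; rewrite -(linear0 mxvec) (can_eq mxvecK).
  by rewrite mulmx_free_eq0 ?row_base_free // => /eqP ->; rewrite linear0.
have TL : (T <= Lm)%MS.
  apply/row_subP => i; rewrite rowE -[delta_mx _ _]vec_mxK TE; apply: subL.
  by rewrite mulmx_sub // eq_row_base.
have rL : (\rank T <= z * r + r * k)%N.
  by apply: leq_trans (mxrankS TL) _; apply: leq_trans (rank_leq_row _) _; rewrite yr.
have U1r : (\rank U1 <= r)%N.
  rewrite leqNgt; apply/negP => rU.
  have : (z * r.+1 <= z * r + r * k)%N by apply: leq_trans rL; rewrite rT leq_mul2l rU orbT.
  by rewrite mulnS addnC leq_add2l leqNgt zrk.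
have vU1 : (v <= U1)%MS.
  rewrite -{1}vE /Lam; apply: summx_sub_sums => j _.
  by rewrite -mulmxA genmxE submxMl.
have U1v : (U1 <= v)%MS by have := mxrank_leqif_sup vU1; move/geq_leqif => <-.
move=> j; apply: submx_trans U1v; apply: (sumsmx_sup j) => //.
by rewrite genmxE.
Qed.

(** With [r <= k] and [z = N - r], the bound on [N] yields [r * k < z]; irreducibility then leaves
    only the whole space for the nonzero invariant row space. *)
Lemma kernel_vector_full : (k * k + k < N)%N -> irred S -> v != 0 -> row_full v.
Proof.
move=> Nk [k0 irrS] v0.
have rk : (r <= k)%N by apply: rank_leq_col.
have zE : z = (N - r)%N by rewrite /z mxrank_ker.
have zrk : (r * k < z)%N.
  rewrite zE ltn_subRL; apply: leq_ltn_trans Nk; rewrite addnC leq_add //.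
  by rewrite leq_mul2r rk orbT.
by case: (irrS _ v (range_stable zrk)) => // v0'; rewrite v0' eqxx in v0.
Qed.

End Invariance.
End Core.

(** * The derivative of the gauge as a supporting functional *)

Section Support.
Context {R : realType} {g : nat}.
Local Notation C := R[i].
Local Notation ctup n := ('I_g -> 'M[C]_n).
Local Notation normc := (@Normc.normc R).
Local Notation Re := (@complex.Re R).
Local Notation Im := (@complex.Im R).

Lemma trace_mxvec m n (w : 'M[C]_(m, n)) (c : 'cV[C]_(m * n)) :
  \tr ((vec_mx c^T)^T *m w) = (mxvec w *m c) 0 0.
Proof.
rewrite mxtrace_mulC mxE (reindex _ (curry_mxvec_bij m n)) /=.
transitivity (\sum_i \sum_j w i j * (vec_mx c^T)^T j i).
  by apply: eq_bigr => i _; rewrite mxE.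
rewrite pair_bigA /=; apply: eq_bigr => -[i j] _ /=.
by rewrite mxvecE !mxE.
Qed.

(** Kernel of the transpose of [1 - Lam X S] for the pairing [tr (y v)], as [trace_Lam] shows. *)
Definition left_kernel N k (S : ctup k) (X : ctup N) (y : 'M[C]_(k, N)) :=
  \sum_j S j *m y *m X j = y.

Lemma left_kernelZ N k (S : ctup k) (X : ctup N) (y : 'M[C]_(k, N)) a :
  left_kernel S X y -> left_kernel S X (a *: y).
Proof.
rewrite /left_kernel => {2}<-; rewrite scaler_sumr; apply: eq_bigr => j _.
by rewrite -scalemxAr -scalemxAl.
Qed.

Lemma trace_Lam N k (S : ctup k) (X : ctup N) (y : 'M[C]_(k, N)) v :
  \tr (y *m Lam X S v) = \tr ((\sum_j S j *m y *m X j) *m v).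
Proof.
rewrite /Lam mulmx_sumr mulmx_suml !raddf_sum; apply: eq_bigr => j _ /=.
by rewrite !mulmxA mxtrace_mulC !mulmxA.
Qed.

Lemma sing_left_kernel N k (S : ctup k) (X : ctup N) :
  sing S X -> exists2 y : 'M[C]_(k, N), y != 0 & left_kernel S X y.
Proof.
rewrite sing_unit -unitmx_tr -row_free_unit -kermx_eq0 => /rowV0Pn[w /sub_kermxP wM w0].
pose y : 'M[C]_(k, N) := (vec_mx w)^T.
have yE v : \tr (y *m (v - Lam X S v)) = 0.
  rewrite /y -[w]trmxK trace_mxvec.
  have -> : mxvec (v - Lam X S v) = mxvec v *m (1%:M - LamM X S).
    by rewrite mulmxBr mulmx1 mul_LamM linearB.
  by rewrite -mulmxA -[_ *m w^T]trmxK trmx_mul trmxK wM trmx0 mulmx0 mxE.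
exists y.
  apply: contra_neq w0 => y0; rewrite -[w]vec_mxK -[vec_mx w]trmxK -/y y0.
  by rewrite trmx0 linear0.
apply/eqP; rewrite -subr_eq0; apply/eqP; apply: trace_pair_eq0 => v.
rewrite mulmxBr raddfB /= mxtrace_mulC -trace_Lam (mxtrace_mulC v y).
have := yE v; rewrite mulmxBr raddfB /= => /eqP; rewrite subr_eq0 => /eqP ->.
by rewrite subrr.
Qed.

Lemma isOs_const0 (a : C) : isOs 1 (fun=> a) -> a = 0.
Proof.
move=> /isOs_mx Oa; have := @isO_lim0 R 0 1 1 a%:M.
move=> /(_ (isO_eq (fun t => _) Oa)) h.
have {}h : a%:M = 0 :> 'M[_]_1 by apply: h => t; rewrite expr0 scale1r.
by move/matrixP/(_ 0 0): h; rewrite !mxE mulr1n.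
Qed.

Lemma isOs_eq e (a b : R -> C) : a =1 b -> isOs e a -> isOs e b.
Proof. by move=> ab [c [d [c0 d0 H]]]; exists c, d; split=> // t t0 td; rewrite -ab H. Qed.

Lemma isOs_div e (b : R -> C) :
  isOs e.+1 (fun t => t%:C%C * b t) -> isOs e b.
Proof.
move=> [c [d [c0 d0 H]]]; exists c, d; split=> // t t0 td.
have := H t t0 td; rewrite Normc.normcM normc_real ger0_norm ?(ltW t0) //.
by rewrite exprS mulrCA ler_pM2l.
Qed.


Lemma isOsD e (a b : R -> C) : isOs e a -> isOs e b -> isOs e (fun t => a t + b t).
Proof.
move=> [c [d [c0 d0 H]]] [c' [d' [c0' d0' H']]].
exists (c + c'), (Num.min d d'); split; [exact: addr_ge0|by rewrite lt_min d0|].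
move=> t t0; rewrite lt_min => /andP[td td'].
by rewrite mulrDl; apply: le_trans (le_normcD _ _) (lerD (H _ _ _) (H' _ _ _)).
Qed.

Lemma isOsM e e' (a b : R -> C) :
  isOs e a -> isOs e' b -> isOs (e + e') (fun t => a t * b t).
Proof.
move=> [c [d [c0 d0 H]]] [c' [d' [c0' d0' H']]].
exists (c * c'), (Num.min d d'); split; [exact: mulr_ge0|by rewrite lt_min d0|].
move=> t t0; rewrite lt_min => /andP[td td'].
rewrite exprD mulrACA Normc.normcM.
by apply: ler_pM; rewrite ?normc_ge0 ?H ?H'.
Qed.

Lemma isO_Lam e N k (X : ctup N) (S : ctup k) (w : R -> 'M[C]_(N, k)) :
  isO e w -> isO e (fun t => Lam X S (w t)).
Proof.
move=> Ow; apply: isO_sum => j.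
by have := isOM (isOM (isO_cst (X j)) Ow) (isO_cst (S j)); rewrite add0n addn0.
Qed.

Lemma hermT_delta N j0 (M : 'M[C]_N) : adj M = M ->
  hermT (fun j : 'I_g => if j == j0 then M else 0).
Proof. by move=> hM j; case: eqP => _; rewrite ?hM ?adj0. Qed.

Lemma Lam_delta N k j0 (M : 'M[C]_N) (S : ctup k) v :
  Lam (fun j => if j == j0 then M else 0) S v = M *m v *m S j0.
Proof.
rewrite /Lam (bigD1 j0) //= eqxx big1 ?addr0 // => j /negPf ->.
by rewrite !mul0mx.
Qed.

Lemma normc_Re_le (a : C) : Re a <= normc a.
Proof.
case: a => x y /=; apply: le_trans (ler_norm x) _; rewrite -sqrtr_sqr.
by apply: ler_wsqrtr; rewrite lerDl sqr_ge0.
Qed.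

Lemma normc_Im_le (a : C) : `|Im a| <= normc a.
Proof.
case: a => x y /=; rewrite -sqrtr_sqr; apply: ler_wsqrtr.
by rewrite lerDr sqr_ge0.
Qed.

Lemma Re_opp_sub (a : C) (s t : R) : Re (- (s%:C%C - t%:C%C * a)) = t * Re a - s.
Proof. by case: a => p q /=; rewrite !mul0r subr0 opprB. Qed.

Lemma small_step (c d d' a : R) : 0 <= c -> 0 < d -> 0 < d' -> 0 < a ->
  exists t, [/\ 0 < t, t < d, t < d', t < 1 & c * t < a].
Proof.
move=> c0 d0 d'0 a0; have c1 : 0 < c + 1 by rewrite ltr_wpDl.
have [t /andP[t0]] : exists t, 0 < t < Num.min (Num.min d d') (Num.min 1 (a / (c + 1))).
  have m0 : 0 < Num.min (Num.min d d') (Num.min 1 (a / (c + 1))).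
    by rewrite !lt_min d0 d'0 ltr01 divr_gt0.
  by exists (Num.min (Num.min d d') (Num.min 1 (a / (c + 1))) / 2); lra.
rewrite !lt_min => /andP[/andP[td td'] /andP[t1 ta]]; exists t; split=> //.
apply: le_lt_trans (_ : t * (c + 1) < a); last by rewrite -ltr_pdivlMr.
by rewrite mulrDr mulr1 mulrC lerDl ltW.
Qed.

Lemma small_step_contra (c t a gm : R) :
  0 < t -> c * t < a -> gm <= 1 -> t * a - (gm - 1) <= c * t ^+ 2 -> False.
Proof.
move=> t0 cta g1 h; have : c * t * t < a * t by rewrite ltr_pM2r.
by rewrite expr2 in h; lra.
Qed.

Section Dual.
Variables (N k : nat) (Q : ctup N -> Prop) (S : ctup k).
Variables (X : ctup N) (v : 'M[C]_(N, k)).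
Hypotheses (lQ : cvx_level Q) (bX : bdry Q X) (vE : Lam X S v = v) (v0 : v != 0) (vfull : row_full v).
Hypothesis pth : forall H, hermT H -> path_prop Q S X v H.

(** Pairing the kernel equation along the path with [y] cancels the contribution of [Lam X S], so
    the derivative of the gauge is a quotient of two traces. The product form avoids dividing by
    [tr (y v)] before it is known to be nonzero. *)
Lemma first_order y H : left_kernel S X y -> hermT H ->
  exists (gam : R -> R) (d : R), [/\ 0 < d,
    forall t, 0 < t -> t < d -> 0 < gam t /\ bdry Q (tscale (gam t)^-1 (tadd X (tscale t H))) &
    isOs 2 (fun t => (gam t - 1)%:C%C * \tr (y *m v) - t%:C%C * \tr (y *m Lam H S v))].
Proof.
move=> yE hH; have [gam [vt [d [d0 Ov Og Hp]]]] := pth hH.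
exists gam, d; split=> // [t t0 td|]; first by have [? ? _ _] := Hp t t0 td.
have O1 := isOsM isOs_t (isO_trace (isOM (isO_cst y) (isO_Lam H S Ov))).
have O2 := isOsM Og (isO_trace (isOM (isO_cst y) Ov)).
have ON := isOsM (isO_trace (isO_cst (- 1%:M : 'M[C]_1))) O2.
have [c [d' [c0 d'0 Hc]]] := isOsD O1 ON.
exists c, (Num.min d d'); split=> //; first by rewrite lt_min d0.
move=> t t0; rewrite lt_min => /andP[td td'].
apply: le_trans (Hc t t0 td'); rewrite le_eqVlt; apply/orP; left; apply/eqP; congr normc.
have [_ _ vtE _] := Hp t t0 td.
have e1 := congr1 (fun w => \tr (y *m w)) vtE.
rewrite Lam_tadd Lam_tscale mulmxDr -!scalemxAr mxtraceD !mxtraceZ trace_Lam in e1.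
rewrite yE in e1.
rewrite LamB !mulmxBr !raddfB /= raddfN /= mxtrace1 mulN1r.
rewrite ?rmorph1 /=.
move: e1; move: (\tr (y *m vt t)) (\tr (y *m v)) (\tr (y *m Lam H S (vt t))) (\tr (y *m Lam H S v)).
move=> a b c1 d1 e1; have {}e1 : t%:C%C * c1 = (gam t)%:C%C * a - a by rewrite e1 addrC addKr.
by rewrite mulrBr e1; ring.
Qed.

(** If the pairing vanished, the expansion would force [tr (y Lam H S v) = 0] for all Hermitian [H],
    hence every [v S_j y = 0]; full rank of [v] then gives [S_j y = 0], and the equation of [y]
    gives [y = 0]. *)
Lemma pairing_neq0 y : left_kernel S X y -> y != 0 -> \tr (y *m v) != 0.
Proof.
move=> yE y0; apply/eqP => yv0.
case/eqP: y0.
have phi0 H : hermT H -> \tr (y *m Lam H S v) = 0.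
  move=> hH; have [gam [d [_ _]]] := first_order yE hH.
  rewrite yv0 => O2; apply: isOs_const0; apply: (@isOs_div 1).
  have O3 := isOsM (isO_trace (isO_cst (- 1%:M : 'M[C]_1))) O2.
  apply: (@isOs_eq 2 _ _ _ O3) => t /=; rewrite raddfN /= mxtrace1; ring.
have vSy j : v *m S j *m y = 0.
  apply: herm_trace_eq0 => M hM; have := phi0 _ (hermT_delta j hM).
  by rewrite Lam_delta mxtrace_mulC !mulmxA.
have Sy j : S j *m y = 0.
  by rewrite -[S j *m y]mul1mx -(mulVpmx vfull) -mulmxA [v *m (_)]mulmxA vSy mulmx0.
by rewrite -yE big1 // => j _; rewrite Sy mul0mx.
Qed.

(** Reality holds because [gam t] is real. The bound holds because moving from [X] towards a point
    of [Q] does not raise the gauge above one. *)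
Lemma support_functional : exists y, [/\ left_kernel S X y, \tr (y *m v) = 1,
  forall H, hermT H -> Im (\tr (y *m Lam H S v)) = 0 &
  forall Y, Q Y -> Re (\tr (y *m Lam Y S v)) <= 1].
Proof.
have [y0 y0ne y0E] := sing_left_kernel (ex_intro2 _ _ v v0 vE).
have yv0 := pairing_neq0 y0E y0ne.
pose y := (\tr (y0 *m v))^-1 *: y0.
have yE : left_kernel S X y by apply: left_kernelZ.
have yv : \tr (y *m v) = 1 by rewrite -scalemxAl mxtraceZ mulVf.
exists y; split=> // [H hH|Y QY].
  have [gam [d [_ _ [c [d' [c0 d'0 Hc]]]]]] := first_order yE hH.
  set phi := \tr (y *m Lam H S v) in Hc *.
  suff : (Im phi)%:C%C = 0 by case.
  apply: isOs_const0; apply: (@isOs_div 1); exists c, d'; split=> // t t0 td.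
  apply: le_trans (Hc t t0 td); rewrite yv mulr1 Normc.normcM !normc_real.
  apply: le_trans (normc_Im_le _); rewrite -normrM -normrN.
  by case: (phi) => a b /=; rewrite !mul0r addr0 sub0r.
rewrite leNgt; apply/negP => gt1.
have hX : hermT X by case: bX.
have hH : hermT (tadd Y (tscale (-1) X)).
  by apply: hermT_add; [apply: (lvl_herm lQ)|apply: hermT_scale].
have [gam [d [d0 Hg [c [d' [c0 d'0 Hc]]]]]] := first_order yE hH.
set phi := \tr (y *m Lam _ S v) in Hc.
have phiE : Re phi = Re (\tr (y *m Lam Y S v)) - 1.
  rewrite /phi Lam_tadd Lam_tscale vE rmorphN rmorph1 scaleN1r mulmxBr raddfB /= yv.
  by rewrite raddfB.
have phi0 : 0 < Re phi by rewrite phiE subr_gt0.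
set a := Re phi in phi0.
have [t [t0 td td' t1 cta]] := small_step c0 d0 d'0 phi0.
have [g0 [_ bscale nQ]] := Hg t t0 td.
(* If [gam t > 1], both [X / gam t] and [Y / gam t] lie in [Q], and so does their convex combination
   with weight [t], which is the boundary point itself. *)
have gle1 : gam t <= 1.
  rewrite leNgt; apply/negP => g1; apply: nQ.
  have gi1 : (gam t)^-1 < 1 by rewrite invf_lt1.
  have gi0 : 0 <= (gam t)^-1 by rewrite invr_ge0 ltW.
  have QX : Q (tscale (gam t)^-1 X) by have [_ + _] := bX; apply.
  have QYg := lvl_scale lQ QY gi0 (ltW gi1).
  have := lvl_cvx lQ QYg QX (ltW t0) (ltW t1).
  congr Q; apply/funext => j; rewrite /tadd /tscale rmorphB rmorphN rmorph1.
  by apply/matrixP => p q; rewrite !mxE; ring.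
have := Hc t t0 td'; rewrite yv mulr1 => h.
apply: (small_step_contra t0 cta gle1).
apply: le_trans h; rewrite -normcN; apply: le_trans (normc_Re_le _).
by rewrite Re_opp_sub lexx.
Qed.

End Dual.
End Support.

(** * Matrix convexity and second-order variation *)

Section Family.
Context {R : realType} {g : nat}.
Local Notation C := R[i].
Local Notation ctup n := ('I_g -> 'M[C]_n).
Local Notation Re := (@complex.Re R).

Definition tsum n m (X : ctup n) (Y : ctup m) : 'I_g -> 'M[C]_(n + m) :=
  fun j => block_mx (X j) 0 0 (Y j).

(** Only compressions to invariant subspaces are postulated, as these are compatible with rational
    expressions; arbitrary ones follow from convexity in [mc_compress]. *)
Record mxconvex (Q : forall N, ctup N -> Prop) : Prop := MxConvex {
  mc_lvl : forall N, (0 < N)%N -> cvx_level (@Q N);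
  mc_restr : forall N n (V : 'M[C]_(N, n)) W X, (0 < n)%N -> adj V *m V = 1%:M ->
    (forall j, W j *m V = V *m X j) -> hermT X -> Q N W -> Q n X;
  mc_sum : forall n m X Y, (0 < n)%N -> (0 < m)%N -> Q n X -> Q m Y ->
    Q (n + m)%N (tsum X Y) }.

Lemma conjc_realX (x : R) e : conjc (x%:C%C ^+ e) = x%:C%C ^+ e.
Proof. by rewrite -rmorphXn; apply: conjc_real. Qed.

Lemma adj_invmx n (A : 'M[C]_n) : A \in unitmx -> adj A = A -> adj (invmx A) = invmx A.
Proof.
move=> uA hA; have e : adj (invmx A) *m A = 1%:M by rewrite -{2}hA -adjM mulmxV // adj1.
by rewrite -[LHS]mulmx1 -(mulmxV uA) mulmxA e mul1mx.
Qed.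

Lemma isometry_dim N n (V : 'M[C]_(N, n)) : adj V *m V = 1%:M -> (n <= N)%N.
Proof.
move=> VV; have : \rank (adj V *m V) = n by rewrite VV mxrank1.
by move=> <-; apply: leq_trans (mxrankM_maxr _ _) (rank_leq_row _).
Qed.

Section Compress.
Variable Q : forall N, ctup N -> Prop.
Hypothesis mcQ : mxconvex Q.

(** Averaging [W] with its conjugate by the reflection [F = 2 V adj V - 1] removes the blocks mixing
    the range of [V] with its complement; that range becomes invariant and the compression is
    unchanged. *)
Lemma mc_compress N n (V : 'M[C]_(N, n)) W : (0 < n)%N -> adj V *m V = 1%:M ->
  Q W -> Q (fun j => adj V *m W j *m V).
Proof.
move=> n0 VV QW.
have N0 : (0 < N)%N := leq_trans n0 (isometry_dim VV).
have lQ := mc_lvl mcQ N0.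
have hW := lvl_herm lQ QW.
pose F := 2%:R *: (V *m adj V) - 1%:M.
have hF : adj F = F.
  by rewrite adjB adj1 adjZ adjM adjK conjc_nat.
have PP : V *m adj V *m (V *m adj V) = V *m adj V.
  by rewrite -mulmxA (mulmxA (adj V)) VV mul1mx.
have FF : F *m F = 1%:M.
  rewrite mulmxBl mul1mx mulmxBr mulmx1 -scalemxAl -scalemxAr PP scalerA.
  by apply/matrixP => i j; rewrite !mxE; ring.
have FV : F *m V = V.
  rewrite mulmxBl mul1mx -scalemxAl -mulmxA VV mulmx1.
  by apply/matrixP => i j; rewrite !mxE; ring.
have hFWF : hermT (fun j => F *m W j *m F) by move=> j; rewrite !adjM hF hW mulmxA.
have QF : Q (fun j => F *m W j *m F).
  apply: (mc_restr mcQ N0 _ _ hFWF QW (V := F)); first by rewrite hF.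
  by move=> j; rewrite !mulmxA FF mul1mx.
have h0 : 0 <= 1 / 2 :> R by lra.
have h1 : 1 / 2 <= 1 :> R by lra.
have Qavg := lvl_cvx lQ QW QF h0 h1.
apply: (mc_restr mcQ n0 VV _ _ Qavg); last by move=> j; rewrite !adjM adjK hW mulmxA.
move=> j; rewrite /tadd /tscale mulmxDl -!scalemxAl.
have -> : F *m W j *m F *m V = 2%:R *: (V *m (adj V *m W j *m V)) - W j *m V.
  by rewrite -!mulmxA FV mulmxBl mul1mx -scalemxAl !mulmxA.
have -> : (1 - 1 / 2 : R) = 1 / 2 by lra.
have e2 : ((1 / 2 : R)%:C%C) * 2%:R = 1 :> C.
  by rewrite -(rmorph_nat (real_complex R)) -rmorphM /=; congr (_%:C%C); lra.
by rewrite scalerBr scalerA e2 scale1r addrC subrK.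
Qed.

End Compress.

(* [G] turns [S] into a self-adjoint tuple, hence [1 - Lam] into a linear pencil,
   whose positivity set contains [Q]. *)
Definition good k (Q : forall N, ctup N -> Prop) (S : ctup k) : Prop :=
  exists G : 'M[C]_k, [/\ adj G = G,
    forall x : 'rV_k, x != 0 -> 0 < Re (\tr (x *m G *m adj x)),
    forall j, S j *m G = G *m adj (S j) &
    forall m (Y : ctup m) (psi : 'M[_]_(m, k)), (0 < m)%N -> Q m Y ->
      0 <= Re (\tr ((psi - Lam Y S psi) *m G *m adj psi))].

Lemma resolvent_path N (E : 'M[C]_N) : adj E = E ->
  exists (c : R -> 'M[C]_N) (d : R), [/\ 0 < d, isO 0 c &
    forall t, 0 < t -> t < d -> adj (c t) = c t /\ c t + t%:C%C ^+ 2 *: (E *m c t) = 1%:M].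
Proof.
move=> hE; pose F t : 'M[C]_N := 1%:M + (t%:C%C ^+ 2) *: E.
have O2 : isOs 2 (fun t : R => t%:C%C ^+ 2) := isOsM isOs_t isOs_t.
have OF2 : isO 2 (fun t => F t - 1%:M).
  by have h := isOZ O2 (isO_cst E); apply: (isO_eq _ h) => t; rewrite /F [1%:M + _]addrC addrK.
have [[d d0 uF] Oc] := isO_invmx (isO_le (isT : (1 <= 2)%N) OF2).
exists (fun t => invmx (F t)), d; split=> // t t0 td; split.
  by apply: adj_invmx; [exact: uF|rewrite /F adjD adj1 adjZ hE conjc_realX].
by rewrite scalemxAl -{1}[invmx _]mul1mx -mulmxDl mulmxV // uF.
Qed.

(** [V] is the first block column of the Cayley transform of the skew-Hermitian block matrix with
    corners [- t adj D] and [t D]. Being rational in [t], it needs neither square roots nor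
    exponentials. *)
Lemma cayley_isometry N m (c : 'M[C]_N) (D : 'M[C]_(m, N)) (t : R) :
  adj c = c -> c + t%:C%C ^+ 2 *: ((adj D *m D) *m c) = 1%:M ->
  let V := col_mx (2%:R *: c - 1%:M) ((2%:R * t%:C%C) *: (D *m c)) in
  adj V *m V = 1%:M /\
  forall A B, adj V *m block_mx A 0 0 B *m V = (2%:R *: c - 1%:M) *m A *m (2%:R *: c - 1%:M)
    + (4%:R * t%:C%C ^+ 2) *: (c *m (adj D *m B *m D) *m c).
Proof.
move=> hc c1 V.
have tt : 2%:R * t%:C%C * (2%:R * t%:C%C) = 4%:R * t%:C%C ^+ 2 :> C by ring.
have conj2t : conjc (2%:R * t%:C%C) = 2%:R * t%:C%C :> C.
  have -> : 2%:R * t%:C%C = (2%:R * t)%:C%C :> C by rewrite rmorphM rmorph_nat.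
  exact: conjc_real.
have hU : adj (2%:R *: c - 1%:M) = 2%:R *: c - 1%:M.
  by rewrite adjB adj1 adjZ hc conjc_nat.
have adjV : adj V = row_mx (2%:R *: c - 1%:M) ((2%:R * t%:C%C) *: (c *m adj D)).
  rewrite /adj tr_col_mx map_row_mx -/(adj _) -/(adj _) hU; congr row_mx.
  by rewrite adjZ adjM hc conj2t.
split=> [|A B]; last first.
  rewrite adjV mul_row_block !mulmx0 addr0 add0r mul_row_col; congr (_ + _).
  by rewrite -!scalemxAl -scalemxAr scalerA tt; congr (_ *: _); rewrite !mulmxA.
rewrite adjV mul_row_col -scalemxAl -scalemxAr scalerA tt.
have -> : c *m adj D *m (D *m c) = c *m (adj D *m D *m c) by rewrite !mulmxA.
rewrite -scalerA scalemxAr.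
have -> : t%:C%C ^+ 2 *: (adj D *m D *m c) = 1%:M - c by rewrite -c1 addrC addKr.
rewrite mulmxBl mul1mx mulmxBr mulmx1 mulmxBr mulmx1 -scalemxAl -scalemxAr.
by move: (c *m c) => cc; apply/matrixP => i j; rewrite !mxE; ring.
Qed.

Lemma small_quadratic (a : R) (f : R -> R) c d : 0 <= c -> 0 < d ->
  (forall t, 0 < t -> t < d -> t ^+ 2 * a <= c * t ^+ 3) -> a <= 0.
Proof.
move=> c0 d0 H; rewrite leNgt; apply/negP => a0.
have [t [t0 td _ t1 cta]] := small_step c0 d0 d0 a0.
have := H t t0 td; rewrite exprS mulrA [c * t]mulrC.
have t2 : 0 < t ^+ 2 by rewrite exprn_gt0.
have -> : t * c * t ^+ 2 = t ^+ 2 * (c * t) by ring.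
by rewrite ler_pM2l // leNgt cta.
Qed.

Section Positivity.
Variables (N k : nat) (Q : forall N, ctup N -> Prop) (S : ctup k).
Variables (X : ctup N) (v : 'M[C]_(N, k)) (y : 'M[C]_(k, N)).
Hypotheses (N0 : (0 < N)%N) (mcQ : mxconvex Q) (bX : bdry (@Q N) X) (vE : Lam X S v = v).
Hypotheses (yE : left_kernel S X y) (yv : \tr (y *m v) = 1).
Hypothesis supp : forall Y, Q Y -> Re (\tr (y *m Lam Y S v)) <= 1.

(** With [a = t^2], [e1 = O(t^2)] and [e2 = O(t^4)], every term on the left is [O(t^4)]; the right
    side is the compressed tuple minus its second-order expansion. *)
Lemma second_order_algebra (a : C) (e1 e2 A M : 'M[C]_N) :
  e2 *m (2%:R *: A) + 2%:R *: A *m e2 + e1 *m (4%:R *: A) *m e1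
    + a *: (e1 *m (4%:R *: M) *m (1%:M + e1) + 4%:R *: M *m e1)
  = (1%:M + 2%:R *: e1) *m A *m (1%:M + 2%:R *: e1)
    + (4%:R * a) *: ((1%:M + e1) *m M *m (1%:M + e1)) - A
    - ((4%:R * a) *: M - 2%:R *: ((e2 - e1) *m A + A *m (e2 - e1))).
Proof.
rewrite !(mulmxBl, mulmxBr, mulmxDl, mulmxDr, mul1mx, mulmx1) -?(scalemxAl, scalemxAr).
rewrite -?(scalemxAl, scalemxAr).
by apply/matrixP => p q; rewrite !mxE; ring.
Qed.

Lemma scale_comb (a : C) (M E A : 'M[C]_N) :
  a *: (4%:R *: M - 2%:R *: (E *m A + A *m E)) =
  (4%:R * a) *: M - 2%:R *: ((a *: E) *m A + A *m (a *: E)).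
Proof.
rewrite -scalemxAl -scalemxAr; move: (E *m A) (A *m E) => B1 B2.
by apply/matrixP => p q; rewrite !mxE; ring.
Qed.

Lemma Lam_comb (a b : C) (A B D : ctup N) :
  Lam (fun j => a *: A j - b *: (B j + D j)) S v =
  a *: Lam A S v - b *: (Lam B S v + Lam D S v).
Proof.
rewrite /Lam -big_split /= !scaler_sumr -sumrB; apply: eq_bigr => j _.
by rewrite !mulmxBl -!scalemxAl !mulmxDl.
Qed.

Lemma trace_comb (a b : C) (A B D : 'M[C]_(N, k)) :
  \tr (y *m (a *: A - b *: (B + D))) = a * \tr (y *m A) - b * (\tr (y *m B) + \tr (y *m D)).
Proof. by rewrite mulmxBr raddfB /= -!scalemxAr !mxtraceZ mulmxDr mxtraceD. Qed.

Lemma trace_left_kernel w : left_kernel S X y -> \tr (y *m Lam X S w) = \tr (y *m w).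
Proof. by move=> e; rewrite trace_Lam e. Qed.

(** The two products with [E] contribute equally, one through the equation of [v] and the other
    through that of [y]. *)
Lemma trace_kap (M : ctup N) (E : 'M[C]_N) :
  \tr (y *m Lam (fun j => 4%:R *: M j - 2%:R *: (E *m X j + X j *m E)) S v) =
  4%:R * (\tr (y *m Lam M S v) - \tr (y *m (E *m v))).
Proof.
rewrite Lam_comb trace_comb.
have -> : Lam (fun j => E *m X j) S v = E *m v.
  by rewrite -[in RHS]vE mulmx_Lam.
have -> : Lam (fun j => X j *m E) S v = Lam X S (E *m v).
  by apply: eq_bigr => j _; rewrite !mulmxA.
have -> := trace_left_kernel (E *m v) yE.
by move: (\tr (y *m Lam M S v)) (\tr (y *m (E *m v))) => p q; ring.
Qed.

Lemma trace_remainder (Z kap : ctup N) (a : C) :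
  \tr (y *m Lam (fun j => Z j - X j - a *: kap j) S v) =
  \tr (y *m Lam Z S v) - 1 - a * \tr (y *m Lam kap S v).
Proof.
have -> : Lam (fun j => Z j - X j - a *: kap j) S v =
    Lam Z S v - Lam X S v - a *: Lam kap S v.
  rewrite /Lam scaler_sumr -!sumrB; apply: eq_bigr => j _.
  by rewrite !mulmxBl -!scalemxAl.
by rewrite vE !mulmxBr !raddfB /= yv -scalemxAr mxtraceZ.
Qed.

Lemma Re_remainder (a b : C) (t : R) : Re a <= 1 ->
  t ^+ 2 * Re b <= Re (- (a - 1 - t%:C%C ^+ 2 * b)).
Proof.
rewrite -(rmorphXn (real_complex R)); case: a b => [p q] [p' q'] /= h.
by rewrite mul0r subr0; lra.
Qed.

Lemma Re_mul4_le0 (a b : C) : Re (4%:R * (a - b)) <= 0 -> Re a <= Re b.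
Proof.
rewrite -(rmorph_nat (real_complex R)); case: a b => [p q] [p' q'] /=.
by rewrite mul0r subr0; lra.
Qed.

Lemma isO_trace_Lam e (Z : 'I_g -> R -> 'M[C]_N) : (forall j, isO e (Z j)) ->
  isOs e (fun t => \tr (y *m Lam (fun j => Z j t) S v)).
Proof.
move=> OZ; have OL : isO e (fun t => Lam (fun j => Z j t) S v).
  apply: isO_sum => j.
  by have := isOM (isOM (OZ j) (isO_cst v)) (isO_cst (S j)); rewrite !addn0.
by have := isO_trace (isOM (isO_cst y) OL); rewrite add0n.
Qed.

(** Only the multiples [s X] with [s < 1] belong to [Q]; bounds involving [X] itself are reached by
    letting [s] tend to one. *)
Lemma affine_le1 (a b : R) : (forall s, 0 <= s -> s < 1 -> s * a + b <= 1) -> a + b <= 1.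
Proof.
move=> H; rewrite leNgt; apply/negP => ab.
have b1 : b <= 1 by have := H 0 (lexx 0) ltr01; rewrite mul0r add0r.
have a0 : 0 < a by lra.
pose dl := (a + b - 1) / (2 * a).
have dE : dl * (2 * a) = a + b - 1 by rewrite divfK // gt_eqF //; lra.
have d0 : 0 < dl by rewrite divr_gt0 //; lra.
have := H (1 - dl); rewrite mulrBl mul1r.
have -> : dl * a = (a + b - 1) / 2 by rewrite -dE; field.
have d2 : dl <= 1 by rewrite ler_pdivrMr; lra.
move=> /(_ ltac:(lra) ltac:(lra)); lra.
Qed.

(** The real part of the functional is at most one on the compressions of [X (+) Y] and equals one
    at [t = 0], where the linear term is absent. So the coefficient of [t^2], four times the
    difference of the two traces, has nonpositive real part. *)
Lemma second_order m (Y : ctup m) (D : 'M[C]_(m, N)) : (0 < m)%N -> Q Y ->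
  Re (\tr (y *m Lam (fun j => adj D *m Y j *m D) S v)) <= Re (\tr (y *m (adj D *m D *m v))).
Proof.
move=> m0 QY.
set E := adj D *m D.
have hE : adj E = E by rewrite adjM adjK.
have [c [d [d0 Oc cP]]] := resolvent_path hE.
have O2 : isOs 2 (fun t : R => t%:C%C ^+ 2) := isOsM isOs_t isOs_t.
pose kap j : 'M[C]_N := 4%:R *: (adj D *m Y j *m D) - 2%:R *: (E *m X j + X j *m E).
pose Z t j := (2%:R *: c t - 1%:M) *m X j *m (2%:R *: c t - 1%:M)
  + (4%:R * t%:C%C ^+ 2) *: (c t *m (adj D *m Y j *m D) *m c t).
have bound t : 0 < t -> t < d -> Re (\tr (y *m Lam (Z t) S v)) <= 1.
  move=> t0 td; have [hc c1] := cP t t0 td.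
  have [VV VB] := cayley_isometry hc c1.
  set V := col_mx _ _ in VV VB.
  pose A := Re (\tr (y *m Lam (fun j => (2%:R *: c t - 1%:M) *m X j *m (2%:R *: c t - 1%:M)) S v)).
  pose B := Re (\tr (y *m Lam (fun j => (4%:R * t%:C%C ^+ 2) *:
    (c t *m (adj D *m Y j *m D) *m c t)) S v)).
  have ZE : Re (\tr (y *m Lam (Z t) S v)) = A + B.
    rewrite /A /B -raddfD /= -mxtraceD -mulmxDr -Lam_tadd; congr (Re (\tr (_ *m Lam _ S v))).
  rewrite ZE; apply: affine_le1 => s s0 s1.
  have QsX : Q (tscale s X) by have [_ + _] := bX; apply.
  have := mc_compress mcQ N0 VV (mc_sum mcQ N0 m0 QsX QY) => /supp.
  suff -> : Re (\tr (y *m Lam (fun j => adj V *m tsum (tscale s X) Y j *m V) S v)) = s * A + B by [].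
  have -> : (fun j => adj V *m tsum (tscale s X) Y j *m V) =
      tadd (tscale s (fun j => (2%:R *: c t - 1%:M) *m X j *m (2%:R *: c t - 1%:M)))
        (fun j => (4%:R * t%:C%C ^+ 2) *: (c t *m (adj D *m Y j *m D) *m c t)).
    apply/funext => j; rewrite /tsum VB; congr (_ + _).
    by rewrite /tscale -scalemxAr -scalemxAl.
  rewrite Lam_tadd Lam_tscale mulmxDr -scalemxAr mxtraceD mxtraceZ raddfD /= -/B.
  by congr (_ + _); rewrite /A; case: (\tr _) => p q /=; rewrite mul0r subr0.
have OZt j : isO 3 (fun t => Z t j - X j - (t%:C%C ^+ 2) *: kap j).
  pose e1 t := c t - 1%:M; pose e2 t := e1 t + (t%:C%C ^+ 2) *: E.
  have Oe1 : isO 2 e1.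
    apply: isO_near d0 _ (isON (isOZ O2 (isOM (isO_cst E) Oc))) => t t0 td.
    by have [_ c1] := cP t t0 td; rewrite /e1 -c1 opprD addrA subrr sub0r.
  have Oe2 : isO 4 e2.
    apply: isO_near d0 _ (isON (isOZ O2 (isOM (isO_cst E) Oe1))) => t t0 td.
    have [_ c1] := cP t t0 td; rewrite /e2 /e1 mulmxBr mulmx1 scalerBr opprB.
    by rewrite -[in RHS]c1 opprD addrA subrr sub0r addrC.
  pose M := adj D *m Y j *m D.
  have O1 := isOD (isOM Oe2 (isO_cst (2%:R *: X j))) (isOM (isO_cst (2%:R *: X j)) Oe2).
  have O3 := isOM (isOM Oe1 (isO_cst (4%:R *: X j))) Oe1.
  have O4 := isOZ O2 (isOD (isOM (isOM Oe1 (isO_cst (4%:R *: M))) Oc) (isOM (isO_cst (4%:R *: M)) Oe1)).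
  have O5 := isOD (isO_le (isT : (3 <= 4)%N) O1) (isO_le (isT : (3 <= 4)%N) O3).
  have O6 := isOD O5 (isO_le (isT : (3 <= 4)%N) O4).
  apply: (isO_eq _ O6) => t.
  have UE : 2%:R *: c t - 1%:M = 1%:M + 2%:R *: e1 t.
    by rewrite /e1; move: (c t) => ct; apply/matrixP => p q; rewrite !mxE; ring.
  have ctE : c t = 1%:M + e1 t by rewrite /e1 addrC subrK.
  have EE : (t%:C%C ^+ 2) *: E = e2 t - e1 t by rewrite /e2 addrAC subrr add0r.
  rewrite /Z /kap -/M UE ctE.
  have -> : (t%:C%C ^+ 2) *: (4%:R *: M - 2%:R *: (E *m X j + X j *m E)) =
     (4%:R * t%:C%C ^+ 2) *: M - 2%:R *: ((e2 t - e1 t) *m X j + X j *m (e2 t - e1 t)).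
    by rewrite -EE scale_comb.
  exact: second_order_algebra.
have OPhi := isO_trace_Lam OZt.
set phiM := \tr (y *m Lam _ S v).
have kE : \tr (y *m Lam kap S v) = 4%:R * (phiM - \tr (y *m (E *m v))) := trace_kap _ _.
have : Re (\tr (y *m Lam kap S v)) <= 0.
  have [cc [d' [c0 d'0 Hc]]] := OPhi.
  apply: (@small_quadratic _ id cc (Num.min d d')) => //; first by rewrite lt_min d0.
  move=> t t0; rewrite lt_min => /andP[td td'].
  apply: le_trans (Hc t t0 td'); rewrite -normcN; apply: le_trans (normc_Re_le _).
  have h := Re_remainder (\tr (y *m Lam kap S v)) t (bound t t0 td).
  have e := trace_remainder (Z t) kap (t%:C%C ^+ 2).
  exact: (@eq_ind_r _ _ (fun x => t ^+ 2 * _ <= Re (- x)) h _ e).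
rewrite kE; exact: Re_mul4_le0.
Qed.

End Positivity.
End Family.

(** * The Hermitian form attached to an irreducible tuple *)

Section HermitianStructure.
Context {R : realType} {g : nat}.
Local Notation C := R[i].
Local Notation ctup n := ('I_g -> 'M[C]_n).
Local Notation Re := (@complex.Re R).
Local Notation Im := (@complex.Im R).

Lemma conjc_Im0 (z : C) : Im z = 0 -> conjc z = z.
Proof. by case: z => a b /= ->; rewrite oppr0. Qed.

Lemma herm_of_real_trace N (K : 'M[C]_N) :
  (forall M, adj M = M -> Im (\tr (M *m K)) = 0) -> adj K = K.
Proof.
move=> H; apply/eqP; rewrite -subr_eq0; apply/eqP; apply: herm_trace_eq0 => M hM.
rewrite mulmxBr raddfB /= -{1}hM -adjM tr_adj (mxtrace_mulC K) conjc_Im0 ?subrr //.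
exact: H.
Qed.

(** For an isotropic [x], put [w = x G] and test nonnegativity at [x - s w]: for small [s] the
    linear term [- 2 s tr (w adj w)] dominates unless [w = 0]. *)
Lemma trace_pd_kernel k (G : 'M[C]_k) : adj G = G ->
  (forall x : 'rV[C]_k, 0 <= Re (\tr (x *m G *m adj x))) ->
  (forall x : 'rV[C]_k, x *m G = 0 -> x = 0) ->
  forall x : 'rV[C]_k, x != 0 -> 0 < Re (\tr (x *m G *m adj x)).
Proof.
move=> hG psd ker0 x x0; rewrite lt_neqAle psd andbT eq_sym.
apply: contra_neq x0 => xGx; apply: ker0; set w := x *m G.
apply: mul_adj_eq0.
have wge : 0 <= \tr (w *m adj w) by apply: mul_adj_ge0.
set a := Re (\tr (w *m adj w)); set b := Re (\tr (w *m G *m adj w)).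
have aE : \tr (w *m adj w) = a%:C%C by rewrite RRe_real // ger0_real.
have a0 : 0 <= a by rewrite -ler0c -aE.
have b0 : 0 <= b by apply: psd.
rewrite aE; suff : a <= 0 by move=> a1; rewrite (_ : a = 0) //; apply/eqP; rewrite eq_le a1.
rewrite leNgt; apply/negP => apos.
(* This value gives [s^2 b <= s a], so that [- 2 s a + s^2 b < 0]. *)
pose s := a / (b + 1).
have b1 : 0 < b + 1 by rewrite ltr_wpDl.
have := psd (x - s%:C%C *: w).
have -> : \tr ((x - s%:C%C *: w) *m G *m adj (x - s%:C%C *: w)) =
    \tr (x *m G *m adj x) - (2 * s)%:C%C * a%:C%C + (s ^+ 2)%:C%C * \tr (w *m G *m adj w).
  rewrite adjB adj_realZ !mulmxBl !mulmxBr -!scalemxAl -!scalemxAr.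
  rewrite !raddfB /= !mxtraceZ -/w.
  have -> : w *m G *m adj x = w *m adj w by rewrite -mulmxA -{1}hG -adjM.
  rewrite aE; move: (\tr _) (\tr _) => p q.
  by rewrite !rmorphM rmorph_nat; ring.
have Re2 (p q : C) : Re (p - (2 * s)%:C%C * a%:C%C + (s ^+ 2)%:C%C * q) =
    Re p - 2 * s * a + s ^+ 2 * Re q.
  by case: p q => [p1 p2] [q1 q2] /=; ring.
rewrite Re2 xGx -/b => h.
have s0 : 0 < s by rewrite divr_gt0.
have sb : s * (b + 1) = a by rewrite divfK // gt_eqF.
have h2 : s ^+ 2 * b <= s * a by rewrite -sb expr2 -mulrA !ler_pM2l // lerDl.
have h3 : 0 < s * a by rewrite mulr_gt0.
by clear -h h2 h3; lra.
Qed.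

Section IrredGood.
Variables (N k : nat) (Q : forall N, ctup N -> Prop) (S : ctup k).
Variables (X : ctup N) (v : 'M[C]_(N, k)) (y : 'M[C]_(k, N)).
Hypotheses (N0 : (0 < N)%N) (mcQ : mxconvex Q) (bX : bdry (@Q N) X) (vE : Lam X S v = v).
Hypotheses (vfull : row_full v) (irrS : irred S).
Hypotheses (yE : left_kernel S X y) (yv : \tr (y *m v) = 1).
Hypothesis yreal : forall H, hermT H -> Im (\tr (y *m Lam H S v)) = 0.
Hypothesis supp : forall Y, Q Y -> Re (\tr (y *m Lam Y S v)) <= 1.

(** Since [v y] is Hermitian and [v] has a left inverse [L], [y] factors as [G adj v]; Hermitian
    symmetry of [v S_j y] becomes [S_j G = G adj (S_j)]. Semidefiniteness of [G] is the second-order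
    inequality at the zero tuple, and its kernel is an [S]-invariant space, hence zero by
    irreducibility, as [tr (y v) = 1] excludes [G = 0]. *)
Lemma good_of_support : good Q S.
Proof.
pose L := pinvmx v.
have Lv : L *m v = 1%:M by apply: mulVpmx.
have vL : adj v *m adj L = 1%:M by rewrite -adjM Lv adj1.
have hK j : adj (v *m S j *m y) = v *m S j *m y.
  apply: herm_of_real_trace => M hM; have := yreal (hermT_delta j hM).
  by rewrite Lam_delta mxtrace_mulC !mulmxA.
have hvy : adj (v *m y) = v *m y.
  have [hX _ _] := bX.
  have e : v *m y = \sum_j v *m S j *m y *m X j.
    by rewrite -{1}yE mulmx_sumr; apply: eq_bigr => j _; rewrite !mulmxA.
  rewrite [in LHS]e adj_sum -[v in RHS]vE mulmx_suml; apply: eq_bigr => j _.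
  by rewrite adjM hK hX !mulmxA.
have [G yG] : exists G, y = G *m adj v.
  by exists (L *m adj y); rewrite -mulmxA -adjM hvy mulmxA Lv mul1mx.
have vGv : v *m G *m adj v = v *m y by rewrite -mulmxA -yG.
have cancel (A B : 'M[C]_k) : v *m A *m adj v = v *m B *m adj v -> A = B.
  move=> /(congr1 (fun M => L *m M *m adj L)).
  by rewrite !mulmxA Lv !mul1mx -!mulmxA vL !mulmx1.
have hG : adj G = G.
  by apply: cancel; rewrite vGv -hvy -vGv !adjM adjK mulmxA.
have SG j : S j *m G = G *m adj (S j).
  apply: cancel.
  have -> : v *m (S j *m G) *m adj v = v *m S j *m y by rewrite yG !mulmxA.
  by rewrite -hK yG !adjM adjK hG !mulmxA.
have pos m (Y : ctup m) (psi : 'M[_]_(m, k)) : (0 < m)%N -> Q Y ->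
    0 <= Re (\tr ((psi - Lam Y S psi) *m G *m adj psi)).
  move=> m0 QY; pose D := psi *m L.
  have Dv : D *m v = psi by rewrite -mulmxA Lv mulmx1.
  have := second_order N0 mcQ bX vE yE yv supp D m0 QY.
  have -> : Lam (fun j => adj D *m Y j *m D) S v = adj D *m Lam Y S psi.
    by rewrite mulmx_Lam; apply: eq_bigr => j _; rewrite -Dv !mulmxA.
  have -> : adj D *m D *m v = adj D *m psi by rewrite -mulmxA Dv.
  have yD : y *m adj D = G *m adj psi by rewrite yG -mulmxA -adjM Dv.
  rewrite !mulmxA yD -subr_ge0 -raddfB /= -raddfB /= -mulmxBr.
  by rewrite mxtrace_mulC mulmxA.
exists G; split=> //; apply: trace_pd_kernel => //.
  move=> x; have [r r0 Qb] := lvl_ball (mc_lvl mcQ (isT : (0 < 1)%N)).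
  have Q0 : Q (fun=> 0 : 'M[C]_1).
    apply: Qb; first by move=> j; rewrite adj0.
    by rewrite /tnorm big1 ?ltW // => j _; rewrite mnorm0.
  have := pos 1%N _ x isT Q0; rewrite (_ : Lam _ S x = 0) ?subr0 //.
  by rewrite /Lam big1 // => j _; rewrite !mul0mx.
have [k0 irr] := irrS.
have [] := irr _ (kermx G) _.
- move=> j; apply/sub_kermxP; rewrite -mulmxA SG mulmxA.
  by rewrite (sub_kermxP (submx_refl _)) mul0mx.
- move=> kG x xG; have : (x <= kermx G)%MS by apply/sub_kermxP.
  by rewrite kG submx0 => /eqP.
- move=> fG; exfalso.
  have G0 : G = 0.
    have /sub_kermxP : (1%:M <= kermx G)%MS by apply: submx_full.
    by rewrite mul1mx.
  have := yv; rewrite yG G0 mul0mx mul0mx mxtrace0 => /eqP.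
  by rewrite eq_sym oner_eq0.
Qed.

End IrredGood.

(** Singularity is assumed only near one boundary point of one size; the conclusion concerns all
    sizes because direct sums with [Y] of any size compress back to size [N]. *)
Lemma irred_good N k (Q : forall N, ctup N -> Prop) (S : ctup k) X0 e :
  mxconvex Q -> (k * k + k < N)%N -> irred S -> bdry (@Q N) X0 -> 0 < e ->
  (forall X, bdry (@Q N) X -> tnorm (tadd X (tscale (-1) X0)) < e -> sing S X) ->
  good Q S.
Proof.
move=> mcQ Nk irrS bX0 e0 sB.
have N0 : (0 < N)%N by apply: leq_ltn_trans Nk.
have lQ := mc_lvl mcQ N0.
pose B X := bdry (@Q N) X /\ tnorm (tadd X (tscale (-1) X0)) < e.
have BX0 : B X0.
  split=> //; rewrite (_ : tnorm _ = 0) // /tnorm big1 // => j _.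
  by rewrite /tadd /tscale rmorphN rmorph1 scaleN1r subrr mnorm0.
have sB' X : B X -> sing S X by case; apply: sB.
have [X [v [[bX Xe] v0 vE maxr maxrho]]] := generic_point BX0 sB'.
have pth H : hermT H -> path_prop (@Q N) S X v H.
  move=> hH; apply: (boundary_path lQ bX Xe vE _ _ hH).
    by move=> X' b1 b2; apply: maxr.
  by move=> X' v' b1 b2; apply: maxrho.
have vfull := kernel_vector_full vE pth Nk irrS v0.
have [y [yE yv yreal supp]] := support_functional lQ bX vE v0 vfull pth.
exact: good_of_support N0 mcQ bX vE vfull irrS yE yv yreal supp.
Qed.

End HermitianStructure.

(** * Irreducible factors of a tuple *)

Section Factors.
Context {F : fieldType} {g : nat}.

Definition stuple := {k : nat & 'I_g -> 'M[F]_k}.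

(** [S1] is the restriction to the invariant row space and [S2] the action on the quotient, realised
    through [Q]. A kernel vector either has a nonzero image in the quotient or has its rows in the
    subspace. *)
Lemma invariant_split k (S : 'I_g -> 'M[F]_k) r (U : 'M[F]_(r, k)) :
  U != 0 -> ~~ row_full U -> (forall j, (U *m S j <= U)%MS) ->
  exists k1 k2 (S1 : 'I_g -> 'M[F]_k1) (S2 : 'I_g -> 'M[F]_k2),
    [/\ (k1 < k)%N, (k2 < k)%N &
    forall N (X : 'I_g -> 'M[F]_N), sing S X -> sing S1 X \/ sing S2 X].
Proof.
move=> U0 nfU stU.
pose b := row_base U; pose K := kermx b^T; pose Q := (row_base K)^T.
have rU : (0 < \rank U)%N by rewrite lt0n mxrank_eq0.
have rUk : (\rank U < k)%N by rewrite ltn_neqAle nfU rank_leq_col.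
have rb : \rank b = \rank U by rewrite eq_row_base.
have rK : \rank K = (k - \rank U)%N by rewrite mxrank_ker mxrank_tr rb.
have bQ : b *m Q = 0.
  apply: trmx_inj; rewrite trmx_mul trmxK trmx0.
  by apply/sub_kermxP; rewrite eq_row_base.
have stb j : (b *m S j <= b)%MS.
  have bU : (b :=: U)%MS := eq_row_base U.
  by rewrite bU; apply: submx_trans (stU j); apply: submxMr; rewrite bU.
have /fin_all_exists[S1 S1E] : forall j, exists s, b *m S j = s *m b.
  by move=> j; apply/submxP.
have /fin_all_exists[S2 S2E] : forall j, exists s, S j *m Q = Q *m s.
  move=> j; have : ((S j *m Q)^T <= Q^T)%MS.
    rewrite trmxK eq_row_base; apply/sub_kermxP; apply: trmx_inj.
    by rewrite trmx_mul !trmxK trmx0 mulmxA S1E -mulmxA bQ mulmx0.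
  move=> /submxP[D DE]; exists D^T; apply: trmx_inj.
  by rewrite (trmx_mul Q) (trmxK D); exact: DE.
exists (\rank U), (\rank K), S1, S2; split=> //.
  by rewrite rK ltn_subrL rU (leq_ltn_trans _ rUk).
move=> N X [v v0 vE].
have [vQ|vQ] := eqVneq (v *m Q) 0; last first.
  right; exists (v *m Q) => //.
  rewrite -[in RHS]vE mulmx_suml; apply: eq_bigr => j _.
  by rewrite -(mulmxA _ (S j)) S2E !mulmxA.
left.
have bK : (b <= kermx Q)%MS by apply/sub_kermxP.
have Kb : (kermx Q <= b)%MS.
  have := mxrank_leqif_sup bK; move/geq_leqif => <-.
  rewrite mxrank_ker mxrank_tr rb eq_row_base rK subKn //.
  exact: ltnW.
have /submxP[w wE] : (v <= b)%MS by apply: submx_trans Kb; apply/sub_kermxP.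
exists w; first by apply: contra_neq v0 => w0; rewrite wE w0 mul0mx.
apply: (row_free_inj (row_base_free U)); rewrite -/b -wE -[in RHS]vE mulmx_suml.
by apply: eq_bigr => j _; rewrite -mulmxA -S1E wE !mulmxA.
Qed.

Lemma irred_factors k (S : 'I_g -> 'M[F]_k) : exists s : seq stuple,
  (forall x, List.In x s -> irred (projT2 x)) /\
  forall N (X : 'I_g -> 'M[F]_N), sing S X -> exists2 x, List.In x s & sing (projT2 x) X.
Proof.
have [n] := ubnP k; elim: n => // n IH in k S *; rewrite ltnS => kn.
have [irr|nirr] := pselect (irred S).
  exists [:: existT _ k S]; split=> [x [<-|[]]|N X sS] //.
  by exists (existT _ k S) => //; left.
have [k0|k0] := posnP k.
  exists [::]; split=> // N X [v v0 _]; case/eqP: v0.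
  by subst k; apply/matrixP => i [].
have [r [U [stU U0 fU]]] : exists r (U : 'M[_]_(r, k)),
    [/\ forall j, (U *m S j <= U)%MS, U != 0 & ~~ row_full U].
  apply: contrapT => h; apply: nirr; split=> // r U stU.
  have [->|U0] := eqVneq U 0; [by left|right].
  by apply/negPn/negP => fU; apply: h; exists r, U.
have [k1 [k2 [S1 [S2 [k1k k2k H]]]]] := invariant_split U0 fU stU.
have [s1 [irr1 H1]] := IH k1 S1 (leq_trans k1k kn).
have [s2 [irr2 H2]] := IH k2 S2 (leq_trans k2k kn).
exists (s1 ++ s2); split=> [x /List.in_app_iff[]|N X /H[/H1|/H2] [x xs sx]]; auto.
  by exists x => //; apply/List.in_app_iff; left.
by exists x => //; apply/List.in_app_iff; right.
Qed.

End Factors.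

(** * Detection of boundary points by good tuples *)

Section Detection.
Context {R : realType} {g : nat}.
Local Notation C := R[i].
Local Notation ctup n := ('I_g -> 'M[C]_n).
Local Notation stup := (@stuple C g).

(** A kernel vector at [X0 + E] is recovered from [Lam E S v] by the inverse at [X0], so its norm is
    at most [tnorm E * c] times itself. *)
Lemma nonsing_open N k (S : ctup k) (X0 : ctup N) : ~ sing S X0 ->
  exists2 e, 0 < e & forall X, tnorm (tadd X (tscale (-1) X0)) < e -> ~ sing S X.
Proof.
rewrite sing_unit => /negP; rewrite negbK => U.
set M := (1%:M - _) in U.
pose c := (\sum_j mnorm (S j)) * mnorm (invmx M) + 1.
have c0 : 0 < c by rewrite ltr_wpDl // mulr_ge0 ?mnorm_ge0 // sumr_ge0 // => j _; apply: mnorm_ge0.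
exists c^-1; first by rewrite invr_gt0.
move=> X; set E := tadd X _ => Ee [v v0 vE].
have XE : X = tadd X0 E.
  by apply/funext => j; rewrite /E /tadd /tscale rmorphN rmorph1 scaleN1r addrC subrK.
have : mxvec v *m M = mxvec (Lam E S v).
  rewrite mulmxBr mulmx1 mul_LamM -linearB /=; congr mxvec.
  by rewrite -{1}vE XE Lam_tadd addrC addKr.
move=> /(congr1 (mulmx^~ (invmx M))); rewrite mulmxK // => vE2.
have : mnorm v <= mnorm v * (tnorm E * c).
  rewrite -mnorm_mxvec vE2; apply: le_trans (mnormM _ _) _; rewrite -vE2 !mnorm_mxvec.
  have LE : mnorm (Lam E S v) <= tnorm E * mnorm v * (\sum_j mnorm (S j)).
    apply: le_trans (mnorm_sum _ _ _) _; rewrite mulr_sumr; apply: ler_sum => j _.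
    apply: le_trans (mnormM _ _) _; apply: ler_wpM2r; first exact: mnorm_ge0.
    apply: le_trans (mnormM _ _) _; apply: ler_wpM2r; first exact: mnorm_ge0.
    by rewrite /tnorm (bigD1 j) //= lerDl sumr_ge0 // => i _; apply: mnorm_ge0.
  apply: le_trans (ler_wpM2r (mnorm_ge0 _) LE) _.
  rewrite [tnorm E * _]mulrC -!mulrA; apply: ler_wpM2l; first exact: mnorm_ge0.
  by apply: ler_wpM2l; [exact: tnorm_ge0|rewrite /c lerDl].
have : tnorm E * c < 1 by rewrite -ltr_pdivlMr // div1r.
have : 0 < mnorm v.
  rewrite lt_neqAle mnorm_ge0 andbT eq_sym; apply: contra_neq v0 => v00.
  by apply: mnorm_eq0; rewrite v00.
move=> vpos lt1; rewrite -[leLHS]mulr1 ler_pM2l // leNgt lt1 //.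
Qed.

Section Detect.
Variable Q : forall N, ctup N -> Prop.
Hypothesis mcQ : mxconvex Q.

Lemma tnorm_sub0 N (X : ctup N) : tnorm (tadd X (tscale (-1) X)) = 0.
Proof.
rewrite /tnorm big1 // => j _.
by rewrite /tadd /tscale rmorphN rmorph1 scaleN1r subrr mnorm0.
Qed.

Lemma tnorm_triangle N (X Y Z : ctup N) : tnorm (tadd X (tscale (-1) Z)) <=
  tnorm (tadd X (tscale (-1) Y)) + tnorm (tadd Y (tscale (-1) Z)).
Proof.
apply: le_trans (tnormD _ _); rewrite le_eqVlt; apply/orP; left; apply/eqP; congr tnorm.
apply/funext => j; rewrite /tadd /tscale rmorphN rmorph1 !scaleN1r.
by rewrite addrA subrK.
Qed.

(** By [irred_good], a tuple that is not good cannot be singular on a whole neighbourhood in the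
    boundary. Moving to a nearby boundary point where it is nonsingular, and shrinking the radius,
    discards it; the finite list is thus exhausted. *)
Lemma no_bad_cover N (s : seq stup) X0 e : bdry (@Q N) X0 -> 0 < e ->
  (forall x, List.In x s -> irred (projT2 x) /\ (projT1 x * projT1 x + projT1 x < N)%N) ->
  (forall X, bdry (@Q N) X -> tnorm (tadd X (tscale (-1) X0)) < e ->
    exists x, [/\ List.In x s, ~ good Q (projT2 x) & sing (projT2 x) X]) -> False.
Proof.
elim: s X0 e => [|x s IH] X0 e bX0 e0 irr H.
  by have [|x []] := H X0 bX0 _; rewrite ?tnorm_sub0.
have irrs z : List.In z s -> irred (projT2 z) /\ (projT1 z * projT1 z + projT1 z < N)%N.
  by move=> zs; apply: irr; right.
have [gx|ngx] := pselect (good Q (projT2 x)).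
  apply: (IH X0 e) => // X bX Xe; have [z [[<-|zs] ng sz]] := H X bX Xe; first by [].
  by exists z.
have [irrx szx] := irr x (or_introl erefl).
have [X1 [bX1 X1e nsX1]] : exists X1, [/\ bdry (@Q N) X1,
    tnorm (tadd X1 (tscale (-1) X0)) < e & ~ sing (projT2 x) X1].
  apply: contrapT => h; apply: ngx; apply: (irred_good mcQ szx irrx bX0 e0).
  by move=> X bX Xe; apply: contrapT => ns; apply: h; exists X.
have [e1 e10 He1] := nonsing_open nsX1.
apply: (IH X1 (Num.min e1 (e - tnorm (tadd X1 (tscale (-1) X0))))) => //.
  by rewrite lt_min e10 subr_gt0.
move=> X bX; rewrite lt_min => /andP[Xe1 Xe2].
have Xe : tnorm (tadd X (tscale (-1) X0)) < e.
  by apply: le_lt_trans (tnorm_triangle _ X1 _) _; rewrite -ltrBrDr.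
have [z [[<-|zs] ng sz]] := H X bX Xe; first by case: (He1 X Xe1).
by exists z.
Qed.

Lemma good_nonsing_nbhd N (s : seq stup) (X0 : ctup N) :
  (forall x, List.In x s -> good Q (projT2 x) -> ~ sing (projT2 x) X0) ->
  exists2 e, 0 < e & forall x, List.In x s -> good Q (projT2 x) ->
    forall X, tnorm (tadd X (tscale (-1) X0)) < e -> ~ sing (projT2 x) X.
Proof.
elim: s => [|x s IH] H; first by exists 1.
have [z zs gz|e e0 He] := IH; first by apply: H => //; right.
have [gx|ngx] := pselect (good Q (projT2 x)); last first.
  by exists e => // z [<- //|zs] gz; apply: He.
have [e1 e10 He1] := nonsing_open (H x (or_introl erefl) gx).
exists (Num.min e e1); first by rewrite lt_min e0.
by move=> z [<-|zs] gz X; rewrite lt_min => /andP[h1 h2]; [apply: He1|apply: He h1].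
Qed.

(** Zero padding enlarges the size without leaving the boundary, which provides the room demanded by
    [irred_good]. *)
Lemma bdry_pad n m (X : ctup n) : (0 < n)%N -> (0 < m)%N ->
  bdry (@Q n) X -> bdry (@Q (n + m)%N) (tsum X (fun=> 0)).
Proof.
move=> n0 m0 [hX below nQ].
have Q0 : Q (fun=> 0 : 'M[C]_m).
  have [r r0 Qb] := lvl_ball (mc_lvl mcQ m0).
  apply: Qb; first by move=> j; rewrite adj0.
  by rewrite /tnorm big1 ?ltW // => j _; rewrite mnorm0.
split.
- by move=> j; rewrite /tsum /adj tr_block_mx map_block_mx -/(adj _) hX !trmx0 !map_mx0.
- move=> s s0 s1; have := mc_sum mcQ n0 m0 (below s s0 s1) Q0.
  congr Q; apply/funext => j.
  by rewrite /tsum /tscale scale_block_mx !scaler0.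
- move=> QX; apply: nQ.
  have VV : adj (col_mx 1%:M 0 : 'M[C]_(n + m, n)) *m col_mx 1%:M 0 = 1%:M.
    rewrite /adj tr_col_mx map_row_mx trmx1 map_mx1 trmx0 map_mx0.
    by rewrite mul_row_col mulmx1 mulmx0 addr0.
  apply: (mc_restr mcQ n0 VV _ hX QX) => j.
  by rewrite /tsum mul_block_col mul_col_mx !mul0mx mulmx1 mul1mx !addr0.
Qed.

Lemma sing_pad n m k (S : ctup k) (X : ctup n) :
  sing S (tsum X (fun=> 0 : 'M[C]_m)) -> sing S X.
Proof.
move=> [v v0 vE].
have LE : Lam (tsum X (fun=> 0)) S v = col_mx (Lam X S (usubmx v)) 0.
  rewrite -{1}[v]vsubmxK /Lam.
  under eq_bigr => j _ do rewrite /tsum mul_block_col !mul0mx !addr0 mul_col_mx mul0mx.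
  elim/big_ind2: _ => [|a b c d -> ->|j _]; rewrite ?col_mx0 //.
    by rewrite add_col_mx addr0.
exists (usubmx v).
  apply: contra_neq v0 => u0; rewrite -vE LE u0.
  by rewrite /Lam big1 ?col_mx0 // => j _; rewrite mulmx0 mul0mx.
by rewrite -[in RHS]vE LE col_mxKu.
Qed.

(** If no good tuple were singular at [X], none would be near its padding, and the boundary there
    would be covered by the singular sets of tuples that are not good. *)
Lemma good_detects (s : seq stup) : (forall x, List.In x s -> irred (projT2 x)) ->
  (forall N X, (0 < N)%N -> bdry (@Q N) X -> exists2 x, List.In x s & sing (projT2 x) X) ->
  forall n (X : ctup n), (0 < n)%N -> bdry (@Q n) X ->
    exists x, [/\ List.In x s, good Q (projT2 x) & sing (projT2 x) X].
Proof.
move=> irr H n X n0 bX; apply: contrapT => nog.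
(* Large enough to exceed [k * k + k] for all sizes [k] in the list at once. *)
pose m := (\sum_(x <- s) (projT1 x * projT1 x + projT1 x)).+1.
have mbig x : List.In x s -> (projT1 x * projT1 x + projT1 x < n + m)%N.
  move=> xs; apply: leq_trans (leq_addl _ _); rewrite ltnS.
  elim: (s) xs => // z s' IH' [->|zs]; rewrite big_cons ?leq_addr //.
  exact: leq_trans (IH' zs) (leq_addl _ _).
have bX0 := bdry_pad n0 (isT : (0 < m)%N) bX.
have [|e e0 He] := @good_nonsing_nbhd (n + m) s (tsum X (fun=> 0)).
  by move=> x xs gx /sing_pad sx; apply: nog; exists x.
apply: (no_bad_cover bX0 e0 (s := s)); first by move=> x xs; split; [apply: irr|apply: mbig].
move=> X' bX' X'e; have [x xs sx] := H _ X' (ltn_addr _ n0) bX'.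
exists x; split=> // gx; exact: He X'e sx.
Qed.

End Detect.
End Detection.

(** * Real and imaginary parts, realification *)

Section Realify.
Context {R : realType}.
Local Notation C := R[i].
Local Notation Re := (@complex.Re R).
Local Notation Im := (@complex.Im R).

Definition Remx m n (A : 'M[C]_(m, n)) : 'M[R]_(m, n) := map_mx Re A.
Definition Immx m n (A : 'M[C]_(m, n)) : 'M[R]_(m, n) := map_mx Im A.
Definition toC m n (A : 'M[R]_(m, n)) : 'M[C]_(m, n) := map_mx (real_complex R) A.

Definition realify m n (A : 'M[C]_(m, n)) : 'M[R]_(m + m, n + n) :=
  block_mx (Remx A) (- Immx A) (Immx A) (Remx A).

Lemma RemxM m n p (A : 'M[C]_(m, n)) (B : 'M[C]_(n, p)) :
  Remx (A *m B) = Remx A *m Remx B - Immx A *m Immx B.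
Proof.
apply/matrixP => i j; rewrite !mxE raddf_sum -sumrB; apply: eq_bigr => k _ /=.
by rewrite !mxE; case: (A i k) (B k j) => a b [].
Qed.

Lemma ImmxM m n p (A : 'M[C]_(m, n)) (B : 'M[C]_(n, p)) :
  Immx (A *m B) = Remx A *m Immx B + Immx A *m Remx B.
Proof.
apply/matrixP => i j; rewrite !mxE raddf_sum -big_split; apply: eq_bigr => k _ /=.
by rewrite !mxE; case: (A i k) (B k j) => a b [].
Qed.

Lemma RemxD m n (A B : 'M[C]_(m, n)) : Remx (A + B) = Remx A + Remx B.
Proof. by apply/matrixP => i j; rewrite !mxE; case: (A i j) (B i j) => a b []. Qed.

Lemma ImmxD m n (A B : 'M[C]_(m, n)) : Immx (A + B) = Immx A + Immx B.
Proof. by apply/matrixP => i j; rewrite !mxE; case: (A i j) (B i j) => a b []. Qed.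

Lemma RemxZ m n a (A : 'M[C]_(m, n)) : Remx (a%:C%C *: A) = a *: Remx A.
Proof.
by apply/matrixP => i j; rewrite !mxE; case: (A i j) => x y /=; rewrite mul0r subr0.
Qed.

Lemma ImmxZ m n a (A : 'M[C]_(m, n)) : Immx (a%:C%C *: A) = a *: Immx A.
Proof.
by apply/matrixP => i j; rewrite !mxE; case: (A i j) => x y /=; rewrite mul0r addr0.
Qed.

Lemma Remx_toC m n (A : 'M[R]_(m, n)) : Remx (toC A) = A.
Proof. by apply/matrixP => i j; rewrite !mxE. Qed.

Lemma Immx_toC m n (A : 'M[R]_(m, n)) : Immx (toC A) = 0.
Proof. by apply/matrixP => i j; rewrite !mxE. Qed.

Lemma Remx_adj m n (A : 'M[C]_(m, n)) : Remx (adj A) = (Remx A)^T.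
Proof. by apply/matrixP => i j; rewrite !mxE; case: (A j i). Qed.

Lemma Immx_adj m n (A : 'M[C]_(m, n)) : Immx (adj A) = - (Immx A)^T.
Proof. by apply/matrixP => i j; rewrite !mxE; case: (A j i). Qed.

Lemma ReImmx m n (A B : 'M[C]_(m, n)) : Remx A = Remx B -> Immx A = Immx B -> A = B.
Proof.
move=> /matrixP hR /matrixP hI; apply/matrixP => i j.
have := hR i j; have := hI i j; rewrite !mxE.
by case: (A i j) (B i j) => a b [a' b'] /= -> ->.
Qed.

Lemma realifyM m n p (A : 'M[C]_(m, n)) (B : 'M[C]_(n, p)) :
  realify (A *m B) = realify A *m realify B.
Proof.
rewrite /realify mulmx_block RemxM ImmxM !mulmxN !mulNmx.
by congr block_mx; rewrite ?opprD // addrC.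
Qed.

Lemma realifyD m n (A B : 'M[C]_(m, n)) : realify (A + B) = realify A + realify B.
Proof. by rewrite /realify add_block_mx RemxD ImmxD opprD. Qed.

Lemma realifyZ m n a (A : 'M[C]_(m, n)) : realify (a%:C%C *: A) = a *: realify A.
Proof. by rewrite /realify scale_block_mx RemxZ ImmxZ scalerN. Qed.

Lemma realify_adj m n (A : 'M[C]_(m, n)) : realify (adj A) = (realify A)^T.
Proof.
rewrite /realify tr_block_mx Remx_adj Immx_adj opprK.
by have -> : (- Immx A)^T = - (Immx A)^T by rewrite linearN.
Qed.

Lemma realify_toC m n (A : 'M[R]_(m, n)) : realify (toC A) = block_mx A 0 0 A.
Proof. by rewrite /realify Remx_toC Immx_toC oppr0. Qed.

Lemma toC1 n : toC (1%:M : 'M[R]_n) = 1%:M.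
Proof. by rewrite /toC map_mx1. Qed.

Lemma realify1 n : realify (1%:M : 'M[C]_n) = 1%:M.
Proof. by rewrite -toC1 realify_toC -scalar_mx_block. Qed.

Lemma adj_toC m n (A : 'M[R]_(m, n)) : adj (toC A) = toC A^T.
Proof. by apply/matrixP => i j; rewrite !mxE /= oppr0. Qed.

End Realify.

Local Notation symT X := (forall j, (X j)^T = X j).

(** * Complexification of a real family *)

Section RealFamily.
Context {R : realType} {g : nat}.
Local Notation C := R[i].
Local Notation ctup n := ('I_g -> 'M[C]_n).
Local Notation rtup n := ('I_g -> 'M[R]_n).

Record real_family (P : forall n, rtup n -> Prop) : Prop := RealFamily {
  rf_sym : forall n X, P n X -> symT X;
  rf_cvx : forall n X Y s, (0 < n)%N -> P n X -> P n Y -> 0 <= s -> s <= 1 ->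
    P n (fun j => s *: X j + (1 - s) *: Y j);
  rf_ball : forall n, (0 < n)%N -> exists2 r, 0 < r & forall X : 'I_g -> 'M[_]_n,
    symT X -> (forall j a b, `|X j a b| <= r) -> P n X;
  rf_open : forall n X, (0 < n)%N -> P n X -> exists2 th, 1 < th & P n (fun j => th *: X j);
  rf_restr : forall N n (V : 'M[R]_(N, n)) W X, (0 < n)%N -> V^T *m V = 1%:M ->
    (forall j, W j *m V = V *m X j) -> symT X -> P N W -> P n X;
  rf_sum : forall n m X Y, (0 < n)%N -> (0 < m)%N -> P n X -> P m Y ->
    P (n + m)%N (fun j => block_mx (X j) 0 0 (Y j)) }.

Definition bdryR n (P : rtup n -> Prop) (X : rtup n) : Prop :=
  [/\ symT X, forall s, 0 <= s -> s < 1 -> P (fun j => s *: X j) & ~ P X].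

Section Complexify.
Variable P : forall n, rtup n -> Prop.
Hypothesis rfP : real_family P.

Definition cplx N (X : ctup N) : Prop :=
  hermT X /\ P (fun j => realify (X j)).

Lemma realify_sym N (X : ctup N) : hermT X -> forall j, (realify (X j))^T = realify (X j).
Proof. by move=> hX j; rewrite -realify_adj hX. Qed.

Lemma realify_entry N (A : 'M[C]_N) a b : `|realify A a b| <= mnorm A.
Proof.
have hR i j : `|complex.Re (A i j)| <= mnorm A.
  apply: le_trans (entry_le_mnorm A i j); case: (A i j) => x y /=.
  by rewrite -sqrtr_sqr ler_wsqrtr // lerDl sqr_ge0.
have hI i j : `|complex.Im (A i j)| <= mnorm A.
  by apply: le_trans (entry_le_mnorm A i j); apply: normc_Im_le.
rewrite -(fintype.splitK a) -(fintype.splitK b); case: (fintype.split a) (fintype.split b) => [i|i] [j|j] /=.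
- by rewrite block_mxEul mxE hR.
- by rewrite block_mxEur !mxE normrN hI.
- by rewrite block_mxEdl mxE hI.
- by rewrite block_mxEdr mxE hR.
Qed.

Lemma cplx_mxconvex : mxconvex cplx.
Proof.
split.
- move=> N N0; have NN : (0 < N + N)%N by rewrite addn_gt0 N0.
  split.
  + by move=> X [].
  + move=> X Y s [hX PX] [hY PY] s0 s1; split.
      by apply: hermT_add; apply: hermT_scale.
    have := rf_cvx rfP NN PX PY s0 s1; congr P; apply/funext => j.
    by rewrite /tadd /tscale realifyD !realifyZ.
  + have [r r0 H] := rf_ball rfP NN; exists r => // X hX Xr; split=> //.
    apply: H; first exact: realify_sym.
    move=> j a b; apply: le_trans (realify_entry _ _ _) (le_trans _ Xr).
    by rewrite /tnorm (bigD1 j) //= lerDl sumr_ge0 // => i _; apply: mnorm_ge0.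
  + move=> X [hX PX]; have [th th1 Pth] := rf_open rfP NN PX; exists th => //; split.
      exact: hermT_scale.
    by move: Pth; congr P; apply/funext => j; rewrite realifyZ.
- move=> N n V W X n0 VV WV hX [hW PW]; split=> //.
  have nn : (0 < n + n)%N by rewrite addn_gt0 n0.
  apply: (rf_restr rfP nn _ _ _ PW (V := realify V)).
  + by rewrite -realify_adj -realifyM VV realify1.
  + by move=> j; rewrite -!realifyM WV.
  + exact: realify_sym.
- move=> n m X Y n0 m0 [hX PX] [hY PY].
  have hXY : hermT (tsum X Y).
    by move=> j; rewrite /tsum /adj tr_block_mx map_block_mx -/(adj (X j)) -/(adj (Y j)) hX hY !trmx0 !map_mx0.
  split=> //.
  have nn : (0 < n + n)%N by rewrite addn_gt0 n0.
  have mm : (0 < m + m)%N by rewrite addn_gt0 m0.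
  have nm : (0 < n + m + (n + m))%N by rewrite !addn_gt0 n0.
  (* The realification of a direct sum is the direct sum of the realifications up to a permutation
     of the four blocks, which [realify A1] stacked on [realify A2] carries out. *)
  pose A1 : 'M[C]_(n, n + m) := row_mx 1%:M 0.
  pose A2 : 'M[C]_(m, n + m) := row_mx 0 1%:M.
  apply: (rf_restr rfP nm _ _ _ (rf_sum rfP nn mm PX PY) (V := col_mx (realify A1) (realify A2))).
  + rewrite tr_col_mx mul_row_col -!realify_adj -!realifyM -realifyD -realify1; congr realify.
    rewrite /adj !tr_row_mx !map_col_mx !trmx1 !trmx0 !map_mx1 !map_mx0 !mul_col_row.
    by rewrite !mul1mx !mul0mx add_block_mx !addr0 !add0r -scalar_mx_block.
  + move=> j; rewrite mul_block_col !mul0mx addr0 add0r [RHS]mul_col_mx -!realifyM.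
    congr (col_mx (realify _) (realify _)).
      by rewrite /tsum mul_row_block !mul0mx !mul1mx !addr0 mul_mx_row mulmx1 mulmx0.
    by rewrite /tsum mul_row_block !mul0mx !mul1mx !add0r mul_mx_row mulmx1 mulmx0.
  + exact: realify_sym.
Qed.

Lemma hermT_toC n (X : rtup n) : symT X -> hermT (fun j => toC (X j)).
Proof. by move=> hX j; rewrite adj_toC hX. Qed.

(** The realification of a real tuple is two copies of it, so the two implications are closure under
    restriction and under direct sums. *)
Lemma cplx_toC n (X : rtup n) : (0 < n)%N -> symT X ->
  cplx (fun j => toC (X j)) <-> P X.
Proof.
move=> n0 hX; split=> [[_]|PX].
  apply: (rf_restr rfP n0 _ _ hX (V := col_mx 1%:M 0)).
    by rewrite tr_col_mx mul_row_col trmx1 trmx0 mulmx1 mulmx0 addr0.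
  move=> j; rewrite realify_toC mul_block_col mul_col_mx.
  by rewrite !mul0mx mulmx1 mulmx0 mul1mx !addr0.
split; first exact: hermT_toC.
have := rf_sum rfP n0 n0 PX PX; congr P; apply/funext => j.
by rewrite realify_toC.
Qed.

Lemma sing_realify N k (X : ctup N) (S : rtup k) :
  sing S (fun j => realify (X j)) -> sing (fun j => toC (S j)) X.
Proof.
move=> [w w0 wE].
set w1 := usubmx w; set w2 := dsubmx w.
have wc : w = col_mx w1 w2 by rewrite vsubmxK.
have e : col_mx w1 w2 = col_mx
    (\sum_j (Remx (X j) *m w1 - Immx (X j) *m w2) *m S j)
    (\sum_j (Immx (X j) *m w1 + Remx (X j) *m w2) *m S j).
  rewrite -wc -[LHS]wE /Lam {1}wc.
  under eq_bigr => j _ do rewrite mul_block_col mul_col_mx mulNmx.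
  elim/big_ind3: _ => [|a b c a' b' c' -> ->|j _]; rewrite ?col_mx0 //.
  by rewrite add_col_mx.
have [e1 e2] := eq_col_mx e.
pose v := toC w1 + 'i%C *: toC w2.
have Rv : Remx v = w1.
  by apply/matrixP => i j; rewrite !mxE /= !(mul0r, mul1r, mulr0, subr0, addr0).
have Iv : Immx v = w2.
  by apply/matrixP => i j; rewrite !mxE /= !(mul0r, mul1r, mulr0, subr0, addr0, add0r).
exists v.
  apply: contra_neq w0 => v0; rewrite wc -Rv -Iv v0.
  by apply/matrixP => i j; rewrite !mxE; case: fintype.splitP => i' _; rewrite !mxE.
have RS m n (I : Type) (r : seq I) (F : I -> 'M[C]_(m, n)) :
    Remx (\sum_(i <- r) F i) = \sum_(i <- r) Remx (F i).
  elim/big_rec2: _ => [|i A B _ <-]; last by rewrite RemxD.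
  by apply/matrixP => a b; rewrite !mxE.
have IS m n (I : Type) (r : seq I) (F : I -> 'M[C]_(m, n)) :
    Immx (\sum_(i <- r) F i) = \sum_(i <- r) Immx (F i).
  elim/big_rec2: _ => [|i A B _ <-]; last by rewrite ImmxD.
  by apply/matrixP => a b; rewrite !mxE.
apply: ReImmx.
  rewrite /Lam RS Rv [RHS]e1; apply: eq_bigr => j _.
  by rewrite RemxM RemxM Remx_toC Immx_toC mulmx0 subr0 Rv Iv.
rewrite /Lam IS Iv [RHS]e2; apply: eq_bigr => j _.
by rewrite ImmxM ImmxM Remx_toC Immx_toC mulmx0 add0r Rv Iv addrC.
Qed.

Lemma complex_factors (s : seq {k & rtup k}) : exists s' : seq (@stuple C g),
  (forall x, List.In x s' -> irred (projT2 x)) /\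
  forall N (X : ctup N) x, List.In x s -> sing (fun j => toC (projT2 x j)) X ->
    exists2 y, List.In y s' & sing (projT2 y) X.
Proof.
elim: s => [|x s [s1 [irr1 H1]]]; first by exists [::]; split.
have [s2 [irr2 H2]] := irred_factors (fun j => toC (projT2 x j)).
exists (s1 ++ s2); split=> [y /List.in_app_iff[]|N X y]; auto.
case=> [<-|ys] h.
  by have [z zs sz] := H2 _ _ h; exists z => //; apply/List.in_app_iff; right.
by have [z zs sz] := H1 _ _ _ ys h; exists z => //; apply/List.in_app_iff; left.
Qed.

Lemma real_good_detects (s : seq {k & rtup k}) :
  (forall n (X : rtup n), (0 < n)%N -> bdryR (@P n) X ->
    exists2 x, List.In x s & sing (projT2 x) X) ->
  exists s' : seq (@stuple C g), forall N (X : ctup N), (0 < N)%N -> bdry (@cplx N) X ->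
    exists x, [/\ List.In x s', good cplx (projT2 x) & sing (projT2 x) X].
Proof.
move=> H; have [s' [irr H']] := complex_factors s; exists s'.
apply: (good_detects cplx_mxconvex irr).
move=> N Y N0 [hY below nQ].
have bR : bdryR (@P (N + N)%N) (fun j => realify (Y j)).
  split; first exact: realify_sym.
    move=> t t0 t1; have [_] := below t t0 t1; congr P; apply/funext => j.
    by rewrite realifyZ.
  by move=> PY; apply: nQ.
have [|x xs sx] := H _ _ _ bR; first by rewrite addn_gt0 N0.
exact: H' xs (sing_realify sx).
Qed.

End Complexify.
End RealFamily.

(** * Cholesky factorisation *)

Section Cholesky.
Context {R : realType}.
Local Notation C := R[i].
Local Notation Re := (@complex.Re R).

Definition cposdef k (G : 'M[C]_k) : Prop :=
  adj G = G /\ forall x : 'rV[C]_k, x != 0 -> 0 < Re (\tr (x *m G *m adj x)).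

Lemma adj_row_mx m n1 n2 (A : 'M[C]_(m, n1)) (B : 'M[C]_(m, n2)) :
  adj (row_mx A B) = col_mx (adj A) (adj B).
Proof. by rewrite /adj tr_row_mx map_col_mx. Qed.

Lemma adj_block_mx m1 m2 n1 n2 (A : 'M[C]_(m1, n1)) (B : 'M[C]_(m1, n2))
    (D : 'M[C]_(m2, n1)) (E : 'M[C]_(m2, n2)) :
  adj (block_mx A B D E) = block_mx (adj A) (adj D) (adj B) (adj E).
Proof. by rewrite /adj tr_block_mx map_block_mx. Qed.

Lemma cholesky k (G : 'M[C]_k) : cposdef G -> exists2 T : 'M[C]_k, T \in unitmx & G = T *m adj T.
Proof.
elim: k G => [|k IH]; last rewrite -[k.+1]/(1 + k)%N; move=> G [hG pd].
  by exists 1%:M; [apply: unitmx1|apply/matrixP => -[]].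
have [a [b [D GE]]] : exists (a : 'M[C]_1) (b : 'M[_]_(1, k)) (D : 'M[_]_k), G = block_mx a b (adj b) D.
  exists (ulsubmx G), (ursubmx G), (drsubmx G).
  have -> : adj (ursubmx G) = dlsubmx G.
    have : adj (block_mx (ulsubmx G) (ursubmx G) (dlsubmx G) (drsubmx G)) =
      block_mx (ulsubmx G) (ursubmx G) (dlsubmx G) (drsubmx G) by rewrite submxK.
    by rewrite adj_block_mx => /eq_block_mx [_ _ -> _].
  by rewrite submxK.
have := hG; rewrite GE adj_block_mx adjK => /eq_block_mx [ha _ _ hD].
have [r aE] : exists r : R, a = r%:C%C%:M.
  exists (Re (a 0 0)); rewrite [LHS]mx11_scalar; congr (_%:M).
  have := congr1 (fun M : 'M[_]_1 => M 0 0) ha; rewrite !mxE.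
  by case: (a 0 0) => p q /= [/eqP]; rewrite eq_sym -subr_eq0 opprK -mulr2n mulrn_eq0 /= => /eqP ->.
have r0 : 0 < r.
  have x0 : (row_mx 1%:M 0 : 'rV[C]_(1 + k)) != 0.
    apply/eqP => /(congr1 (fun M : 'rV[C]_(1 + k) => M 0 (lshift k 0))).
    by rewrite row_mxEl !mxE eqxx => /eqP; rewrite oner_eq0.
  have := pd _ x0; rewrite GE adj_row_mx mul_row_block !mul1mx !mul0mx !addr0.
  by rewrite mul_row_col adj1 adj0 mulmx1 mulmx0 addr0 aE mxtrace_scalar.
have rne : r%:C%C != 0 :> C by rewrite eq_complex /= eqxx andbT gt_eqF.
pose D' := D - (r%:C%C)^-1 *: (adj b *m b).
have rV : (r%:C%C)^-1 = (r^-1)%:C%C :> C by rewrite fmorphV.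
have hD' : adj D' = D' by rewrite /D' rV adjB hD adj_realZ adjM adjK.
have pd' : forall x : 'rV[C]_k, x != 0 -> 0 < Re (\tr (x *m D' *m adj x)).
  (* The first coordinate minimises the form of [G] for fixed [x]; at that point the form takes the
     value of the Schur complement. *)
  move=> x x0; pose z : 'rV[C]_(1 + k) := row_mx (- (r%:C%C)^-1 *: (x *m adj b)) x.
  have z0 : z != 0.
    apply: contra_neq x0 => zz; apply/matrixP => i j.
    by have := congr1 (fun M : 'rV[C]_(1 + k) => M i (rshift 1 j)) zz; rewrite row_mxEr !mxE.
  have := pd _ z0; rewrite GE aE /z adj_row_mx mul_row_block mul_row_col.
  have -> : (- (r%:C%C)^-1 *: (x *m adj b)) *m (r%:C%C)%:M + x *m adj b = 0.
    by rewrite mul_mx_scalar scalerA mulrN mulfV // scaleN1r addNr.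
  rewrite mul0mx add0r; congr (0 < Re (\tr (_ *m _))).
  by rewrite /D' mulmxBr -scalemxAl -scalemxAr mulmxA scaleNr addrC.
have [T' uT' D'E] := IH D' (conj hD' pd').
pose be := Num.sqrt r.
have be0 : be%:C%C != 0 :> C by rewrite eq_complex /= eqxx andbT gt_eqF // sqrtr_gt0.
have bb : be%:C%C * be%:C%C = r%:C%C :> C by rewrite -rmorphM -expr2 sqr_sqrtr // ltW.
pose T : 'M[C]_(1 + k) := block_mx (be%:C%C)%:M 0 ((be%:C%C)^-1 *: adj b) T'.
have beV : conjc (be%:C%C)^-1 = (be%:C%C)^-1 :> C.
  by rewrite -fmorphV; apply: conjc_real.
exists T.
  rewrite unitmxE det_lblock det_scalar expr1 unitrM -unitmxE uT' andbT.
  by rewrite unitfE.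
have adjbe : adj ((be%:C%C)%:M : 'M[C]_1) = (be%:C%C)%:M.
  by rewrite -scalemx1 adj_realZ adj1.
rewrite /T adj_block_mx adj0 adjbe mulmx_block !mulmx0 !mul0mx !addr0.
rewrite adjZ adjK beV -D'E /D' -scalar_mxM bb aE.
rewrite mul_scalar_mx scalerA mulfV // scale1r mul_mx_scalar scalerA mulfV // scale1r.
rewrite -scalemxAl -scalemxAr scalerA -invfM bb addrCA subrr addr0.
by [].
Qed.

Lemma cposdef_mx k m (G : 'M[C]_k) (psi : 'M[C]_(m, k)) : cposdef G -> psi != 0 ->
  0 < Re (\tr (psi *m G *m adj psi)).
Proof.
move=> [hG pd] psi0.
have trE : \tr (psi *m G *m adj psi) = \sum_i \tr (row i psi *m G *m adj (row i psi)).
  apply: eq_bigr => i _; rewrite /mxtrace big_ord1.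
  rewrite -row_mul !mxE; apply: eq_bigr => j _; rewrite !mxE; congr (_ * _).
have ge0 i : 0 <= Re (\tr (row i psi *m G *m adj (row i psi))).
  have [->|/pd/ltW //] := eqVneq (row i psi) 0.
  by rewrite !mul0mx mxtrace0.
rewrite trE raddf_sum /= lt_neqAle sumr_ge0 ?andbT //.
apply: contra_neq psi0 => /esym h; apply/row_matrixP => i; rewrite row0.
apply/eqP; apply: contraT => /pd.
by have /(psumr_eq0P (fun i _ => ge0 i))/(_ i isT) -> := h; rewrite ltxx.
Qed.

End Cholesky.

(** * From good tuples to one linear matrix inequality *)

Section LMI.
Context {R : realType} {g : nat}.
Local Notation C := R[i].
Local Notation ctup n := ('I_g -> 'M[C]_n).
Local Notation rtup n := ('I_g -> 'M[R]_n).
Local Notation Re := (@complex.Re R).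

(** Positive definiteness of [I - L_AA(X)] read on matrices instead of tensor vectors;
    [posdef_pencil] is the dictionary. *)
Definition lmi_form n m (AA : rtup m) (X : rtup n) : Prop :=
  forall v : 'M[R]_(n, m), v != 0 -> 0 < \tr (v^T *m (v - Lam X AA v)).

Definition is_lmi (D : forall n, rtup n -> Prop) : Prop :=
  exists m (AA : rtup m), [/\ (0 < m)%N, symT AA &
    forall n (X : rtup n), (0 < n)%N -> D n X <-> lmi_form AA X].

Lemma trace_gram_gt0 n m (v : 'M[R]_(n, m)) : v != 0 -> 0 < \tr (v^T *m v).
Proof.
have ge0 i j : 0 <= v^T i j * v j i by rewrite mxE -expr2 sqr_ge0.
have ge1 i : 0 <= (v^T *m v) i i by rewrite mxE; apply: sumr_ge0.
move=> v0; rewrite lt_neqAle sumr_ge0 ?andbT //; apply: contra_neq v0 => /esym h.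
apply/matrixP => i j; rewrite mxE.
have /(psumr_eq0P (fun i _ => ge1 i))/(_ j isT) := h.
rewrite mxE => /(psumr_eq0P (fun i _ => ge0 j i))/(_ i isT).
by rewrite mxE -expr2 => /eqP; rewrite sqrf_eq0 => /eqP.
Qed.

Lemma is_lmi_true : is_lmi (fun _ _ => True).
Proof.
exists 1%N, (fun=> 0); split=> // [j|n X n0]; first by rewrite trmx0.
split=> // _ v v0; rewrite (_ : Lam _ _ _ = 0) ?subr0.
  exact: trace_gram_gt0.
by rewrite /Lam big1 // => j _; rewrite mulmx0.
Qed.

Lemma is_lmi_and D1 D2 : is_lmi D1 -> is_lmi D2 -> is_lmi (fun n X => D1 n X /\ D2 n X).
Proof.
move=> [m1 [A1 [m10 s1 H1]]] [m2 [A2 [m20 s2 H2]]].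
pose A j := block_mx (A1 j) 0 0 (A2 j).
have formE n (X : rtup n) (v1 : 'M[R]_(n, m1)) (v2 : 'M[R]_(n, m2)) :
    \tr ((row_mx v1 v2)^T *m (row_mx v1 v2 - Lam X A (row_mx v1 v2))) =
    \tr (v1^T *m (v1 - Lam X A1 v1)) + \tr (v2^T *m (v2 - Lam X A2 v2)).
  have -> : Lam X A (row_mx v1 v2) = row_mx (Lam X A1 v1) (Lam X A2 v2).
    rewrite /Lam /A.
    under eq_bigr => j _ do rewrite mul_mx_row mul_row_block !mulmx0 addr0 add0r.
    elim/big_ind3: _ => [|a b c a' b' c' -> ->|j _]; rewrite ?row_mx0 //.
    by rewrite add_row_mx.
  rewrite opp_row_mx add_row_mx mxtrace_mulC tr_row_mx mul_row_col mxtraceD.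
  by rewrite mxtrace_mulC [X in _ + X = _]mxtrace_mulC.
exists (m1 + m2)%N, A; split.
- by rewrite addn_gt0 m10.
- by move=> j; rewrite /A tr_block_mx s1 s2 !trmx0.
move=> n X n0; split=> [[/(H1 n X n0) f1 /(H2 n X n0) f2]|f].
  have ge (m : nat) (B : 'I_g -> 'M[_]_m) (v : 'M[_]_(n, m)) : lmi_form B X ->
      0 <= \tr (v^T *m (v - Lam X B v)).
    move=> fB; have [->|/fB/ltW //] := eqVneq v 0.
    by rewrite trmx0 mul0mx mxtrace0.
  move=> v; rewrite -[v]hsubmxK; set v1 := lsubmx v; set v2 := rsubmx v => v0.
  rewrite formE; have [v10|v10] := eqVneq v1 0.
    have v20 : v2 != 0 by apply: contra_neq v0 => v20; rewrite v10 v20 row_mx0.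
    by apply: ltr_wpDl; [apply: ge|apply: f2].
  by apply: ltr_wpDr; [apply: ge|apply: f1].
split; [apply/H1 => // v v0|apply/H2 => // v v0].
  have := f (row_mx v 0); rewrite formE trmx0 mul0mx mxtrace0 addr0; apply.
  by apply: contra_neq v0; rewrite -[RHS]row_mx0 => /eq_row_mx[].
have := f (row_mx 0 v); rewrite formE trmx0 mul0mx mxtrace0 add0r; apply.
by apply: contra_neq v0; rewrite -[RHS]row_mx0 => /eq_row_mx[].
Qed.

Lemma Remx_toCM m n p (A : 'M[R]_(m, n)) (B : 'M[C]_(n, p)) :
  Remx (toC A *m B) = A *m Remx B.
Proof. by rewrite RemxM Remx_toC Immx_toC mul0mx subr0. Qed.

Lemma Immx_toCM m n p (A : 'M[R]_(m, n)) (B : 'M[C]_(n, p)) :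
  Immx (toC A *m B) = A *m Immx B.
Proof. by rewrite ImmxM Remx_toC Immx_toC mul0mx addr0. Qed.

Lemma lmi_of_hermitian k (A : ctup k) : (0 < k)%N -> hermT A ->
  is_lmi (fun n X => forall chi : 'M[C]_(n, k), chi != 0 ->
    0 < Re (\tr ((chi - Lam (fun j => toC (X j)) A chi) *m adj chi))).
Proof.
move=> k0 hA.
(* [AA j] is right multiplication by [A j] on rows split into real and imaginary parts. *)
pose AA j := block_mx (Remx (A j)) (Immx (A j)) (- Immx (A j)) (Remx (A j)).
have AAsym j : (AA j)^T = AA j.
  have := hA j => e; rewrite /AA tr_block_mx; congr block_mx.
  - by rewrite -[in RHS]e Remx_adj.
  - by rewrite -[in RHS]e Immx_adj linearN.
  - by rewrite -{2}e Immx_adj opprK.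
  - by rewrite -[in RHS]e Remx_adj.
have formE n (X : rtup n) (chi : 'M[C]_(n, k)) :
    Re (\tr ((chi - Lam (fun j => toC (X j)) A chi) *m adj chi)) =
    \tr ((row_mx (Remx chi) (Immx chi))^T *m
      (row_mx (Remx chi) (Immx chi) - Lam X AA (row_mx (Remx chi) (Immx chi)))).
  have -> : Lam X AA (row_mx (Remx chi) (Immx chi)) =
      row_mx (Remx (Lam (fun j => toC (X j)) A chi)) (Immx (Lam (fun j => toC (X j)) A chi)).
    rewrite /Lam.
    elim/big_ind2: _ => [|a b c d -> ->|j _].
    - by rewrite /Remx /Immx !map_mx0 row_mx0.
    - by rewrite RemxD ImmxD add_row_mx.
    - rewrite RemxM (ImmxM (toC (X j) *m chi)) Remx_toCM Immx_toCM /AA mul_mx_row mul_row_block.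
      by rewrite mulmxN.
  move: (Lam _ A chi) => w.
  have trRe (M : 'M[C]_n) : Re (\tr M) = \tr (Remx M).
    by rewrite /mxtrace raddf_sum; apply: eq_bigr => i _; rewrite mxE.
  rewrite trRe RemxM Remx_adj Immx_adj mulmxN opprK opp_row_mx add_row_mx.
  rewrite [RHS]mxtrace_mulC tr_row_mx mul_row_col.
  have -> : Remx (chi - w) = Remx chi - Remx w by apply/matrixP => i j; rewrite !mxE raddfB.
  by have -> : Immx (chi - w) = Immx chi - Immx w by apply/matrixP => i j; rewrite !mxE raddfB.
exists (k + k)%N, AA; split=> //; first by rewrite addn_gt0 k0.
move=> n X n0; split=> [H w w0|f chi chi0].
  pose chi : 'M[C]_(n, k) := toC (lsubmx w) + 'i%C *: toC (rsubmx w).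
  have Rc : Remx chi = lsubmx w.
    by apply/matrixP => i j; rewrite !mxE /= !(mul0r, mul1r, mulr0, subr0, addr0).
  have Ic : Immx chi = rsubmx w.
    by apply/matrixP => i j; rewrite !mxE /= !(mul0r, mul1r, mulr0, subr0, addr0, add0r).
  have := H chi; rewrite formE Rc Ic hsubmxK; apply.
  apply: contra_neq w0 => c0; rewrite -[w]hsubmxK -Rc -Ic c0.
  by rewrite /Remx /Immx !map_mx0 row_mx0.
rewrite formE; apply: f; apply: contra_neq chi0; rewrite -[RHS]row_mx0 => /eq_row_mx[r0 i0].
by apply: ReImmx; rewrite ?r0 ?i0 /Remx /Immx map_mx0.
Qed.

Definition good_form k (S : ctup k) (G : 'M[C]_k) n (X : rtup n) : Prop :=
  forall psi : 'M[C]_(n, k), psi != 0 ->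
    0 < Re (\tr ((psi - Lam (fun j => toC (X j)) S psi) *m G *m adj psi)).

(** With [G = T adj T], conjugation by [T] turns [S] into a Hermitian tuple and the form of [G] into
    the standard one. *)
Lemma lmi_of_good k (S : ctup k) (G : 'M[C]_k) : (0 < k)%N -> cposdef G ->
  (forall j, S j *m G = G *m adj (S j)) -> is_lmi (good_form S G).
Proof.
move=> k0 pdG SG; have [T uT GE] := cholesky pdG.
pose A j := invmx T *m S j *m T.
have hA : hermT A.
  move=> j; rewrite /A; have := SG j; rewrite GE => e.
  have e2 : T *m (adj T *m adj (S j) *m adj (invmx T)) = S j *m T.
    rewrite !mulmxA -[T *m adj T *m _]e -!mulmxA -adjM mulVmx // adj1 mulmx1.
    by [].
  rewrite !adjM mulmxA; apply: (can_inj (mulKmx uT)).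
  by rewrite e2 -mulmxA mulKVmx.
have [m [AA [m0 sAA H]]] := lmi_of_hermitian k0 hA.
exists m, AA; split=> // n X n0; rewrite -H //.
have formE psi : (psi - Lam (fun j => toC (X j)) S psi) *m G *m adj psi =
    (psi *m T - Lam (fun j => toC (X j)) A (psi *m T)) *m adj (psi *m T).
  have -> : Lam (fun j => toC (X j)) A (psi *m T) = Lam (fun j => toC (X j)) S psi *m T.
    rewrite /Lam mulmx_suml; apply: eq_bigr => j _.
    by rewrite /A !mulmxA mulmxK.
  by rewrite -mulmxBl GE adjM !mulmxA.
split=> [h chi chi0|h psi psi0].
  have := h (chi *m invmx T); rewrite formE mulmxKV //; apply.
  by apply: contra_neq chi0 => c0; rewrite -(mulmxKV uT chi) c0 mul0mx.
by rewrite formE; apply: h; apply: contra_neq psi0 => c0; rewrite -(mulmxK uT psi) c0 mul0mx.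
Qed.

Section Main.
Variable P : forall n, rtup n -> Prop.
Hypothesis rfP : real_family P.

(** A good tuple yields only a weak inequality; strictness comes from applying it to [th X] with
    [th > 1]. *)
Lemma good_form_on_family k (S : ctup k) G n (X : rtup n) : (0 < n)%N ->
  cposdef G ->
  (forall m (Y : ctup m) (psi : 'M[_]_(m, k)), (0 < m)%N -> cplx P Y ->
      0 <= Re (\tr ((psi - Lam Y S psi) *m G *m adj psi))) ->
  P X -> good_form S G X.
Proof.
move=> n0 pdG H PX psi psi0.
have [th th1 Pth] := rf_open rfP n0 PX.
have Qth := (cplx_toC rfP n0 (rf_sym rfP Pth)).2 Pth.
have := H _ _ psi n0 Qth; have := cposdef_mx pdG psi0.
have -> : (fun j => toC (th *: X j)) = tscale th (fun j => toC (X j)).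
  by apply/funext => j; rewrite /tscale /toC map_mxZ.
rewrite Lam_tscale !mulmxBl -!scalemxAl !raddfB /=.
have -> : \tr (th%:C%C *: (Lam (fun j => toC (X j)) S psi *m G *m adj psi)) =
  th%:C%C * \tr (Lam (fun j => toC (X j)) S psi *m G *m adj psi) by rewrite mxtraceZ.
move: (\tr (Lam _ S psi *m G *m adj psi)) (\tr (psi *m G *m adj psi)) => [p q] [p' q'] /=.
rewrite mul0r subr0; clear -th1; nra.
Qed.

(** [D] is the conjunction of the inequalities of the good tuples. A point of [D] outside [P] has a
    multiple [c X] in the boundary with [0 < c <= 1], where a good tuple is singular; at [X] the
    kernel vector has eigenvalue [1 / c >= 1], against its inequality. *)
Theorem lmi_of_real_family (s : seq {k & rtup k}) :
  (forall n (X : rtup n), (0 < n)%N -> bdryR (@P n) X ->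
    exists2 x, List.In x s & sing (projT2 x) X) ->
  exists m (AA : rtup m), [/\ (0 < m)%N, symT AA &
    forall n (X : rtup n), (0 < n)%N -> symT X ->
      P X <-> lmi_form AA X].
Proof.
move=> Hs; have [s' Hs'] := real_good_detects rfP Hs.
have [D [[m [AA [m0 sAA HD]]] [PD Dbd]]] : exists D : forall n, rtup n -> Prop,
    is_lmi D /\ (forall n (X : 'I_g -> 'M[_]_n), (0 < n)%N -> P X -> D n X) /\
    (forall n (X : rtup n) x c, D n X -> List.In x s' -> good (cplx P) (projT2 x) ->
      0 < c -> c <= 1 -> ~ sing (projT2 x) (tscale c (fun j => toC (X j)))).
  elim: s' {Hs'} => [|x s1 [D1 [lD1 [PD1 Db1]]]].
    by exists (fun _ _ => True); split; [exact: is_lmi_true|split].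
  have [gx|ngx] := pselect (good (cplx P) (projT2 x)); last first.
    exists D1; split=> //; split=> // n X y c DX [<- //|ys]; exact: Db1.
  have [G [hG pd SG pos]] := gx.
  have pdG : cposdef G by split.
  have [k0|k0] := posnP (projT1 x).
    exists D1; split=> //; split=> // n X y c DX [<-|ys]; last exact: Db1.
    move=> _ _ _ [v v0 _]; case/eqP: v0; apply/matrixP => i j.
    by exfalso; move: j; rewrite k0 => -[].
  exists (fun n X => D1 n X /\ good_form (projT2 x) G X).
  split; first by apply: is_lmi_and => //; apply: lmi_of_good.
  split=> [n X n0 PX|n X y c [DX gX] [<-|ys]]; last exact: Db1.
    by split; [exact: PD1|exact: good_form_on_family PX].
  move=> _ c0 c1 [v v0 vE].
  have := gX v v0; have := cposdef_mx pdG v0.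
  have -> : Lam (fun j => toC (X j)) (projT2 x) v = (c^-1)%:C%C *: v.
    by rewrite -[in RHS]vE Lam_tscale scalerA -rmorphM mulVf ?gt_eqF // rmorph1 scale1r.
  rewrite !mulmxBl -!scalemxAl raddfB /= mxtraceZ.
  have c'1 : 1 <= c^-1 by rewrite invf_ge1.
  move: (\tr _) => [p q] /=; rewrite mul0r subr0; clear -c'1; nra.
exists m, AA; split=> // n X n0 hX; rewrite -HD //; split=> [PX|DX]; first exact: PD.
apply: contrapT => nP.
have lQ := mc_lvl (cplx_mxconvex rfP) n0.
have hXc := hermT_toC hX.
have nQ : ~ cplx P (fun j => toC (X j)) by move/(cplx_toC rfP n0 hX).
have [r r0 Qb] := lvl_ball lQ.
set Xc := (fun j => toC (X j)) in hXc nQ.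
have t1 : 0 < tnorm Xc + 1 by rewrite ltr_wpDl // tnorm_ge0.
have [|c c0 cr|c c0 Qc|c /andP[c1 c2] bc] := @bdry_scale_exists _ _ _ _ Xc (r / (tnorm Xc + 1)) 1 lQ hXc.
- by rewrite divr_gt0.
- apply: Qb; first exact: hermT_scale.
  rewrite tnormZ ger0_norm //.
  apply: le_trans (_ : c * (tnorm Xc + 1) <= r).
    by rewrite ler_wpM2l // lerDl.
  by rewrite -ler_pdivlMr // ltW.
- rewrite leNgt; apply/negP => c1; apply: nQ.
  have -> : Xc = tscale c^-1 (tscale c Xc) by rewrite tscaleA mulVf ?gt_eqF // tscale1.
  by apply: (lvl_scale lQ Qc); [rewrite invr_ge0 ltW|rewrite invf_le1 // ltW].
have [x [xs gx sx]] := Hs' _ _ n0 bc.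
apply: (Dbd n X x c DX xs gx _ c2 sx); apply: lt_le_trans c1; exact: divr_gt0.
Qed.

End Main.

End LMI.

(** * Tensor vectors as matrices *)

Section TensorVec.
Context {R : realType}.

(** Arranged so that [A *t X] acts as [w |-> X w A^T], which turns pencils into the operator
    [Lam]. *)
Definition tmat n d (w : 'cV[R]_(d * n)) : 'M[R]_(n, d) :=
  \matrix_(a, b) w (mxtens_index (b, a)) 0.

Definition tvec n d (v : 'M[R]_(n, d)) : 'cV[R]_(d * n) :=
  \col_i v (mxtens_unindex i).2 (mxtens_unindex i).1.

Lemma tvecK n d : cancel (@tvec n d) (@tmat n d).
Proof. by move=> v; apply/matrixP => a b; rewrite !mxE mxtens_indexK. Qed.

Lemma tmatK n d : cancel (@tmat n d) (@tvec n d).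
Proof.
move=> w; apply/matrixP => a b; rewrite !mxE ord1.
by case: (mxtens_unindex a) (mxtens_unindexK a) => i j /= <-.
Qed.

Lemma tmat0 n d : tmat (0 : 'cV[R]_(d * n)) = 0.
Proof. by apply/matrixP => a b; rewrite !mxE. Qed.

Lemma tmatD n d (w w' : 'cV[R]_(d * n)) : tmat (w + w') = tmat w + tmat w'.
Proof. by apply/matrixP => a b; rewrite !mxE. Qed.

Lemma tmatN n d (w : 'cV[R]_(d * n)) : tmat (- w) = - tmat w.
Proof. by apply/matrixP => a b; rewrite !mxE. Qed.

Lemma sum_mxtens (V : nmodType) m n (F : 'I_(m * n) -> V) :
  \sum_i F i = \sum_i \sum_j F (mxtens_index (i, j)).
Proof.
rewrite pair_bigA /= (reindex (@mxtens_index m n)) /=; last first.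
  by exists (@mxtens_unindex m n) => i _; rewrite ?mxtens_indexK ?mxtens_unindexK.
by apply: eq_bigr => -[i j].
Qed.

Lemma tmatM n n' d d' (A : 'M[R]_(d', d)) (X : 'M[R]_(n', n)) (w : 'cV[R]_(d * n)) :
  tmat ((A *t X) *m w) = X *m tmat w *m A^T.
Proof.
apply/matrixP => a b; rewrite !mxE sum_mxtens; apply: eq_bigr => c _.
rewrite !mxE mulr_suml; apply: eq_bigr => e _.
by rewrite !mxE !mxtens_indexK /=; ring.
Qed.

Lemma tmat_dot n d (w w' : 'cV[R]_(d * n)) :
  (w^T *m w') 0 0 = \tr ((tmat w)^T *m tmat w').
Proof.
rewrite mxE sum_mxtens /mxtrace; apply: eq_bigr => b _; rewrite mxE.
by apply: eq_bigr => a _; rewrite !mxE.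
Qed.

Lemma tmat_sum n d (I : Type) (r : seq I) (F : I -> 'cV[R]_(d * n)) :
  tmat (\sum_(i <- r) F i) = \sum_(i <- r) tmat (F i).
Proof. by elim/big_rec2: _ => [|i a b _ <-]; rewrite ?tmat0 ?tmatD. Qed.

End TensorVec.

Section PencilForm.
Context {R : realType} {g : nat}.
Local Notation rtup n := ('I_g -> 'M[R]_n).

Lemma tmat_pencil n d (J : 'M[R]_d) (A : rtup d) (X : rtup n) w :
  tmat (pencil J A X *m w) = tmat w *m J^T - \sum_j X j *m tmat w *m (A j)^T.
Proof.
rewrite /pencil /linear_pencil mulmxBl tmatD tmatN tmatM mul1mx; congr (_ - _).
by rewrite mulmx_suml tmat_sum; apply: eq_bigr => j _; rewrite tmatM.
Qed.

Lemma posdef_pencil n m (AA : rtup m) (X : rtup n) :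
  symT AA -> symT X ->
  posdef (pencil 1%:M AA X) <-> lmi_form AA X.
Proof.
move=> sA sX.
have formE w : (w^T *m pencil 1%:M AA X *m w) 0 0 =
    \tr ((tmat w)^T *m (tmat w - Lam X AA (tmat w))).
  rewrite -mulmxA tmat_dot tmat_pencil trmx1 mulmx1; congr (\tr (_ *m (_ - _))).
  by apply: eq_bigr => j _; rewrite sA.
have sP : Defs.symmetric (pencil 1%:M AA X).
  rewrite /Defs.symmetric /pencil /linear_pencil linearB /= trmx_tens !trmx1; congr (_ - _).
  by rewrite linear_sum; apply: eq_bigr => j _; rewrite /= trmx_tens sA sX.
split=> [[_ H] v v0|H]; last first.
  split=> // w w0; rewrite formE; apply: H.
  by apply: contra_neq w0 => t0; rewrite -[w]tmatK t0 -tmat0 tmatK.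
rewrite -[v]tvecK -formE; apply: H.
by apply: contra_neq v0 => t0; rewrite -[v]tvecK t0 tmat0.
Qed.

End PencilForm.

(** * Rational expressions under restriction and direct sum *)

Section Intertwine.
Context {R : realType} {g : nat}.
Local Notation rtup n := ('I_g -> 'M[R]_n).

Lemma word_intertwine n N (V : 'M[R]_(N, n)) (W : rtup N) (X : rtup n) w :
  (forall j, W j *m V = V *m X j) -> word_eval W w *m V = V *m word_eval X w.
Proof.
move=> WV; elim: w => [|j w IH]; first by rewrite /word_eval !big_nil mul1mx mulmx1.
by rewrite /word_eval !big_cons -mulmxA [_ *m V]IH !mulmxA WV.
Qed.

Lemma rexpr_intertwine k1 k2 (s : rexpr R g k1 k2) n N (V : 'M[R]_(N, n))
    (W : rtup N) (X : rtup n) :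
  (forall j, W j *m V = V *m X j) -> evaluable s W -> evaluable s X ->
  rexpr_eval s W *m (1%:M *t V) = (1%:M *t V) *m rexpr_eval s X.
Proof.
move=> WV; elim: s => {k1 k2} /=.
- move=> k1 k2 p _ _; rewrite mulmx_suml mulmx_sumr; apply: eq_bigr => t _.
  by rewrite !tensmx_mul mulmx1 mul1mx (word_intertwine _ WV).
- move=> k1 k2 s1 IH1 s2 IH2 [e1 e2] [e1' e2'].
  by rewrite mulmxDl mulmxDr IH1 // IH2.
- move=> k1 k2 k3 s1 IH1 s2 IH2 [e1 e2] [e1' e2'].
  by rewrite -mulmxA IH2 // !mulmxA IH1.
- move=> k s IH [e u] [e' u'].
  apply: (can_inj (mulKmx u)); rewrite mulKVmx //.
  by rewrite mulmxA IH // mulmxK.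
Qed.

Lemma tens11 k n : (1%:M : 'M[R]_k) *t (1%:M : 'M[R]_n) = 1%:M.
Proof.
apply/matrixP => i j; rewrite !mxE -[i == j](can_eq (@mxtens_unindexK k n)).
case: (mxtens_unindex i) (mxtens_unindex j) => [a b] [c d] /=.
by rewrite xpair_eqE -natrM mulnb.
Qed.

Lemma tensDr m1 n1 m2 n2 (A : 'M[R]_(m1, n1)) (B B' : 'M[R]_(m2, n2)) :
  A *t (B + B') = A *t B + A *t B'.
Proof. by apply/matrixP => i j; rewrite !mxE mulrDr. Qed.

Lemma tr_tens1 k n N (V : 'M[R]_(N, n)) : ((1%:M : 'M[R]_k) *t V)^T = 1%:M *t (V^T).
Proof. by rewrite trmx_tens trmx1. Qed.

Lemma tens_isometry k n N (V : 'M[R]_(N, n)) : V^T *m V = 1%:M ->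
  ((1%:M : 'M[R]_k) *t V^T) *m (1%:M *t V) = 1%:M.
Proof. by move=> VV; rewrite tensmx_mul mul1mx VV tens11. Qed.

Lemma isometry_size n N (V : 'M[R]_(N, n)) : (0 < n)%N -> V^T *m V = 1%:M -> (0 < N)%N.
Proof.
case: N V => // V n0 /matrixP/(_ (Ordinal n0) (Ordinal n0)).
by rewrite !mxE big_ord0 eqxx => /esym/eqP; rewrite oner_eq0.
Qed.

Section Restr.
Variables (n N : nat) (V : 'M[R]_(N, n)) (W : rtup N) (X : rtup n).
Hypotheses (VV : V^T *m V = 1%:M) (WV : forall j, W j *m V = V *m X j).

(** The compression of the inverse at [W] is a one-sided inverse of the square matrix at [X], hence
    an inverse. *)
Lemma evaluable_restr k1 k2 (s : rexpr R g k1 k2) : evaluable s W -> evaluable s X.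
Proof.
elim: s => {k1 k2} //=.
- by move=> k1 k2 s1 IH1 s2 IH2 [/IH1 ? /IH2].
- by move=> k1 k2 k3 s1 IH1 s2 IH2 [/IH1 ? /IH2].
- move=> k s IH [e u]; have e' := IH e; split=> //.
  have h : ((1%:M *t (V^T)) *m invmx (rexpr_eval s W) *m (1%:M *t V)) *m rexpr_eval s X = 1%:M.
    by rewrite -mulmxA -(rexpr_intertwine WV) // -!mulmxA mulKmx // tens_isometry.
  by have [] := mulmx1_unit h.
Qed.

Lemma rexpr_eval_restr k1 k2 (s : rexpr R g k1 k2) : evaluable s W ->
  rexpr_eval s X = (1%:M *t (V^T)) *m rexpr_eval s W *m (1%:M *t V).
Proof.
move=> e; rewrite -mulmxA (rexpr_intertwine WV) ?mulmxA ?tens_isometry ?mul1mx //.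
exact: evaluable_restr.
Qed.

Lemma posdef_restr k (s : rexpr R g k k) : evaluable s W ->
  posdef (rexpr_eval s W) -> posdef (rexpr_eval s X).
Proof.
move=> e [sW pW]; rewrite (rexpr_eval_restr e).
split.
  by rewrite /Defs.symmetric !trmx_mul sW !tr_tens1 trmxK mulmxA.
move=> v v0; have := pW ((1%:M *t V) *m v).
rewrite trmx_mul tr_tens1 !mulmxA; apply.
apply: contra_neq v0 => h; rewrite -[v]mul1mx -(tens_isometry k VV) -mulmxA h.
exact: mulmx0.
Qed.

End Restr.

Section Sum.
Variables (n m : nat) (X : rtup n) (Y : rtup m).
Let W j := block_mx (X j) 0 0 (Y j).
Let V1 : 'M[R]_(n + m, n) := col_mx 1%:M 0.
Let V2 : 'M[R]_(n + m, m) := col_mx 0 1%:M.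

Lemma sum_intertwine1 j : W j *m V1 = V1 *m X j.
Proof.
by rewrite /W /V1 mul_block_col mul_col_mx !mul0mx mulmx1 mulmx0 mul1mx !addr0.
Qed.

Lemma sum_intertwine2 j : W j *m V2 = V2 *m Y j.
Proof.
by rewrite /W /V2 mul_block_col mul_col_mx !mul0mx mulmx1 mulmx0 mul1mx !add0r.
Qed.

Lemma sum_complete k : ((1%:M : 'M[R]_k) *t V1) *m (1%:M *t (V1^T)) +
  (1%:M *t V2) *m (1%:M *t (V2^T)) = 1%:M.
Proof.
rewrite !tensmx_mul !mul1mx -tensDr -tens11; congr (_ *t _).
rewrite /V1 /V2 !tr_col_mx !mul_col_row !trmx1 !trmx0 !mulmx0 !mul0mx !mulmx1 add_block_mx.
by rewrite !addr0 !add0r -scalar_mx_block.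
Qed.

Lemma evaluable_sum k1 k2 (s : rexpr R g k1 k2) :
  evaluable s X -> evaluable s Y -> evaluable s W.
Proof.
elim: s => {k1 k2} //=.
- by move=> k1 k2 s1 IH1 s2 IH2 [/IH1 h1 /IH2 h2] [/h1 ? /h2].
- by move=> k1 k2 k3 s1 IH1 s2 IH2 [/IH1 h1 /IH2 h2] [/h1 ? /h2].
- move=> k s IH [eX uX] [eY uY]; have e := IH eX eY; split=> //.
  have h : rexpr_eval s W *m ((1%:M *t V1) *m invmx (rexpr_eval s X) *m (1%:M *t (V1^T)) +
      (1%:M *t V2) *m invmx (rexpr_eval s Y) *m (1%:M *t (V2^T))) = 1%:M.
    rewrite mulmxDr !mulmxA (rexpr_intertwine sum_intertwine1) // (rexpr_intertwine sum_intertwine2) //.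
    by rewrite !mulmxK // sum_complete.
  by have [] := mulmx1_unit h.
Qed.

Lemma posdef_sum k (s : rexpr R g k k) : evaluable s X -> evaluable s Y ->
  posdef (rexpr_eval s X) -> posdef (rexpr_eval s Y) -> posdef (rexpr_eval s W).
Proof.
move=> eX eY [sX pX] [sY pY]; have eW := evaluable_sum eX eY.
have WE : rexpr_eval s W = (1%:M *t V1) *m rexpr_eval s X *m (1%:M *t (V1^T)) +
    (1%:M *t V2) *m rexpr_eval s Y *m (1%:M *t (V2^T)).
  rewrite -[LHS]mulmx1 -(sum_complete k) mulmxDr !mulmxA.
  by rewrite (rexpr_intertwine sum_intertwine1) // (rexpr_intertwine sum_intertwine2).
split.
  rewrite /Defs.symmetric WE linearD /= !trmx_mul sX sY !tr_tens1 !trmxK.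
  by rewrite !mulmxA.
move=> v v0; set a : 'cV_(k * n) := (1%:M *t (V1^T)) *m v; set b : 'cV_(k * m) := (1%:M *t (V2^T)) *m v.
have qE : (v^T *m rexpr_eval s W *m v) 0 0 =
    (a^T *m rexpr_eval s X *m a) 0 0 + (b^T *m rexpr_eval s Y *m b) 0 0.
  rewrite WE mulmxDr mulmxDl mxE /a /b !trmx_mul !tr_tens1 !trmxK.
  by rewrite !mulmxA.
have ge0 l (M : 'M[R]_l) (x : 'cV_l) : (forall x : 'cV_l, x != 0 -> 0 < (x^T *m M *m x) 0 0) ->
    0 <= (x^T *m M *m x) 0 0.
  by move=> pM; have [->|/pM/ltW //] := eqVneq x 0; rewrite mulmx0 mxE.
rewrite qE; have [a0|a0] := eqVneq a 0; last by apply: ltr_wpDr; [apply: ge0|apply: pX].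
have b0 : b != 0.
  apply: contra_neq v0 => b0; rewrite -[v]mul1mx -(sum_complete k) mulmxDl -!mulmxA.
  by rewrite -/a -/b a0 b0 !mulmx0 addr0.
by apply: ltr_wpDl; [apply: ge0|apply: pY].
Qed.

End Sum.

Lemma word_eval0 n w : word_eval (fun=> 0 : 'M[R]_n) w = if w == [::] :> seq 'I_g then 1%:M else 0.
Proof. by case: w => [|j w]; rewrite /word_eval ?big_nil // big_cons mul0mx. Qed.

Lemma evaluable0 k1 k2 (s : rexpr R g k1 k2) n : analytic_at0 s ->
  evaluable s (fun=> 0 : 'M[R]_n) /\ rexpr_eval s (fun=> 0 : 'M[R]_n) = rexpr_at0 s *t 1%:M.
Proof.
elim: s => {k1 k2} /=.
- move=> k1 k2 p _; split=> //; elim: p => [|t p IH].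
    by rewrite !big_nil; apply/matrixP => i j; rewrite !mxE mul0r.
  rewrite !big_cons IH word_eval0; case: eqP => _.
    by apply/matrixP => i j; rewrite !mxE mulrDl.
  by apply/matrixP => i j; rewrite !mxE mulr0 add0r.
- move=> k1 k2 s1 IH1 s2 IH2 [/IH1[e1 v1] /IH2[e2 v2]]; split=> //.
  by rewrite v1 v2; apply/matrixP => i j; rewrite !mxE mulrDl.
- move=> k1 k2 k3 s1 IH1 s2 IH2 [/IH1[e1 v1] /IH2[e2 v2]]; split=> //.
  by rewrite v1 v2 tensmx_mul mulmx1.
- move=> k s IH [/IH[e v] u].
  have h : (rexpr_at0 s *t 1%:M) *m (invmx (rexpr_at0 s) *t 1%:M) = 1%:M :> 'M[R]_(k * n).
    by rewrite tensmx_mul mulmxV // mulmx1 tens11.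
  have [u1 _] := mulmx1_unit h.
  split; first by rewrite v.
  by rewrite v -[LHS]mulmx1 -h mulKmx.
Qed.

End Intertwine.

(** * Norm and inversion of real matrices *)

Section RealNorm.
Context {R : realType}.

Definition rnorm m n (A : 'M[R]_(m, n)) : R := mnorm (toC A).

Lemma rnormE m n (A : 'M[R]_(m, n)) : rnorm A = \sum_i \sum_j `|A i j|.
Proof.
by rewrite /rnorm /mnorm; apply: eq_bigr => i _; apply: eq_bigr => j _; rewrite mxE normc_real.
Qed.

Lemma rnorm_ge0 m n (A : 'M[R]_(m, n)) : 0 <= rnorm A.
Proof. exact: mnorm_ge0. Qed.

Lemma rnorm0 m n : rnorm (0 : 'M[R]_(m, n)) = 0.
Proof. by rewrite /rnorm /toC map_mx0 mnorm0. Qed.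

Lemma rnormD m n (A B : 'M[R]_(m, n)) : rnorm (A + B) <= rnorm A + rnorm B.
Proof. by rewrite /rnorm /toC map_mxD mnormD. Qed.

Lemma rnormN m n (A : 'M[R]_(m, n)) : rnorm (- A) = rnorm A.
Proof. by rewrite /rnorm /toC map_mxN mnormN. Qed.

Lemma rnormBC m n (A B : 'M[R]_(m, n)) : rnorm (A - B) = rnorm (B - A).
Proof. by rewrite -rnormN opprB. Qed.

Lemma rnormM m n p (A : 'M[R]_(m, n)) (B : 'M[R]_(n, p)) : rnorm (A *m B) <= rnorm A * rnorm B.
Proof. by rewrite /rnorm /toC map_mxM mnormM. Qed.

Lemma rnormZ m n a (A : 'M[R]_(m, n)) : rnorm (a *: A) = `|a| * rnorm A.
Proof. by rewrite /rnorm /toC map_mxZ mnormZ normc_real. Qed.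

Lemma rnorm_eq0 m n (A : 'M[R]_(m, n)) : rnorm A <= 0 -> A = 0.
Proof.
move=> /mnorm_eq0 /matrixP h; apply/matrixP => i j; have := h i j.
by rewrite !mxE => -[].
Qed.

Lemma entry_le_rnorm m n (A : 'M[R]_(m, n)) i j : `|A i j| <= rnorm A.
Proof. by have := entry_le_mnorm (toC A) i j; rewrite mxE normc_real. Qed.

Lemma rnormT m n (A : 'M[R]_(m, n)) : rnorm A^T = rnorm A.
Proof.
rewrite !rnormE exchange_big; apply: eq_bigr => i _; apply: eq_bigr => j _.
by rewrite mxE.
Qed.

Lemma rnorm_tens m1 n1 m2 n2 (A : 'M[R]_(m1, n1)) (B : 'M[R]_(m2, n2)) :
  rnorm (A *t B) = rnorm A * rnorm B.
Proof.
rewrite !rnormE sum_mxtens mulr_suml; apply: eq_bigr => i _.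
rewrite mulr_sumr; apply: eq_bigr => k _; rewrite sum_mxtens mulr_suml; apply: eq_bigr => j _.
by rewrite mulr_sumr; apply: eq_bigr => l _; rewrite tensmxE normrM.
Qed.

Lemma inv_perturb n (M0 : 'M[R]_n) : M0 \in unitmx ->
  exists c d, [/\ 0 < c, 0 < d & forall M, rnorm (M - M0) < d ->
    M \in unitmx /\ rnorm (invmx M - invmx M0) <= c * rnorm (M - M0)].
Proof.
move=> u0; set b0 := invmx M0; set k := rnorm b0 + 1.
have k1 : 0 < k by rewrite ltr_wpDl // rnorm_ge0.
have kb : rnorm b0 <= k by rewrite lerDl.
exists (2 * k * k), (1 / (2 * k)); split; [by rewrite !mulr_gt0|by rewrite divr_gt0 // mulr_gt0|].
move=> M Md; set e := rnorm (M - M0) in Md *.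
have e0 : 0 <= e by apply: rnorm_ge0.
have ek : e * k <= 1 / 2.
  by move: Md; rewrite ltr_pdivlMr ?mulr_gt0 // => h; lra.
have Mb m (x : 'M[R]_(m, n)) : rnorm (x *m (M0 - M) *m b0) <= rnorm x * (e * k).
  apply: le_trans (rnormM _ _) _; rewrite mulrA; apply: ler_pM; rewrite ?rnorm_ge0 //.
  by apply: le_trans (rnormM _ _) _; rewrite /e rnormBC.
have uM : M \in unitmx.
  rewrite -row_free_unit -kermx_eq0; apply/eqP/row_matrixP => i.
  rewrite row0; set x := row i _.
  have xM : x *m M = 0 by apply/sub_kermxP; rewrite row_sub.
  have xE : x = x *m (M0 - M) *m b0 by rewrite mulmxBr xM subr0 mulmxK.
  apply: rnorm_eq0; have := Mb _ x; rewrite -xE; have := rnorm_ge0 x; nra.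
split=> //; set b := invmx M.
have bE : b - b0 = b *m (M0 - M) *m b0.
  by rewrite mulmxBr mulVmx // mulmxBl mul1mx mulmxK.
have bk : rnorm b <= 2 * k.
  have : rnorm b <= rnorm b0 + rnorm b * (e * k).
    rewrite -{1}(subrK b0 b) bE; apply: le_trans (rnormD _ _) _.
    by rewrite addrC lerD2l Mb.
  by have := rnorm_ge0 b; nra.
rewrite bE; apply: le_trans (Mb _ _) _.
have -> : 2 * k * k * e = 2 * k * (e * k) by ring.
by apply: ler_wpM2r => //; rewrite mulr_ge0 // ltW.
Qed.

End RealNorm.

(** * Continuity of rational expressions *)

Section Continuity.
Context {R : realType} {g : nat}.
Local Notation rtup n := ('I_g -> 'M[R]_n).

Definition tdist n (X Y : rtup n) : R := \sum_j rnorm (X j - Y j).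

Lemma rnorm_le_tdist n (X Y : rtup n) j : rnorm (X j - Y j) <= tdist X Y.
Proof. by rewrite /tdist (bigD1 j) //= lerDl sumr_ge0 // => i _; apply: rnorm_ge0. Qed.

Definition ctn n a b (F : rtup n -> 'M[R]_(a, b)) X : Prop :=
  forall e, 0 < e -> exists2 d, 0 < d & forall Y, tdist Y X < d -> rnorm (F Y - F X) < e.

Lemma ctn_cst n a b (A : 'M[R]_(a, b)) (X : rtup n) : ctn (fun=> A) X.
Proof. by move=> e e0; exists 1 => // Y _; rewrite subrr rnorm0. Qed.

Lemma ctn_ext n a b (F G : rtup n -> 'M[R]_(a, b)) X :
  (forall Y, F Y = G Y) -> ctn F X -> ctn G X.
Proof. by move=> /funext ->. Qed.

Lemma ctn_var n (X : rtup n) j : ctn (fun Y => Y j) X.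
Proof. by move=> e e0; exists e => // Y h; apply: le_lt_trans (rnorm_le_tdist _ _ _) h. Qed.

Lemma ctnD n a b (F G : rtup n -> 'M[R]_(a, b)) X :
  ctn F X -> ctn G X -> ctn (fun Y => F Y + G Y) X.
Proof.
move=> hF hG e e0; have e2 : 0 < e / 2 by rewrite divr_gt0.
have [d1 d10 h1] := hF _ e2; have [d2 d20 h2] := hG _ e2.
exists (Num.min d1 d2); first by rewrite lt_min d10.
move=> Y; rewrite lt_min => /andP[/h1 {}h1 /h2 {}h2].
rewrite opprD addrACA; apply: le_lt_trans (rnormD _ _) _; lra.
Qed.

Lemma ctnM n a b c (F : rtup n -> 'M[R]_(a, b)) (G : _ -> 'M[R]_(b, c)) X :
  ctn F X -> ctn G X -> ctn (fun Y => F Y *m G Y) X.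
Proof.
move=> hF hG e e0.
set f := rnorm (F X) + 1; set k := rnorm (G X) + 1.
have f0 : 0 < f by rewrite ltr_wpDl // rnorm_ge0.
have k0 : 0 < k by rewrite ltr_wpDl // rnorm_ge0.
pose e1 := Num.min 1 (e / (4 * (f + k))).
have e10 : 0 < e1 by rewrite lt_min ltr01 divr_gt0 // mulr_gt0 // addr_gt0.
have [d1 d10 h1] := hF _ e10; have [d2 d20 h2] := hG _ e10.
exists (Num.min d1 d2); first by rewrite lt_min d10.
move=> Y; rewrite lt_min => /andP[/h1 {}h1 /h2 {}h2].
have -> : F Y *m G Y - F X *m G X = (F Y - F X) *m (G Y - G X) +
    (F X *m (G Y - G X) + (F Y - F X) *m G X).
  by rewrite !mulmxBl !mulmxBr; apply/matrixP => i j; rewrite !mxE; ring.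
apply: le_lt_trans (rnormD _ _) _.
apply: le_lt_trans (lerD (rnormM _ _) (rnormD _ _)) _.
apply: le_lt_trans (lerD (lexx _) (lerD (rnormM _ _) (rnormM _ _))) _.
have ee : e1 * (f + k) <= e / 4.
  have h : e1 <= e / (4 * (f + k)) by rewrite /e1 ge_min lexx orbT.
  have fk : 0 < f + k by rewrite addr_gt0.
  have h' := ler_wpM2r (ltW fk) h; apply: le_trans h' _.
  by rewrite invfM mulrA divfK ?gt_eqF.
have e11 : e1 <= 1 by rewrite /e1 ge_min lexx.
move: h1 h2; set p := rnorm (F Y - F X); set q := rnorm (G Y - G X) => h1 h2.
have p0 : 0 <= p by apply: rnorm_ge0.
have q0 : 0 <= q by apply: rnorm_ge0.
have pq : p * q <= e1 * f.
  apply: le_trans (_ : e1 * 1 <= _); first by apply: ler_pM => //; [exact: ltW|lra].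
  by apply: ler_wpM2l; [exact: ltW|rewrite /f lerDr rnorm_ge0].
have fq : rnorm (F X) * q <= e1 * f.
  by rewrite mulrC; apply: ler_pM => //; [exact: rnorm_ge0|exact: ltW|rewrite /f lerDl].
have pk : p * rnorm (G X) <= e1 * k.
  by apply: ler_pM => //; [exact: rnorm_ge0|exact: ltW|rewrite /k lerDl].
have ef : 0 <= e1 * f by rewrite mulr_ge0 // ltW.
have ek : 0 <= e1 * k by rewrite mulr_ge0 // ltW.
clear -ee pq fq pk ef ek e0; lra.
Qed.

Lemma ctn_tens n a b c d (A : 'M[R]_(a, b)) (F : rtup n -> 'M[R]_(c, d)) X :
  ctn F X -> ctn (fun Y => A *t F Y) X.
Proof.
move=> hF e e0; set k := rnorm A + 1.
have k0 : 0 < k by rewrite ltr_wpDl // rnorm_ge0.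
have [|d1 d10 h1] := hF (e / k); first by rewrite divr_gt0.
exists d1 => // Y /h1 {}h1.
have -> : A *t F Y - A *t F X = A *t (F Y - F X).
  by apply/matrixP => i j; rewrite !mxE; ring.
rewrite rnorm_tens; move: h1; rewrite ltr_pdivlMr // mulrC; apply: le_lt_trans.
by apply: ler_wpM2r; [exact: rnorm_ge0|rewrite /k lerDl].
Qed.

Lemma ctn_word n w (X : rtup n) : ctn (fun Y => word_eval Y w) X.
Proof.
elim: w => [|j w IH].
  by apply: (ctn_ext _ (@ctn_cst n _ _ 1%:M X)) => Y; rewrite /word_eval big_nil.
by apply: (ctn_ext _ (ctnM (@ctn_var n X j) IH)) => Y; rewrite /word_eval big_cons.
Qed.

Lemma rexpr_ctn k1 k2 (s : rexpr R g k1 k2) n (X : rtup n) : evaluable s X ->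
  ctn (fun Y => rexpr_eval s Y) X /\
  exists2 d, 0 < d & forall Y, tdist Y X < d -> evaluable s Y.
Proof.
elim: s => {k1 k2} /=.
- move=> k1 k2 p _; split; last by exists 1.
  elim: p => [|t p IH].
    by apply: (ctn_ext _ (@ctn_cst n _ _ 0 X)) => Y; rewrite big_nil.
  by apply: (ctn_ext _ (ctnD (ctn_tens t.2 (@ctn_word n t.1 X)) IH)) => Y; rewrite big_cons.
- move=> k1 k2 s1 IH1 s2 IH2 [/IH1[c1 [d1 d10 h1]] /IH2[c2 [d2 d20 h2]]].
  split; first exact: ctnD.
  exists (Num.min d1 d2); first by rewrite lt_min d10.
  by move=> Y; rewrite lt_min => /andP[/h1 ? /h2].
- move=> k1 k2 k3 s1 IH1 s2 IH2 [/IH1[c1 [d1 d10 h1]] /IH2[c2 [d2 d20 h2]]].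
  split; first exact: ctnM.
  exists (Num.min d1 d2); first by rewrite lt_min d10.
  by move=> Y; rewrite lt_min => /andP[/h1 ? /h2].
- move=> k s IH [/IH[c1 [d1 d10 h1]] u].
  have [c [d [c0 d0 H]]] := inv_perturb u; split.
    move=> e e0; have [|d2 d20 h2] := c1 (Num.min d (e / c)).
      by rewrite lt_min d0 divr_gt0.
    exists d2 => // Y /h2; rewrite lt_min => /andP[/H[_ h3] h4].
    apply: le_lt_trans h3 _; by rewrite mulrC -ltr_pdivlMr.
  have [d2 d20 h2] := c1 _ d0.
  exists (Num.min d1 d2); first by rewrite lt_min d10.
  by move=> Y; rewrite lt_min => /andP[/h1 ? /h2 /H[]].
Qed.

End Continuity.

(** * Stability of positive definiteness *)

Section Posdef.
Context {R : realType}.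
Local Notation Re := (@complex.Re R).

Lemma quad_bound n (E : 'M[R]_n) (v : 'cV[R]_n) :
  `|(v^T *m E *m v) 0 0| <= rnorm E * rnorm v ^+ 2.
Proof.
apply: le_trans (entry_le_rnorm _ _ _) _; apply: le_trans (rnormM _ _) _.
rewrite expr2 mulrA; apply: ler_wpM2r; first exact: rnorm_ge0.
by apply: le_trans (rnormM _ _) _; rewrite rnormT mulrC.
Qed.

Lemma quadB n (M M' : 'M[R]_n) (v : 'cV[R]_n) :
  (v^T *m M' *m v) 0 0 = (v^T *m M *m v) 0 0 + (v^T *m (M' - M) *m v) 0 0.
Proof. by rewrite -{1}(subrK M M') addrC mulmxDr mulmxDl mxE. Qed.

Lemma trace_toC n (M : 'M[R]_n) (x : 'rV[R[i]]_n) : Re (\tr (x *m toC M *m adj x)) =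
  (Remx x *m M *m (Remx x)^T) 0 0 + (Immx x *m M *m (Immx x)^T) 0 0.
Proof.
have -> : Re (\tr (x *m toC M *m adj x)) = (Remx (x *m toC M *m adj x)) 0 0.
  by rewrite /mxtrace big_ord1 [RHS]mxE.
rewrite RemxM RemxM ImmxM Remx_toC Immx_toC !mulmx0 subr0 add0r Remx_adj Immx_adj.
by rewrite mulmxN opprK [LHS]mxE.
Qed.

Lemma normc_entry_le n (y : 'rV[R[i]]_n) j :
  Normc.normc (y 0 j) <= Num.sqrt (Re (\tr (y *m adj y))).
Proof.
have -> : Normc.normc (y 0 j) = Num.sqrt (Re (y 0 j * conjc (y 0 j))).
  by case: (y 0 j) => a b /=; congr Num.sqrt; ring.
have E i : y 0 i * adj y i 0 = y 0 i * conjc (y 0 i) by rewrite !mxE.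
apply: ler_wsqrtr; rewrite /mxtrace big_ord1 mxE (eq_bigr _ (fun i _ => E i)).
rewrite (bigD1 j) //= raddfD /= lerDl raddf_sum; apply: sumr_ge0 => l _ /=.
by case: (y 0 l) => a b /=; nra.
Qed.

(** Coercivity is read off a Cholesky factor [T] of the complexified matrix, in place of compactness
    of the sphere: the form at [v] is the squared length of [v^T T]. *)
Lemma posdef_bound n (M : 'M[R]_n) : posdef M ->
  exists2 K, 0 < K & forall v : 'cV[R]_n, rnorm v ^+ 2 <= K * (v^T *m M *m v) 0 0.
Proof.
move=> [sM pM].
have ge0 (a : 'rV[R]_n) : 0 <= (a *m M *m a^T) 0 0.
  have [->|a0] := eqVneq a 0; first by rewrite !mul0mx mxE.
  by apply: ltW; rewrite -{1}[a]trmxK; apply: pM; rewrite trmx_eq0.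
have gt0 (a : 'rV[R]_n) : a != 0 -> 0 < (a *m M *m a^T) 0 0.
  by move=> a0; rewrite -{1}[a]trmxK; apply: pM; rewrite trmx_eq0.
have [|T uT ME] := @cholesky R n (toC M).
  split; first by rewrite adj_toC sM.
  move=> x x0; rewrite trace_toC; have [r0|r0] := eqVneq (Remx x) 0.
    apply: ltr_wpDl => //; apply: gt0; apply: contra_neq x0 => i0.
    by apply: ReImmx; rewrite ?r0 ?i0 /Remx /Immx map_mx0.
  by apply: ltr_wpDr => //; apply: gt0.
pose K := n%:R * mnorm (invmx T) + 1.
have K0 : 0 < K by rewrite ltr_wpDl // mulr_ge0 ?mnorm_ge0.
exists (K ^+ 2); first by rewrite exprn_gt0.
move=> v; set q := (v^T *m M *m v) 0 0.
pose x := toC v^T; pose y := x *m T.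
have qE : q = Re (\tr (y *m adj y)).
  rewrite /y adjM !mulmxA -(mulmxA x) -ME trace_toC Remx_toC Immx_toC trmxK !mul0mx.
  by rewrite [X in _ + X]mxE addr0.
have q0 : 0 <= q by rewrite /q -{2}[v]trmxK.
have yj j : Normc.normc (y 0 j) <= Num.sqrt q by rewrite qE normc_entry_le.
have ny : mnorm y <= n%:R * Num.sqrt q.
  rewrite /mnorm big_ord1; apply: le_trans (ler_sum _ (fun j _ => yj j)) _.
  by rewrite sumr_const card_ord mulr_natl.
have nv : rnorm v <= K * Num.sqrt q.
  rewrite -rnormT /rnorm -/x -(mulmxK uT x) -/y; apply: le_trans (mnormM _ _) _.
  apply: le_trans (ler_wpM2r (mnorm_ge0 _) ny) _.
  by rewrite mulrAC; apply: ler_wpM2r; [exact: sqrtr_ge0|rewrite /K lerDl].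
rewrite -(sqr_sqrtr q0) -exprMn; apply: lerXn2r; rewrite ?nnegrE ?rnorm_ge0 //.
by rewrite mulr_ge0 ?sqrtr_ge0 // ltW.
Qed.

Lemma posdef_open n (M : 'M[R]_n) : posdef M ->
  exists2 e, 0 < e & forall M' : 'M[R]_n, M'^T = M' -> rnorm (M' - M) < e -> posdef M'.
Proof.
move=> pM; have [K K0 HK] := posdef_bound pM; have [sM pos] := pM.
exists K^-1; first by rewrite invr_gt0.
move=> M' sM' h; split=> // v v0.
have -> : (v^T *m M' *m v) 0 0 = (v^T *m M *m v) 0 0 + (v^T *m (M' - M) *m v) 0 0.
  exact: quadB.
have q0 := pos v v0; have := HK v; have := quad_bound (M' - M) v.
set q := (v^T *m M *m v) 0 0 in q0 *; set p := (v^T *m (M' - M) *m v) 0 0.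
set e := rnorm _ in h *; set s := rnorm v ^+ 2 => h1 h2.
have s0 : 0 <= s by rewrite exprn_ge0 // rnorm_ge0.
have e0 : 0 <= e by apply: rnorm_ge0.
have eK : e * K < 1 by rewrite -ltr_pdivlMr // div1r.
have : e * s <= e * (K * q) by apply: ler_wpM2l.
rewrite (mulrA e K q) => h3; have : e * K * q < 1 * q by rewrite ltr_pM2r.
move: h1; rewrite ler_norml => /andP[h1 _] h4; clear -h1 h3 h4; lra.
Qed.

(** The limit form is semidefinite, and invertibility leaves no isotropic vector. *)
Lemma posdef_limit n (M : 'M[R]_n) : M^T = M -> M \in unitmx ->
  (forall e, 0 < e -> exists2 M', posdef M' & rnorm (M' - M) < e) -> posdef M.
Proof.
move=> sM uM lim.
have psd (v : 'cV[R]_n) : 0 <= (v^T *m M *m v) 0 0.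
  rewrite leNgt; apply/negP => neg; set q := (v^T *m M *m v) 0 0 in neg.
  set s := rnorm v ^+ 2 + 1.
  have s0 : 0 < s by rewrite ltr_wpDl // exprn_ge0 // rnorm_ge0.
  have [|M' [_ pM'] h] := lim (- q / s); first by rewrite divr_gt0 // oppr_gt0.
  have v0 : v != 0.
    by apply/eqP => v0; move: neg; rewrite /q v0 mulmx0 mxE ltxx.
  have := pM' v v0.
  have -> : (v^T *m M' *m v) 0 0 = q + (v^T *m (M' - M) *m v) 0 0.
    exact: quadB.
  have := quad_bound (M' - M) v; rewrite ler_norml => /andP[_ h1].
  have h2 : rnorm (M' - M) * rnorm v ^+ 2 <= rnorm (M' - M) * s.
    by apply: ler_wpM2l; [exact: rnorm_ge0|rewrite /s lerDl].
  move: h; rewrite ltr_pdivlMr // => h; clear -h h1 h2; lra.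
have rowq (a : 'rV[R]_n) : 0 <= (a *m M *m a^T) 0 0 by rewrite -{1}[a]trmxK psd.
split=> // v v0; have := @trace_pd_kernel R n (toC M) _ _ _ (toC v^T) _.
rewrite trace_toC Remx_toC Immx_toC trmxK !mul0mx [X in _ + X]mxE addr0; apply.
- by rewrite adj_toC sM.
- by move=> x; rewrite trace_toC addr_ge0.
- have uC : toC M \in unitmx by rewrite map_unitmx.
  by move=> x xM; rewrite -(mulmxK uC x) xM mul0mx.
- apply: contra_neq v0 => /(congr1 (@Remx _ _ _)); rewrite Remx_toC => h.
  by rewrite -[v]trmxK h; apply/matrixP => i j; rewrite !mxE.
Qed.

End Posdef.

(** * Finiteness of singular points on a ray *)

Lemma roots_finite (F : fieldType) (p : {poly F}) : p != 0 ->
  exists s : seq F, forall x, root p x -> x \in s.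
Proof.
have [n le_pn] : exists n, (size p <= n)%N by exists (size p).
elim: n p le_pn => [|n IH] p le_pn p0.
  by move: p0; rewrite -size_poly_eq0 -leqn0 le_pn.
have [[x /factor_theorem[q pE]]|nx] := pselect (exists x, root p x); last first.
  by exists [::] => x px; case: nx; exists x.
have q0 : q != 0 by apply: contra_neq p0 => q0; rewrite pE q0 mul0r.
have [|s H] := IH q _ q0.
  by rewrite -ltnS; move: le_pn; rewrite pE size_Mmonic ?monicXsubC // size_XsubC addn2.
exists (x :: s) => y; rewrite pE rootM root_XsubC inE orbC.
by case/orP => [->|/H ->] //; rewrite orbT.
Qed.

Section Finite.
Context {R : realType} {g : nat}.
Local Notation rtup n := ('I_g -> 'M[R]_n).

Lemma avoid (s : seq R) a b : a < b -> exists x, [/\ a < x, x < b & x \notin s].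
Proof.
move=> ab; suff [a' [b' [aa bb ab' H]]] : exists a' b',
    [/\ a <= a', b' <= b, a' < b' & forall x, a' < x -> x < b' -> x \notin s].
  have [h1 h2] := (midf_lt ab'); exists ((a' + b') / 2).
  by rewrite H // (le_lt_trans aa h1) (lt_le_trans h2 bb).
elim: s => [|x s [a' [b' [aa bb ab' H]]]]; first by exists a, b.
have [/andP[x1 x2]|nx] := boolP (a' < x < b').
  exists a', x; split=> //; first exact: le_trans (ltW x2) bb.
  by move=> y y1 y2; rewrite inE negb_or lt_eqF // H // (lt_trans y2).
exists a', b'; split=> // y y1 y2; rewrite inE negb_or H // andbT.
by apply: contraNneq nx => <-; rewrite y1.
Qed.

(** Singularity at [t X] makes [1 / t] an eigenvalue of [LamM X S], and never occurs for [t = 0]. *)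
Lemma sing_finite N k (S : rtup k) (X : rtup N) :
  exists s : seq R, forall t, sing S (fun j => t *: X j) -> t \in s.
Proof.
have [|s H] := roots_finite (p := char_poly (LamM X S)).
  by rewrite monic_neq0 // char_poly_monic.
exists [seq x^-1 | x <- s] => t [v v0].
have -> : Lam (fun j => t *: X j) S v = t *: Lam X S v.
  rewrite /Lam scaler_sumr; apply: eq_bigr => j _.
  by rewrite -!scalemxAl.
move=> vE; have t0 : t != 0.
  by apply: contra_neq v0 => t0; rewrite -vE t0 scale0r.
apply/mapP; exists t^-1; last by rewrite invrK.
apply: H; rewrite -eigenvalue_root_char; apply/eigenvalueP; exists (mxvec v).
  by rewrite mul_LamM -[in RHS]vE linearZ /= scalerA mulVf // scale1r.
by apply: contra_neq v0 => /(congr1 vec_mx); rewrite mxvecK linear0.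
Qed.

Lemma sing_sum n m k (S : rtup k) (X : rtup n) (Y : rtup m) :
  sing S (fun j => block_mx (X j) 0 0 (Y j)) -> sing S X \/ sing S Y.
Proof.
move=> [v v0 vE].
have e : Lam (fun j => block_mx (X j) 0 0 (Y j)) S v =
    col_mx (Lam X S (usubmx v)) (Lam Y S (dsubmx v)).
  rewrite /Lam -{1}[v]vsubmxK.
  under eq_bigr => j _ do rewrite mul_block_col mul_col_mx !mul0mx addr0 add0r.
  elim/big_ind3: _ => [|a b c a' b' c' -> ->|j _]; rewrite ?col_mx0 //.
  by rewrite add_col_mx.
rewrite vE -{1}[v]vsubmxK in e; have [e1 e2] := eq_col_mx e.
have [u0|u0] := eqVneq (usubmx v) 0; last by left; exists (usubmx v).
right; exists (dsubmx v) => //; apply: contra_neq v0 => d0.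
by rewrite -[v]vsubmxK u0 d0 col_mx0.
Qed.

End Finite.

(** * Kernels, and tensor multiples of positive definite matrices *)

Section Singular.
Context {R : realType}.

Lemma not_unit_kernel n (M : 'M[R]_n) : M \notin unitmx ->
  exists2 w : 'cV[R]_n, w != 0 & M *m w = 0.
Proof.
rewrite -unitmx_tr -row_free_unit -kermx_eq0 => /rowV0Pn[w /sub_kermxP wM w0].
exists w^T; first by rewrite trmx_eq0.
by rewrite -[M]trmxK -trmx_mul wM trmx0.
Qed.

Lemma posdef_unit n (M : 'M[R]_n) : posdef M -> M \in unitmx.
Proof.
move=> [_ pM]; apply/negPn/negP => /not_unit_kernel[w w0 Mw].
by have := pM w w0; rewrite -mulmxA Mw mulmx0 mxE ltxx.
Qed.

Lemma posdef_tens1 n k (M : 'M[R]_k) : posdef M -> posdef (M *t (1%:M : 'M[R]_n)).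
Proof.
move=> [sM pM]; split; first by rewrite /Defs.symmetric trmx_tens sM trmx1.
move=> w w0; rewrite -mulmxA tmat_dot tmatM mul1mx sM.
set v := tmat w; have v0 : v != 0.
  by apply: contra_neq w0 => t0; rewrite -[w]tmatK -/v t0 -(tmat0 n k) tmatK.
rewrite mxtrace_mulC /mxtrace.
have E i : (v *m M *m v^T) i i = ((row i v)^T^T *m M *m (row i v)^T) 0 0.
  by rewrite trmxK -row_mul; rewrite !mxE; apply: eq_bigr => j _; rewrite !mxE.
have [i vi] : exists i, row i v != 0.
  apply/existsP; apply: contraR v0; rewrite negb_exists => /forallP H.
  by apply/eqP/row_matrixP => i; rewrite row0; apply/eqP/negPn.
rewrite (bigD1 i) //= E ltr_wpDr //; last by apply: pM; rewrite trmx_eq0.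
apply: sumr_ge0 => j _; rewrite E.
have [->|r0] := eqVneq (row j v) 0; first by rewrite trmx0 mulmx0 mxE.
by apply/ltW/pM; rewrite trmx_eq0.
Qed.

End Singular.

Lemma sum_row_mx0 (V : realType) m p q (I : Type) (s : seq I) (F : I -> 'M[V]_(m, p)) :
  \sum_(i <- s) row_mx (F i) (0 : 'M[V]_(m, q)) = row_mx (\sum_(i <- s) F i) 0.
Proof.
elim: s => [|i s IH]; first by rewrite !big_nil row_mx0.
by rewrite !big_cons IH add_row_mx addr0.
Qed.

(** * The two tuples attached to the realization *)

Section Realization.
Context {R : realType} {g d l : nat}.
Local Notation rtup n := ('I_g -> 'M[R]_n).
Variable r : realization R g d l.
Hypothesis r0_pos : posdef (rD r + (rC r)^T *m rJ r *m rC r).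
Local Notation J := (rJ r).
Local Notation A := (rA r).
Local Notation C := (rC r).
Local Notation D := (rD r).

Definition pencil_tuple (j : 'I_g) : 'M[R]_d := A j *m J.

(* If [r(X)] kills [z] and [y = (J - L_A(X))^-1 C z], both written as matrices, then
   [[y z] N = \sum_j X_j [y z] (A_j (+) 0)] where [N] is the matrix below. *)
Definition system_mx : 'M[R]_(d + l) := block_mx J C (- C^T) D^T.

Definition system_tuple (j : 'I_g) : 'M[R]_(d + l) :=
  block_mx (A j) 0 0 0 *m invmx system_mx.

(** Symmetry of [D] is forced by that of [r(0)], since [C^T J C] is symmetric. *)
Lemma rD_sym : D^T = D.
Proof.
have [+ _] := r0_pos; rewrite /Defs.symmetric linearD /= !trmx_mul trmxK rJ_sym mulmxA.
exact: addIr.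
Qed.

Lemma pencil_sing n (X : rtup n) :
  pencil J A X \notin unitmx -> sing pencil_tuple X.
Proof.
move=> /not_unit_kernel[w w0 Pw].
have := tmat_pencil J A X w; rewrite Pw tmat0 rJ_sym => /esym/subr0_eq wE.
exists (tmat w).
  by apply: contra_neq w0 => t0; rewrite -[w]tmatK t0 -(tmat0 n d) tmatK.
rewrite -[RHS]mulmx1 -(rJ_sq r) mulmxA wE mulmx_suml; apply: eq_bigr => j _.
by rewrite rA_sym mulmxA.
Qed.

(** The Schur complement of [J] in [system_mx] is [D + C^T J C = r(0)], which is positive
    definite. *)
Lemma system_unit : system_mx \in unitmx.
Proof.
rewrite -row_free_unit -kermx_eq0; apply: contraT => /rowV0Pn[w /sub_kermxP wN w0].
move: wN; rewrite -[w]hsubmxK /system_mx mul_row_block -row_mx0 => /eq_row_mx[e1 e2].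
set y := lsubmx w in e1 e2; set z := rsubmx w in e1 e2.
have yE : y = z *m C^T *m J.
  rewrite -[LHS]mulmx1 -(rJ_sq r) mulmxA; congr (_ *m _).
  by apply/eqP; rewrite -subr_eq0 -mulmxN e1.
have z0 : z = 0.
  have U := posdef_unit r0_pos; rewrite -(mulmxK U z).
  have -> : z *m (D + C^T *m J *m C) = 0.
    by rewrite mulmxDr !mulmxA -yE -{1}rD_sym addrC.
  by rewrite mul0mx.
by case/eqP: w0; rewrite -[w]hsubmxK -/y -/z yE z0 !mul0mx row_mx0.
Qed.

Lemma reval_sing n (X : rtup n) : pencil J A X \in unitmx ->
  reval r n X \notin unitmx -> sing system_tuple X.
Proof.
move=> U /not_unit_kernel[w w0]; rewrite /reval mulmxDl -!mulmxA.
set y := invmx _ *m _ => e2.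
have e1 : pencil J A X *m y = (C *t 1%:M) *m w by rewrite /y mulKVmx.
have := congr1 (@tmat _ _ _) e1; rewrite tmat_pencil tmatM mul1mx rJ_sym => f1.
have := congr1 (@tmat _ _ _) e2; rewrite tmat0 tmatD !tmatM !mul1mx trmxK => f2.
set v := row_mx (tmat y) (tmat w); exists v.
  apply: contra_neq w0; rewrite /v -row_mx0 => /eq_row_mx[_ t0].
  by rewrite -[w]tmatK t0 -(tmat0 n l) tmatK.
have vN : v *m system_mx = \sum_j X j *m v *m block_mx (A j) 0 0 0.
  have -> : \sum_j X j *m v *m block_mx (A j) 0 0 0 =
      row_mx (\sum_j (X j *m tmat y *m (A j)^T)) (0 : 'M[R]_(n, l)).
    rewrite -sum_row_mx0; apply: eq_bigr => j _.
    by rewrite /v mul_mx_row mul_row_block !mulmx0 !addr0 rA_sym.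
  rewrite /v /system_mx mul_row_block; congr row_mx; last by rewrite addrC.
  by rewrite mulmxN -f1 opprB addrC subrK.
rewrite -[RHS](mulmxK system_unit) vN mulmx_suml; apply: eq_bigr => j _.
by rewrite mulmxA.
Qed.

Lemma pencil_sym n (X : rtup n) : symT X ->
  (pencil J A X)^T = pencil J A X.
Proof.
move=> sX; rewrite /pencil /linear_pencil linearB /= trmx_tens trmx1 rJ_sym; congr (_ - _).
by rewrite linear_sum; apply: eq_bigr => j _; rewrite /= trmx_tens rA_sym sX.
Qed.

Lemma reval_sym n (X : rtup n) : symT X ->
  (reval r n X)^T = reval r n X.
Proof.
move=> sX; rewrite /reval linearD /= trmx_tens trmx1 rD_sym; congr (_ + _).
by rewrite !trmx_mul !trmx_tens trmx_inv pencil_sym // trmxK trmx1 mulmxA.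
Qed.

Lemma reval0_posdef n : posdef (reval r n (fun=> 0)).
Proof.
rewrite -rexpr_eval_realization.
have [_ ->] := evaluable0 n (analytic_at0_realization r).
rewrite /= !big_cons !big_nil /= big_map /= big_pred0_eq !addr0.
have -> : invmx J = J by rewrite -[LHS]mulmx1 -(rJ_sq r) mulKmx // (mulmx1_unit (rJ_sq r)).1.
exact: posdef_tens1.
Qed.

End Realization.

(** * A convex planar set whose exit points lie on finitely many lines *)

Section SquareFill.
Context {R : realType}.
Variables (T : R -> R -> Prop) (th : R) (FX FY : seq R).
Hypothesis th1 : 1 < th.
Hypothesis cvxT : forall a b a' b' s, 0 <= s -> s <= 1 -> T a b -> T a' b' ->
  T (s * a + (1 - s) * a') (s * b + (1 - s) * b').
Hypothesis axis1 : forall a, 0 <= a -> a <= th -> T a 0.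
Hypothesis axis2 : forall b, 0 <= b -> b <= th -> T 0 b.
Hypothesis openT : forall a b, T a b -> exists2 s, 1 < s & T (s * a) (s * b).
Hypothesis bdryT : forall a b, 0 <= a -> 0 <= b ->
  (forall s, 0 <= s -> s < 1 -> T (s * a) (s * b)) -> ~ T a b -> (a \in FX) || (b \in FY).

Let th0 : 0 < th. Proof. exact: lt_trans ltr01 th1. Qed.

Let ratio (x y : R) : 0 <= x -> x <= y -> exists s, [/\ 0 <= s, s <= 1 & x = s * y].
Proof.
move=> x0 xy; have y0 := le_trans x0 xy; have [y00|yn0] := eqVneq y 0.
  by exists 1; split=> //; apply/eqP; rewrite mul1r eq_le xy y00 x0.
have yp : 0 < y by rewrite lt_def yn0.
exists (x / y); split; rewrite ?divr_ge0 ?divfK //.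
by rewrite ler_pdivrMr // mul1r.
Qed.

Let down a b b' : 0 <= a -> a <= th -> T a b -> 0 <= b' -> b' <= b -> T a b'.
Proof.
move=> a0 ah Tab b0 bb; have [s [s0 s1 ->]] := ratio b0 bb.
have := cvxT s0 s1 Tab (axis1 a0 ah); congr T; ring.
Qed.

Let left a a' b : 0 <= b -> b <= th -> T a b -> 0 <= a' -> a' <= a -> T a' b.
Proof.
move=> b0 bh Tab a0 aa; have [s [s0 s1 ->]] := ratio a0 aa.
have := cvxT s0 s1 Tab (axis2 b0 bh); congr T; ring.
Qed.

Let T00 : T 0 0. Proof. by apply: axis1 => //; apply: ltW. Qed.

Let bd a b := [/\ 0 < b, b < th, forall b', 0 <= b' -> b' < b -> T a b' & ~ T a b].

(** The bound is the height at [a] of the line through [(th, 0)] and [(1, 1)]: a point of [T] above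
    it would put [(1, 1)] under a chord ending at [(th, 0)]. *)
Let below a b : ~ T 1 1 -> a < 1 -> 0 <= b -> T a b -> b <= 1 + (1 - a) / (th - 1).
Proof.
have t1 := th1; move=> n11 a1 b0 Tab; rewrite leNgt; apply/negP => h; apply: n11.
have d0 : 0 < th - a by lra.
have e0 : 0 < th - 1 by lra.
pose s := (th - 1) / (th - a).
have sE : s * (th - a) = th - 1 by rewrite divfK // gt_eqF.
have s0 : 0 < s by rewrite divr_gt0.
have s1 : s <= 1 by rewrite ler_pdivrMr // mul1r; lra.
have hb : th - 1 + (1 - a) < b * (th - 1).
  move: h; rewrite -(ltr_pM2r e0) mulrDl divfK ?mul1r //; exact: lt0r_neq0.
have T1 : T (s * a + (1 - s) * th) (s * b + (1 - s) * 0).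
  by apply: cvxT => //; [exact: ltW|apply: axis1 => //; exact: ltW].
have e1 : s * a + (1 - s) * th = 1.
  by have -> : s * a + (1 - s) * th = th - s * (th - a) by [ring|]; rewrite sE; ring.
rewrite e1 mulr0 addr0 in T1.
apply: (down (b := s * b)) => //; [exact: ltW|].
rewrite -(ler_pM2r d0) mul1r mulrAC sE; apply: ltW; rewrite mulrC; lra.
Qed.

(** The upper boundary is strictly decreasing: a chord from [(0, th)] to a point slightly below
    [(a', b)] passes at or above [(a, b)]. *)
Let bd_inj a a' b : 0 < a -> a < a' -> a' < 1 -> bd a b -> bd a' b -> False.
Proof.
have t1 := th1; move=> a0 aa a1 [b0 bh _ nT] [_ _ H _]; apply: nT.
have a'0 : 0 < a' by lra.
pose s := a / a'; have s0 : 0 < s by rewrite divr_gt0.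
have s1 : s < 1 by rewrite ltr_pdivrMr // mul1r.
have aE : a = s * a' by rewrite divfK // gt_eqF.
have s2 : 0 < 1 - s by rewrite subr_gt0.
(* [(a', b1)] is on the line from [(0, th)] through [(a, b)]; as [b < th], it lies below
   [(a', b)]. *)
pose b1 := (b - (1 - s) * th) / s; pose b2 := Num.max 0 b1.
have b1E : s * b1 = b - (1 - s) * th by rewrite mulrC divfK // gt_eqF.
have b1b : b1 < b.
  by rewrite -(ltr_pM2l s0) b1E ltrBlDr -ltrBlDl -{1}[b]mul1r -mulrBl ltr_pM2l.
have b20 : 0 <= b2 by rewrite le_max lexx.
have b2b : b2 < b by rewrite gt_max b0 b1b.
have b21 : s * b1 <= s * b2 by rewrite ler_pM2l // le_max lexx orbT.
have Ta : T (s * a' + (1 - s) * 0) (s * b2 + (1 - s) * th).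
  apply: cvxT; [exact: ltW|exact: ltW|exact: H|apply: axis2 => //; exact: ltW].
rewrite mulr0 addr0 -aE in Ta; apply: (down _ _ Ta); [exact: ltW|lra|exact: ltW|lra].
Qed.

Let bd_exists a : ~ T 1 1 -> 0 < a -> a < 1 -> 1 + (1 - a) / (th - 1) < th ->
  exists b, bd a b.
Proof.
have t1 := th1; have t0 := th0; move=> n11 a0 a1 ah; pose A : set R := fun b => 0 <= b /\ T a b.
have A0 : A 0 by split=> //; apply: axis1; [exact: ltW|lra].
have Aub : ubound A (1 + (1 - a) / (th - 1)) by move=> b [b0 Tab]; apply: below.
have hA : has_sup A by split; [exists 0|exists (1 + (1 - a) / (th - 1))].
set b := sup A; exists b.
have b_le : b <= 1 + (1 - a) / (th - 1) by apply: ge_sup => //; exists 0.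
have bh : b < th by apply: le_lt_trans b_le ah.
have A_le x : A x -> x <= b by move=> Ax; apply: ub_le_sup => //; exists (1 + (1 - a) / (th - 1)).
have b0 : 0 < b.
  apply: lt_le_trans (A_le (th - a) _); first by lra.
  split; first by lra.
  have [s [s0 s1 aE]] := @ratio a th (ltW a0) ltac:(lra).
  have := cvxT s0 s1 (axis1 (ltW th0) (lexx _)) (axis2 (ltW th0) (lexx _)).
  rewrite mulr0 addr0 -aE mulr0 add0r; congr T; rewrite aE; ring.
split=> //.
  move=> b' b'0 b'b; have e0 : 0 < b - b' by rewrite subr_gt0.
  have [x [x0 Tx] xb] := sup_adherent e0 hA.
  apply: (down _ _ Tx) => //; [exact: ltW|lra|].
  by rewrite -/b in xb; lra.
move=> Tab; have [s s1 Ts] := openT Tab.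
(* Capping by [th / b] keeps the height within [th], where moving left inside [T] is possible. *)
pose s' := Num.min s (th / b).
have s'1 : 1 < s' by rewrite lt_min s1 ltr_pdivlMr // mul1r.
have Ts' : T (s' * a) (s' * b).
  have s0 : 0 < s by lra.
  have [u [u0 u1 s'E]] := @ratio s' s ltac:(lra) ltac:(by rewrite ge_min lexx).
  have := cvxT u0 u1 Ts T00; rewrite !mulr0 !addr0 !mulrA -s'E; exact.
have s'b : s' * b <= th by rewrite -ler_pdivlMr // ge_min lexx orbT.
have s'b0 : b < s' * b by rewrite ltr_pMl.
have : A (s' * b).
  split; first by apply: ltW; lra.
  apply: (left _ s'b Ts'); [by apply: ltW; lra|exact: ltW|].
  by rewrite ler_pMl // ltW.
by move=> /A_le; rewrite leNgt s'b0.
Qed.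

Let bd_fin a b : 0 < a -> a < 1 -> bd a b -> (a \in FX) || (b \in FY).
Proof.
move=> a0 a1 [b0 bh H nT]; apply: bdryT => //; [exact: ltW|exact: ltW|].
move=> s s0 s1; apply: (left (a := a)); rewrite ?mulr_ge0 ?(ltW a0) ?(ltW b0) //.
- apply: le_trans (ltW bh); rewrite -[leRHS]mul1r ler_wpM2r //; exact: ltW.
- apply: H; first by rewrite mulr_ge0 // ltW.
  by rewrite -[ltRHS]mul1r ltr_pM2r.
- rewrite -[leRHS]mul1r ler_wpM2r //; exact: ltW.
Qed.

(** If [(1, 1)] were missing, the upper boundary over abscissas close to one would be a strictly
    decreasing curve of exit points. It meets each of the finitely many horizontal lines at most
    once, so some abscissa avoids all lines of both kinds. *)
Lemma square_fill : T 1 1.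
Proof.
have t1 := th1; have [//|n11] := pselect (T 1 1); exfalso.
(* [1 - a < (th - 1)^2] is exactly what makes the bound of [below] smaller than [th]. *)
pose u := (th - 1) ^+ 2.
have u0 : 0 < u by rewrite exprn_gt0 // subr_gt0.
pose a0 := Num.max 0 (1 - u).
have a01 : a0 < 1 by rewrite gt_max ltr01 /=; lra.
have range a : a0 < a -> a < 1 -> 0 < a /\ 1 + (1 - a) / (th - 1) < th.
  rewrite gt_max => /andP[a_gt0 ua] a1; split=> //.
  have e0 : 0 < th - 1 by lra.
  have : (1 - a) / (th - 1) < th - 1; last by lra.
  rewrite ltr_pdivrMr // -expr2 -/u; lra.
have [L HL] : exists L : seq R, forall a b, a0 < a -> a < 1 -> a \notin L -> bd a b -> b \notin FY.
  elim: FY => [|y s [L HL]]; first by exists [::].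
  have [[z [z1 z2 bz]]|nz] := pselect (exists z, [/\ a0 < z, z < 1 & bd z y]); last first.
    exists L => a b h1 h2 h3 h4; rewrite inE negb_or (HL a) // andbT.
    by apply/eqP => by_; apply: nz; exists a; rewrite -by_.
  exists (z :: L) => a b h1 h2; rewrite !inE !negb_or => /andP[az aL] h4.
  rewrite (HL a) // andbT; apply: contraTneq isT => by_.
  have [zpos _] := range z z1 z2; have [apos _] := range a h1 h2.
  rewrite by_ in h4; case: (ltgtP a z) az => // h _.
    by case: (bd_inj apos h z2 h4 bz).
  by case: (bd_inj zpos h h2 bz h4).
have [a [h1 h2]] := avoid (FX ++ L) a01; rewrite mem_cat negb_or => /andP[aX aL].
have [apos ah] := range a h1 h2.
have [b hb] := bd_exists n11 apos h2 ah.
have := bd_fin apos h2 hb; rewrite (negPf aX) /=; apply/negP; exact: HL hb.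
Qed.

End SquareFill.

Import numFieldNormedType.Exports.
Import ArrowAsProduct.

(** * Neighbourhoods, limits and components in the product topology *)

Section Topology.
Context {R : realType}.
Local Open Scope classical_set_scope.
Local Open Scope ring_scope.
Local Notation tup g n := ('I_g -> 'M[R]_n).

Lemma mx_nbhsP m n (M : 'M[R]_(m, n)) (U : set 'M[R]_(m, n)) :
  nbhs M U <-> exists2 e : R, 0 < e & forall M', rnorm (M' - M) < e -> U M'.
Proof.
split=> [/nbhs_ballP[e e0 H]|[e e0 H]].
  exists e => // M' h; apply: H; split=> // i j; rewrite /ball /= distrC.
  by apply: le_lt_trans h; have := entry_le_rnorm (M' - M) i j; rewrite !mxE.
apply/nbhs_ballP; exists (e / (m * n).+1%:R) => /=; first by rewrite divr_gt0.
move=> M' [_ h]; apply: H; rewrite rnormE.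
have b i j : `|(M' - M) i j| <= e / (m * n).+1%:R.
  by rewrite !mxE distrC ltW //; apply: h.
apply: le_lt_trans (ler_sum _ (fun i _ => ler_sum _ (fun j _ => b i j))) _.
rewrite !sumr_const !card_ord -mulrnA -[_ *+ _]mulr_natr mulnC mulrAC.
by rewrite ltr_pdivrMr // ltr_pM2l // ltr_nat.
Qed.

Lemma tuple_nbhsP g n (X : tup g n) (U : set (tup g n)) :
  nbhs X U <-> exists2 e : R, 0 < e & forall Y, tdist Y X < e -> U Y.
Proof.
split=> [|[e e0 H]].
  pose F := filter_from [set e : R | 0 < e] (fun e => [set Y | tdist Y X < e]).
  have FF : Filter F.
    apply: filter_from_filter; first by exists 1 => /=.
    move=> e1 e2 e10 e20; exists (Num.min e1 e2); first by rewrite /= lt_min e10.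
    by move=> Y; rewrite /= lt_min => /andP[].
  suff FX : F --> X by move=> /FX[e /= e0 eU]; exists e.
  apply/cvg_sup => j V; have /= -> := @nbhsE (initial_topology (fun f : tup g n => f j)) X.
  case=> B [[C oC <-] CX] /filterS; apply.
  have /mx_nbhsP[e e0 eC] : nbhs (X j) C by apply: open_nbhs_nbhs.
  exists e => //= Y h; apply: eC; apply: le_lt_trans h; exact: rnorm_le_tdist.
pose e' := e / g.+1%:R; have e'0 : 0 < e' by rewrite divr_gt0.
have near_j (j : 'I_g) : nbhs X [set Y : tup g n | rnorm (Y j - X j) < e'].
  have c := @proj_continuous _ (fun=> 'M[R]_n : topologicalType) j X.
  by apply: (c [set M | rnorm (M - X j) < e']); apply/mx_nbhsP; exists e'.
have FX : Filter (nbhs X) by apply: nbhs_filter.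
have := @filter_forall _ _ (fun j (Y : tup g n) => rnorm (Y j - X j) < e') _ FX near_j.
apply: (@filterS _ _ FX) => Y hY; apply: H.
apply: le_lt_trans (ler_sum _ (fun j _ => ltW (hY j))) _.
rewrite sumr_const card_ord -mulr_natr /e' mulrAC.
by rewrite ltr_pdivrMr // ltr_pM2l // ltr_nat.
Qed.

Lemma tdist_ray g n (X : tup g n) s t :
  tdist (fun j => s *: X j) (fun j => t *: X j) = `|s - t| * \sum_j rnorm (X j).
Proof. by rewrite mulr_sumr; apply: eq_bigr => j _; rewrite -scalerBl rnormZ. Qed.

Lemma near_ray g n (X : tup g n) t e : 0 < e ->
  exists2 del, 0 < del & forall s, `|s - t| < del ->
    tdist (fun j => s *: X j) (fun j => t *: X j) < e.
Proof.
move=> e0; set k := \sum_j rnorm (X j).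
have k0 : 0 <= k by apply: sumr_ge0 => j _; apply: rnorm_ge0.
have k1 : 0 < k + 1 by rewrite ltr_wpDl.
exists (e / (k + 1)); first by rewrite divr_gt0.
move=> s; rewrite ltr_pdivlMr // tdist_ray; apply: le_lt_trans.
by apply: ler_wpM2l => //; rewrite lerDl.
Qed.

Lemma ray_continuous g n (X : tup g n) :
  continuous (fun t : R => (fun j => t *: X j) : tup g n).
Proof.
move=> t U /tuple_nbhsP[e e0 H]; have [del d0 Hd] := near_ray X t e0.
apply/nbhs_ballP; exists del => // s; rewrite /ball /= distrC => /Hd; exact: H.
Qed.

Lemma within_cvgP g n a b (F : tup g n -> 'M[R]_(a, b)) (I : set (tup g n))
    (X : tup g n) (L : 'M[R]_(a, b)) :
  F @ within I (nbhs X) --> L <->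
  forall e, 0 < e -> exists2 d, 0 < d & forall Y, I Y -> tdist Y X < d -> rnorm (F Y - L) < e.
Proof.
split=> [FL e e0|H U /mx_nbhsP[e e0 eU]].
  have /FL : nbhs L [set M | rnorm (M - L) < e] by apply/mx_nbhsP; exists e.
  rewrite /= nbhs_simpl /within /= => /tuple_nbhsP[d d0 Hd].
  by exists d => // Y IY /Hd; apply.
have [d d0 Hd] := H e e0; rewrite /= nbhs_simpl /within /=; apply/tuple_nbhsP.
by exists d => // Y YX IY; apply: eU; apply: Hd.
Qed.

Lemma within_limE g n a b (F : tup g n -> 'M[R]_(a, b)) (I : set (tup g n))
    (X : tup g n) (L : 'M[R]_(a, b)) :
  (forall d, 0 < d -> exists2 Y, I Y & tdist Y X < d) ->
  F @ within I (nbhs X) --> L -> lim (F @ within I (nbhs X)) = L.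
Proof.
move=> dense FL; have c : cvg (F @ within I (nbhs X)) by apply/cvg_ex; exists L.
set l := lim _ in c *; have [//|lL] := eqVneq l L; exfalso.
have n0 : 0 < rnorm (l - L).
  rewrite lt_def rnorm_ge0 andbT; apply: contra_neq lL => h.
  by apply: subr0_eq; apply: rnorm_eq0; rewrite h.
have e0 : 0 < rnorm (l - L) / 2 by rewrite divr_gt0.
have /within_cvgP/(_ _ e0)[d1 d10 h1] : F @ within I (nbhs X) --> l by [].
have /within_cvgP/(_ _ e0)[d2 d20 h2] := FL.
have [|Y IY] := dense (Num.min d1 d2); first by rewrite lt_min d10.
rewrite lt_min => /andP[/(h1 _ IY) {}h1 /(h2 _ IY) {}h2].
have : rnorm (l - L) <= rnorm (F Y - l) + rnorm (F Y - L).
  have -> : l - L = (F Y - L) - (F Y - l) by rewrite opprB [RHS]addrC addrA subrK.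
  by rewrite addrC -(rnormN (F Y - l)); apply: rnormD.
move: h1 h2; set p := rnorm (F Y - l); set q := rnorm (F Y - L); move: n0; set u := rnorm (l - L).
by clear => *; lra.
Qed.

Lemma segment_component g n (E : set (tup g n)) (X : tup g n) :
  (forall t, 0 <= t -> t <= 1 -> E (fun j => t *: X j)) ->
  connected_component E (fun=> 0) X.
Proof.
move=> H; pose f (t : R) : tup g n := fun j => t *: X j.
have f0 : f 0 = (fun=> 0) by apply/funext => j; rewrite /f scale0r.
have f1 : f 1 = X by apply/funext => j; rewrite /f scale1r.
have c : connected (f @` `[0, 1]%classic).
  apply: connected_continuous_connected; first exact: segment_connected.
  exact/continuous_subspaceT/ray_continuous.
apply: (connected_component_max _ _ c).
- by exists 0; rewrite // /= in_itv /= lexx ler01.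
- by move=> _ [t /= + <-]; rewrite in_itv /= => /andP[]; apply: H.
- by exists 1; rewrite // /= in_itv /= lexx ler01.
Qed.

Lemma convex_set_comb g n (E : set (tup g n)) X Y s : convex_set E ->
  0 <= s -> s <= 1 -> E X -> E Y -> E (fun j => s *: X j + (1 - s) *: Y j).
Proof.
move=> cE s0 s1 EX EY.
have s01 : Itv.spec (@Itv.num_sem R) (Itv.Real `[0%Z, 1%Z]) s.
  by rewrite /= /Itv.num_sem /= in_itv /= s0 s1 ger0_real.
have := cE X Y (Itv.mk s01) (mem_set EX) (mem_set EY).
by rewrite inE; congr E; apply/funext => j.
Qed.

End Topology.

(** * Rays through a tuple *)

Section Ray.
Context {R : realType} {g : nat}.
Local Notation rtup n := ('I_g -> 'M[R]_n).

Definition ray n (t : R) (X : rtup n) : rtup n := fun j => t *: X j.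

Lemma ray1 n (X : rtup n) : ray 1 X = X.
Proof. by apply/funext => j; rewrite /ray scale1r. Qed.

Lemma ray0 n (X : rtup n) : ray 0 X = (fun=> 0).
Proof. by apply/funext => j; rewrite /ray scale0r. Qed.

Lemma rayA n s t (X : rtup n) : ray s (ray t X) = ray (s * t) X.
Proof. by apply/funext => j; rewrite /ray scalerA. Qed.

Lemma ray_sym n t (X : rtup n) : symT X ->
  forall j, (ray t X j)^T = ray t X j.
Proof. by move=> sX j; rewrite /ray linearZ /= sX. Qed.

Lemma near_ray1 n (X : rtup n) e : 0 < e ->
  exists2 del, 0 < del & forall t, `|t - 1| < del -> tdist (ray t X) X < e.
Proof.
move=> e0; have [del d0 H] := near_ray X 1 e0; exists del => // t /H.
by rewrite -/(ray t X) -/(ray 1 X) ray1.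
Qed.

Lemma ray_sum n m t (X : rtup n) (Y : rtup m) :
  ray t (fun j => block_mx (X j) 0 0 (Y j)) =
  (fun j => block_mx (ray t X j) 0 0 (ray t Y j)).
Proof. by apply/funext => j; rewrite /ray scale_block_mx !scaler0. Qed.

Lemma ray_restr n N t (V : 'M[R]_(N, n)) (W : rtup N) (X : rtup n) :
  (forall j, W j *m V = V *m X j) -> forall j, ray t W j *m V = V *m ray t X j.
Proof. by move=> WV j; rewrite /ray -scalemxAl WV scalemxAr. Qed.

Lemma sym_sum n m (X : rtup n) (Y : rtup m) :
  symT X -> symT Y ->
  forall j, (block_mx (X j) 0 0 (Y j))^T = block_mx (X j) 0 0 (Y j).
Proof. by move=> sX sY j; rewrite tr_block_mx sX sY !trmx0. Qed.

Lemma small_tuple n e : 0 < e -> exists2 c : R, 0 < c &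
  forall X : rtup n, (forall j a b, `|X j a b| <= c) -> tdist X (fun=> 0) < e.
Proof.
move=> e0; pose N := (g * (n * n)).+1; exists (e / N%:R); first by rewrite divr_gt0.
move=> X h; rewrite /tdist.
have b (j : 'I_g) : rnorm (X j - 0) <= e / N%:R *+ (n * n).
  rewrite subr0 rnormE; apply: le_trans (ler_sum _ (fun a _ => ler_sum _ (fun b _ => h j a b))) _.
  by rewrite !sumr_const !card_ord -mulrnA.
apply: le_lt_trans (ler_sum _ (fun j _ => b j)) _.
rewrite sumr_const card_ord -mulrnA -[_ *+ _]mulr_natr mulrAC.
by rewrite ltr_pdivrMr // ltr_pM2l // ltr_nat /N mulnC.
Qed.

End Ray.

(** * Regular points of the realization *)

Section Regular.
Context {R : realType} {g d l : nat}.
Local Notation rtup n := ('I_g -> 'M[R]_n).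
Variable r : realization R g d l.
Hypothesis r0_pos : posdef (rD r + (rC r)^T *m rJ r *m rC r).
Local Notation rt := (realization_rexpr r).

(** Points where the value involves no limit. Hidden singularities are bypassed by moving slightly
    along a ray, since the pencil is invertible at all but finitely many multiples of a tuple. *)
Definition Preg n (X : rtup n) : Prop := inv_set r n X /\ posdef (reval r n X).

Lemma inv_setE n (X : rtup n) :
  inv_set r n X <-> symT X /\ evaluable rt X.
Proof. by rewrite -Domfor_realization. Qed.

Lemma inv_set_sym n (X : rtup n) : inv_set r n X -> symT X.
Proof. by move=> [sX _] j; apply: sX. Qed.

Lemma inv_set0 n : inv_set r n (fun=> 0).
Proof.
apply/inv_setE; split; first by move=> j; rewrite trmx0.
by have [] := evaluable0 n (analytic_at0_realization r).
Qed.

Lemma Preg0 n : Preg (fun=> 0 : 'M[R]_n).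
Proof. by split; [exact: inv_set0|exact: reval0_posdef]. Qed.

Lemma inv_set_generic n (X : rtup n) : symT X ->
  exists L : seq R, forall t, t \notin L -> inv_set r n (ray t X).
Proof.
move=> sX; have [L HL] := sing_finite (pencil_tuple r) X; exists L => t tL.
split; first exact: ray_sym.
by apply: contraNT tL => /pencil_sing; apply: HL.
Qed.

Lemma inv_set_ray_dense n (X : rtup n) e : symT X -> 0 < e ->
  exists t, [/\ 1 < t, t < 1 + e & inv_set r n (ray t X)].
Proof.
move=> sX e0; have [L HL] := inv_set_generic sX.
have [|t [t1 t2 /HL]] := @avoid R L 1 (1 + e); first by rewrite ltrDl.
by exists t.
Qed.

Lemma reval_ctn n (X : rtup n) : inv_set r n X ->
  ctn (fun Y => reval r n Y) X.
Proof.
move=> /inv_setE[_ /rexpr_ctn[c _]]; apply: ctn_ext c => Y.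
exact: rexpr_eval_realization.
Qed.

Lemma Plim_near n (X : rtup n) : Plim r n X ->
  exists2 e, 0 < e & forall Y, inv_set r n Y -> tdist Y X < e -> posdef (reval r n Y).
Proof.
rewrite /Plim /= /rvalue => -[dX]; case: asboolP => [iX pX|niX pX].
  have [e e0 He] := posdef_open pX; have [e1 e10 H1] := reval_ctn iX e0.
  exists e1 => // Y iY /H1; apply: He; exact: (reval_sym r0_pos (inv_set_sym iY)).
have [e e0 He] := posdef_open pX; case: dX => // -[_ _ cX].
have /within_cvgP/(_ _ e0)[e1 e10 H1] : (reval r n @ within (inv_set r n) (nbhs X)
   --> lim (reval r n @ within (inv_set r n) (nbhs X)))%classic by [].
exists e1 => // Y iY /(H1 _ iY); apply: He; exact: (reval_sym r0_pos (inv_set_sym iY)).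
Qed.

Lemma Plim_sym n (X : rtup n) : Plim r n X -> symT X.
Proof. by move=> [[[sX _]|[sX _ _]] _] j; apply: sX. Qed.

Lemma Preg_Plim n (X : rtup n) : Preg X -> Plim r n X.
Proof.
move=> [iX pX]; split; first by left.
by rewrite /rvalue asboolT.
Qed.

Lemma Plim_ray n (X : rtup n) : Plim r n X ->
  exists2 e, 0 < e & forall t, `|t - 1| < e -> inv_set r n (ray t X) -> Preg (ray t X).
Proof.
move=> /Plim_near[e e0 He]; have [del d0 Hd] := near_ray1 X e0.
by exists del => // t /Hd h iX; split=> //; apply: He.
Qed.

Lemma Preg_ball n : exists2 c : R, 0 < c & forall X : rtup n,
  symT X -> (forall j a b, `|X j a b| <= c) -> Preg X.
Proof.
have [e e0 He] := Plim_near (Preg_Plim (Preg0 n)).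
have /inv_setE[_ /rexpr_ctn[_ [e1 e10 H1]]] := inv_set0 n.
have [|c c0 Hc] := @small_tuple R g n (Num.min e e1); first by rewrite lt_min e0.
exists c => // X sX /Hc; rewrite lt_min => /andP[h1 /H1 h2].
have iX : inv_set r n X by apply/inv_setE.
by split=> //; apply: He.
Qed.

Lemma Preg_restr N n (V : 'M[R]_(N, n)) W X : V^T *m V = 1%:M ->
  (forall j, W j *m V = V *m X j) -> symT X -> Preg W -> Preg X.
Proof.
move=> VV WV sX [/inv_setE[_ eW]]; rewrite -rexpr_eval_realization => pW.
split; first by apply/inv_setE; split=> //; apply: evaluable_restr VV WV _ _ _ eW.
by rewrite -rexpr_eval_realization; apply: posdef_restr VV WV _ _ eW pW.
Qed.

Lemma Preg_sum n m (X : rtup n) (Y : rtup m) : Preg X -> Preg Y ->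
  Preg (fun j => block_mx (X j) 0 0 (Y j)).
Proof.
move=> [/inv_setE[sX eX] pX] [/inv_setE[sY eY] pY]; split.
  by apply/inv_setE; split; [exact: sym_sum|exact: evaluable_sum].
by move: pX pY; rewrite -!rexpr_eval_realization; apply: posdef_sum.
Qed.

Definition boundary_tuples : seq {k & rtup k} :=
  [:: existT _ d (pencil_tuple r); existT _ (d + l)%N (system_tuple r)].

(** If neither tuple is singular at [X], the pencil and [r(X)] are both invertible; [r(X)] is then a
    limit of positive definite values along the ray, hence positive definite, and [X] would be
    regular. *)
Lemma boundary_sing n (X : rtup n) : symT X ->
  (forall s, 0 <= s -> s < 1 -> inv_set r n (ray s X) -> posdef (reval r n (ray s X))) ->
  ~ Preg X -> exists2 x, List.In x boundary_tuples & sing (projT2 x) X.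
Proof.
move=> sX below nP.
have [U|/pencil_sing h] := boolP (pencil (rJ r) (rA r) X \in unitmx); last first.
  by exists (existT _ d (pencil_tuple r)) => //; left.
have [U2|/(reval_sing r0_pos U) h] := boolP (reval r n X \in unitmx); last first.
  by exists (existT _ (d + l)%N (system_tuple r)) => //; right; left.
have iX : inv_set r n X by split.
case: nP; split=> //; apply: posdef_limit => //; first exact: (reval_sym r0_pos sX).
move=> e e0; have [e1 e10 H1] := reval_ctn iX e0.
have [_ /rexpr_ctn[_ [e2 e20 H2]]] := (inv_setE X).1 iX.
have [|del d0 Hd] := @near_ray1 R g n X (Num.min e1 e2); first by rewrite lt_min e10.
pose s := 1 - Num.min 1 (del / 2).
have m0 : 0 < Num.min 1 (del / 2) by rewrite lt_min ltr01 divr_gt0.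
have s0 : 0 <= s by rewrite subr_ge0 ge_min lexx.
have s1 : s < 1 by rewrite ltrBlDr ltrDl.
have sd : `|s - 1| < del.
  rewrite distrC ger0_norm ?subr_ge0 1?ltW // /s opprB addrC subrK.
  by rewrite gt_min [del / 2 < del]ltr_pdivrMr // mulr2n mulrDr mulr1 ltrDl d0 orbT.
have := Hd _ sd; rewrite lt_min => /andP[h1 /H2 h2].
have is_ : inv_set r n (ray s X) by apply/inv_setE; split=> //; apply: ray_sym.
by exists (reval r n (ray s X)); [exact: below|exact: H1].
Qed.

End Regular.

(** * The limit domain *)

Section Limit.
Context {R : realType} {g d l : nat}.
Variable r : realization R g d l.
Hypothesis r0_pos : posdef (rD r + (rC r)^T *m rJ r *m rC r).
Hypothesis cvxP : forall n, (0 < n)%N -> convex_set (Plim r n).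

Lemma Plim_scale n (X : 'I_g -> 'M[R]_n) s : (0 < n)%N -> 0 <= s -> s <= 1 ->
  Plim r n X -> Plim r n (ray s X).
Proof.
move=> n0 s0 s1 PX.
have := convex_set_comb (cvxP n0) s0 s1 PX (Preg_Plim (Preg0 r0_pos n)).
by congr (Plim r n); apply/funext => j; rewrite scaler0 addr0.
Qed.

(** Convexity recovers [X] from a slightly larger multiple, which can be chosen off the hidden
    singularities. Restriction and direct sums then concern actual values of the realization instead
    of limits. *)
Lemma PlimP n (X : 'I_g -> 'M[R]_n) : (0 < n)%N -> symT X ->
  Plim r n X <-> exists2 t, 1 < t & Preg r (ray t X).
Proof.
move=> n0 sX; split=> [/(Plim_ray r0_pos)[e e0 He]|[t t1 /Preg_Plim Pt]].
  have [t [t1 te iX]] := inv_set_ray_dense r sX e0; exists t => //.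
  by apply: He => //; rewrite ger0_norm ?subr_ge0 ?ltW // ltrBlDr addrC.
have t0 : 0 < t := lt_trans ltr01 t1.
rewrite -[X]ray1 -(mulVf (lt0r_neq0 t0)) -rayA; apply: Plim_scale => //.
  by rewrite invr_ge0 ltW.
by rewrite invf_le1 // ltW.
Qed.

Lemma Plim_family : real_family (Plim r).
Proof.
split.
- exact: Plim_sym.
- by move=> n X Y s n0 PX PY s0 s1; apply: convex_set_comb => //; apply: cvxP.
- move=> n n0; have [c c0 Hc] := Preg_ball r0_pos n; exists c => // X sX h.
  exact/Preg_Plim/Hc.
- move=> n X n0 PX; have sX := Plim_sym PX.
  have [t t1 Pt] := (PlimP n0 sX).1 PX.
  have [h1 h2] := midf_lt t1; exists ((1 + t) / 2) => //.
  have u0 : 0 < (1 + t) / 2 by apply: lt_trans h1.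
  apply/(PlimP n0 (ray_sym _ sX)); exists (t / ((1 + t) / 2)).
    by rewrite ltr_pdivlMr // mul1r.
  by rewrite rayA divfK // gt_eqF.
- move=> N n V W X n0 VV WV sX PW; apply/(PlimP n0 sX).
  have N0 := isometry_size n0 VV.
  have [t t1 Pt] := (PlimP N0 (Plim_sym PW)).1 PW; exists t => //.
  by apply: Preg_restr VV (ray_restr t WV) _ Pt; apply: ray_sym.
- move=> n m X Y n0 m0 PX PY; have sX := Plim_sym PX; have sY := Plim_sym PY.
  apply/PlimP; [by rewrite addn_gt0 n0|exact: sym_sum|].
  have [e e0 He] := Plim_ray r0_pos PX; have [e' e'0 He'] := Plim_ray r0_pos PY.
  have [L HL] := inv_set_generic r sX; have [L' HL'] := inv_set_generic r sY.
  (* One factor [t > 1] has to make the pencil invertible at [t X] and at [t Y], so both finite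
     exceptional sets are avoided together. *)
  have [|t [t1 t2]] := @avoid R (L ++ L') 1 (1 + Num.min e e').
    by rewrite ltrDl lt_min e0.
  rewrite mem_cat negb_or => /andP[/HL i1 /HL' i2]; exists t => //.
  have : `|t - 1| < Num.min e e'.
    by rewrite ger0_norm ?subr_ge0 ?ltW // ltrBlDr addrC.
  rewrite lt_min => /andP[h1 h2]; rewrite ray_sum.
  by apply: Preg_sum; [exact: He|exact: He'].
Qed.

Lemma Plim_boundary n (X : 'I_g -> 'M[R]_n) : (0 < n)%N -> bdryR (Plim r n) X ->
  exists2 x, List.In x (boundary_tuples r) & sing (projT2 x) X.
Proof.
move=> n0 [sX below nP]; apply: boundary_sing => //; last by move=> /Preg_Plim.
by move=> s s0 s1 iX; have [_] := below s s0 s1; rewrite /rvalue asboolT.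
Qed.

End Limit.

Lemma boundary_sing_finite (R : realType) g (s : seq {k & 'I_g -> 'M[R]_k}) n (X : 'I_g -> 'M[R]_n) :
  exists L : seq R, forall x t, List.In x s -> sing (projT2 x) (ray t X) -> t \in L.
Proof.
elim: s => [|x s [L HL]]; first by exists [::].
have [L' HL'] := sing_finite (projT2 x) X; exists (L' ++ L) => y t; rewrite mem_cat.
by case=> [<- /HL' ->|ys /(HL _ _ ys) ->] //; rewrite orbT.
Qed.

(** * The algebraic domain *)

Section Algebraic.
Context {R : realType} {g d l : nat}.
Local Notation rtup n := ('I_g -> 'M[R]_n).
Variable r : realization R g d l.
Hypothesis r0_pos : posdef (rD r + (rC r)^T *m rJ r *m rC r).
Local Notation rt := (realization_rexpr r).

Definition valid (s : rexpr R g l l) := analytic_at0 s /\ rexpr_equiv s rt.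

Lemma valid_realization : valid rt.
Proof. by split=> //; apply: analytic_at0_realization. Qed.

Definition Ereg n : set (rtup n) :=
  fun X => Domalg r n X /\ posdef (rvalue r n X).

Lemma inv_set_dense n (X : rtup n) e : symT X -> 0 < e ->
  exists2 Y, inv_set r n Y & tdist Y X < e.
Proof.
move=> sX e0; have [del d0 Hd] := near_ray1 X e0.
have [t [t1 td iX]] := inv_set_ray_dense r sX d0; exists (ray t X) => //.
by apply: Hd; rewrite ger0_norm ?subr_ge0 ?ltW // ltrBlDr addrC.
Qed.

Lemma valid_limit n s (X : rtup n) : (0 < n)%N -> valid s ->
  evaluable s X -> forall e, 0 < e -> exists2 d, 0 < d &
  forall Y, inv_set r n Y -> tdist Y X < d -> rnorm (reval r n Y - rexpr_eval s X) < e.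
Proof.
move=> n0 [_ eqs] /rexpr_ctn[c [d1 d10 H1]] e e0; have [d2 d20 H2] := c e e0.
exists (Num.min d1 d2); first by rewrite lt_min d10.
move=> Y iY; rewrite lt_min => /andP[/H1 h1 /H2 h2].
rewrite -rexpr_eval_realization -(eqs n n0 Y) //; last by rewrite Domfor_realization.
by split=> //; have [] := iY.
Qed.

(** Both branches of [rvalue] agree with [s]: at invertible points by equivalence, elsewhere because
    [s] is continuous and invertible points are dense. *)
Lemma valid_value n s (X : rtup n) : (0 < n)%N -> valid s ->
  symT X -> evaluable s X -> rvalue r n X = rexpr_eval s X.
Proof.
move=> n0 vs sX eX; rewrite /rvalue; case: asboolP => iX.
  have [_ eqs] := vs; rewrite -rexpr_eval_realization; apply/esym/eqs => //.
  by rewrite Domfor_realization.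
apply: within_limE; first by move=> e e0; apply: inv_set_dense.
by apply/within_cvgP => e e0; apply: valid_limit.
Qed.

(** Nothing in the shape of [s] makes its values symmetric; symmetry passes to the limit from nearby
    values of the realization. *)
Lemma valid_sym n s (X : rtup n) : (0 < n)%N -> valid s ->
  symT X -> evaluable s X -> (rexpr_eval s X)^T = rexpr_eval s X.
Proof.
move=> n0 vs sX eX; have [//|ne] := eqVneq (rexpr_eval s X)^T (rexpr_eval s X).
exfalso; move: ne; set M := rexpr_eval s X => ne.
have k0 : 0 < rnorm (M^T - M).
  rewrite lt_def rnorm_ge0 andbT; apply: contra_neq ne => h.
  by apply: subr0_eq; apply: rnorm_eq0; rewrite h.
have [|e e0 He] := valid_limit n0 vs eX (e := rnorm (M^T - M) / 2); first by rewrite divr_gt0.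
have [Y iY /(He _ iY)] := inv_set_dense sX e0; rewrite -/M => h.
have sY := reval_sym r0_pos (inv_set_sym iY).
have : rnorm (M^T - M) <= rnorm (reval r n Y - M) + rnorm (reval r n Y - M).
  have -> : M^T - M = (reval r n Y - M) - (reval r n Y - M)^T.
    by rewrite linearB /= sY opprB [RHS]addrC addrA subrK.
  by apply: le_trans (rnormD _ _) _; rewrite rnormN rnormT.
move: h; rewrite ltr_pdivlMr // => h h'.
by have := le_lt_trans h' _; rewrite -mulr2n -[_ *+ 2]mulr_natr => /(_ _ h); rewrite ltxx.
Qed.

Lemma EregP n (X : rtup n) : (0 < n)%N -> Ereg X <->
  exists s, [/\ valid s, symT X, evaluable s X & posdef (rexpr_eval s X)].
Proof.
move=> n0; split=> [[[s [as_ es [sX eX]]] pX]|[s [[as_ es] sX eX pX]]].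
  by exists s; split=> //; rewrite -(valid_value n0 _ sX eX).
split; first by exists s; split.
by rewrite (valid_value n0 (conj as_ es) sX eX).
Qed.

Lemma Ereg_near n (X : rtup n) : (0 < n)%N -> Ereg X ->
  exists2 e, 0 < e & forall Y : rtup n, symT Y -> tdist Y X < e -> Ereg Y.
Proof.
move=> n0 /(EregP _ n0)[s [vs sX eX pX]]; have [c [e1 e10 H1]] := rexpr_ctn eX.
have [e e0 He] := posdef_open pX; have [e2 e20 H2] := c e e0.
exists (Num.min e1 e2); first by rewrite lt_min e10.
move=> Y sY; rewrite lt_min => /andP[/H1 h1 /H2 h2].
by apply/(EregP _ n0); exists s; split=> //; apply: He => //; apply: valid_sym.
Qed.

Lemma Preg_Ereg n (X : rtup n) : (0 < n)%N -> Preg r X -> Ereg X.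
Proof.
move=> n0 [/inv_setE[sX eX] pX]; apply/(EregP _ n0); exists rt.
by split=> //; [exact: valid_realization|rewrite rexpr_eval_realization].
Qed.

Lemma Ereg_Preg n (X : rtup n) : inv_set r n X -> Ereg X -> posdef (reval r n X).
Proof. by move=> iX [_]; rewrite /rvalue asboolT. Qed.

Lemma Ereg0 n : (0 < n)%N -> Ereg (fun=> 0 : 'M[R]_n).
Proof. by move=> n0; apply: Preg_Ereg => //; apply: Preg0. Qed.

Lemma Ereg_restr N n (V : 'M[R]_(N, n)) W X : (0 < N)%N -> (0 < n)%N -> V^T *m V = 1%:M ->
  (forall j, W j *m V = V *m X j) -> symT X -> Ereg W -> Ereg X.
Proof.
move=> N0 n0 VV WV sX /(EregP _ N0)[s [vs sW eW pW]]; apply/(EregP _ n0); exists s.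
have eX := evaluable_restr VV WV eW.
by split=> //; apply: posdef_restr VV WV _ _ eW pW.
Qed.

(** An expression analytic at [0] is evaluable at the zero tuple of any size, so a single expression
    serves both summands; two arbitrary summands offer no such common expression. *)
Lemma Ereg_pad n m (X : rtup n) : (0 < n)%N -> (0 < m)%N -> Ereg X ->
  Ereg (fun j => block_mx (X j) 0 0 (0 : 'M[R]_m)) /\
  Ereg (fun j => block_mx (0 : 'M[R]_m) 0 0 (X j)).
Proof.
move=> n0 m0 /(EregP _ n0)[s [vs sX eX pX]].
have s0 (j : 'I_g) : (0 : 'M[R]_m)^T = 0 by rewrite trmx0.
have [e0 _] := evaluable0 m vs.1.
have p0 : posdef (rexpr_eval s (fun=> 0 : 'M[R]_m)).
  by rewrite -(valid_value m0 vs s0 e0); case: (Ereg0 m0).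
split; apply/EregP; rewrite ?addn_gt0 ?n0 ?m0 //; exists s; split=> //.
- exact: (sym_sum sX s0).
- exact: (evaluable_sum eX e0).
- exact: (posdef_sum eX e0 pX p0).
- exact: (sym_sum s0 sX).
- exact: (evaluable_sum e0 eX).
- exact: (posdef_sum e0 eX p0 pX).
Qed.

Hypothesis cvxD : forall n, (0 < n)%N -> convex_set (Dalg r n).

(** Convexity makes the component of [0] starlike, and a segment from [0] is connected;
    connectedness is thereby traded for a condition along the ray. *)
Lemma DalgP n (X : rtup n) : (0 < n)%N ->
  Dalg r n X <-> forall t, 0 <= t -> t <= 1 -> Ereg (ray t X).
Proof.
move=> n0; split=> [DX t t0 t1|H]; last exact: segment_component.
have D0 : Dalg r n (fun=> 0) by apply: connected_component_refl; apply: Ereg0.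
have := convex_set_comb (cvxD n0) t0 t1 DX D0.
have -> : (fun j => t *: X j + (1 - t) *: (0 : 'M[R]_n)) = ray t X.
  by apply/funext => j; rewrite scaler0 addr0.
exact: connected_component_sub.
Qed.

Lemma Dalg_Ereg n (X : rtup n) : (0 < n)%N -> Dalg r n X -> Ereg X.
Proof. by move=> n0 /(DalgP _ n0)/(_ 1 ler01 (lexx _)); rewrite ray1. Qed.

Lemma Dalg_sym n (X : rtup n) : Dalg r n X -> symT X.
Proof. by move=> /connected_component_sub[[s [_ _ [sX _]]] _] j; apply: sX. Qed.

Lemma Dalg_scale n (X : rtup n) s : (0 < n)%N -> 0 <= s -> s <= 1 ->
  Dalg r n X -> Dalg r n (ray s X).
Proof.
move=> n0 s0 s1 /(DalgP _ n0) H; apply/(DalgP _ n0) => t t0 t1; rewrite rayA; apply: H.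
  exact: mulr_ge0.
exact: mulr_ile1.
Qed.

Lemma Dalg_shrink n (X : rtup n) s t : (0 < n)%N -> 0 <= s -> s <= t ->
  Dalg r n (ray t X) -> Dalg r n (ray s X).
Proof.
move=> n0 s0 st; have [t0|t0] := eqVneq t 0.
  by rewrite t0 (_ : s = 0) //; apply/eqP; rewrite eq_le s0 -t0 st.
rewrite -(divfK t0 s) -rayA; have tp : 0 < t by rewrite lt_def t0 (le_trans s0).
apply: Dalg_scale => //; first by rewrite divr_ge0 // ltW.
by rewrite ler_pdivrMr // mul1r.
Qed.

Lemma Dalg_open n (X : rtup n) : (0 < n)%N -> Dalg r n X ->
  exists2 th, 1 < th & Dalg r n (ray th X).
Proof.
move=> n0 DX; have sX := Dalg_sym DX.
have [e e0 He] := Ereg_near n0 (Dalg_Ereg n0 DX).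
have [del d0 Hd] := near_ray1 X e0.
exists (1 + del / 2); first by rewrite ltrDl divr_gt0.
apply/(DalgP _ n0) => t t0 t1; rewrite rayA.
have [h|h] := leP (t * (1 + del / 2)) 1.
  apply: ((DalgP _ n0).1 DX) => //; rewrite mulr_ge0 // addr_ge0 // divr_ge0 // ltW //.
apply: He; first exact: ray_sym.
apply: Hd; rewrite ger0_norm ?subr_ge0 1?ltW //.
have : t * (1 + del / 2) <= 1 * (1 + del / 2).
  by apply: ler_wpM2r => //; rewrite addr_ge0 // divr_ge0 // ltW.
rewrite mul1r -(lerD2r (- 1)) addrAC subrr add0r => /le_lt_trans; apply.
by rewrite ltr_pdivrMr // mulr2n mulrDr mulr1 ltrDl.
Qed.

Lemma Dalg_boundary n (X : rtup n) : (0 < n)%N -> bdryR (Dalg r n) X ->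
  exists2 x, List.In x (boundary_tuples r) & sing (projT2 x) X.
Proof.
move=> n0 [sX below nD].
have E1 s : 0 <= s -> s < 1 -> Ereg (ray s X).
  by move=> s0 s1; apply: Dalg_Ereg => //; apply: below.
apply: boundary_sing => //.
  by move=> s s0 s1 iX; apply: Ereg_Preg => //; apply: E1.
move=> /(Preg_Ereg n0) EX; apply: nD; apply/(DalgP _ n0) => t t0.
by rewrite le_eqVlt => /orP[/eqP ->|/(E1 _ t0)] //; rewrite ray1.
Qed.

Lemma Dalg_pad n m (X : rtup n) : (0 < n)%N -> (0 < m)%N -> Dalg r n X ->
  Dalg r (n + m)%N (fun j => block_mx (X j) 0 0 (0 : 'M[R]_m)) /\
  Dalg r (m + n)%N (fun j => block_mx (0 : 'M[R]_m) 0 0 (X j)).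
Proof.
move=> n0 m0 /(DalgP _ n0) H; split; apply/DalgP; rewrite ?addn_gt0 ?n0 ?m0 //.
  move=> t t0 t1; have [+ _] := Ereg_pad n0 m0 (H t t0 t1); congr Ereg.
  by apply/funext => j; rewrite /ray scale_block_mx !scaler0.
move=> t t0 t1; have [_] := Ereg_pad n0 m0 (H t t0 t1); congr Ereg.
by apply/funext => j; rewrite /ray scale_block_mx !scaler0.
Qed.

(* Different expressions may be needed to evaluate [r] at [X] and at [Y], so the
   direct sum is reached through the square of the pairs [(a, b)]: [aX (+) bY]
   can only leave the domain along finitely many lines [a = const] or
   [b = const]. *)
Lemma Dalg_sum n m (X : rtup n) (Y : rtup m) : (0 < n)%N -> (0 < m)%N ->
  Dalg r n X -> Dalg r m Y -> Dalg r (n + m)%N (fun j => block_mx (X j) 0 0 (Y j)).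
Proof.
move=> n0 m0 DX DY; have nm : (0 < n + m)%N by rewrite addn_gt0 n0.
have sX := Dalg_sym DX; have sY := Dalg_sym DY.
pose T a b := Dalg r (n + m)%N (fun j => block_mx (ray a X j) 0 0 (ray b Y j)).
(* Openness along rays gives [th > 1], that is, axes of [T] reaching beyond one, as [square_fill]
   requires. *)
have [t1 t11 D1] := Dalg_open n0 DX; have [t2 t21 D2] := Dalg_open m0 DY.
pose th := Num.min t1 t2; have th1 : 1 < th by rewrite lt_min t11.
have DXa a : 0 <= a -> a <= th -> Dalg r n (ray a X).
  by rewrite le_min => a0 /andP[a1 _]; apply: Dalg_shrink n0 a0 a1 D1.
have DYb b : 0 <= b -> b <= th -> Dalg r m (ray b Y).
  by rewrite le_min => b0 /andP[_ b2]; apply: Dalg_shrink m0 b0 b2 D2.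
have [FX HX] := boundary_sing_finite (boundary_tuples r) X.
have [FY HY] := boundary_sing_finite (boundary_tuples r) Y.
have T_ray s a b : T (s * a) (s * b) <->
    Dalg r (n + m)%N (ray s (fun j => block_mx (ray a X j) 0 0 (ray b Y j))).
  by rewrite ray_sum !rayA.
suff : T 1 1 by rewrite /T !ray1.
apply: (@square_fill R T th FX FY) => //.
- move=> a b a' b' s s0 s1 H1 H2.
  have := convex_set_comb (cvxD nm) s0 s1 H1 H2; rewrite /T; congr (Dalg r _).
  apply/funext => j; rewrite !scale_block_mx add_block_mx !scaler0 !addr0 /ray.
  by congr block_mx => //; rewrite [RHS]scalerDl !scalerA.
- move=> a a0 ah; have [+ _] := Dalg_pad n0 m0 (DXa a a0 ah); rewrite /T; congr (Dalg r _).
  by apply/funext => j; rewrite ray0.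
- move=> b b0 bh; have [_] := Dalg_pad m0 n0 (DYb b b0 bh); rewrite /T; congr (Dalg r _).
  by apply/funext => j; rewrite ray0.
- move=> a b Tab; have [s s1 Ds] := Dalg_open nm Tab; exists s => //.
  exact/T_ray.
- move=> a b a0 b0 below nT.
  have [|x xs] := @Dalg_boundary (n + m)%N (fun j => block_mx (ray a X j) 0 0 (ray b Y j)) nm.
    split=> //; first by apply: sym_sum; apply: ray_sym.
    by move=> s s0 s1; apply/T_ray/below.
  by case/sing_sum => [/(HX _ _ xs) ->|/(HY _ _ xs) ->] //; rewrite orbT.
Qed.

Lemma Dalg_family : real_family (Dalg r).
Proof.
split.
- exact: Dalg_sym.
- by move=> n X Y s n0 PX PY s0 s1; apply: convex_set_comb => //; apply: cvxD.
- move=> n n0; have [c c0 Hc] := Preg_ball r0_pos n; exists c => // X sX h.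
  apply/(DalgP _ n0) => t t0 t1; apply: Preg_Ereg => //; apply: Hc; first exact: ray_sym.
  move=> j a b; rewrite mxE normrM (ger0_norm t0); apply: le_trans (h j a b).
  by rewrite ler_piMl.
- by move=> n X n0; apply: Dalg_open.
- move=> N n V W X n0 VV WV sX.
  have N0 := isometry_size n0 VV.
  move=> /(DalgP _ N0) H; apply/(DalgP _ n0) => t t0 t1.
  by apply: Ereg_restr N0 n0 VV (ray_restr t WV) _ (H t t0 t1); apply: ray_sym.
- exact: Dalg_sum.
Qed.

End Algebraic.

Theorem theorem1p2 (R : realType) (g d l : nat) (g_gt0 : (0 < g)%N)
    (r : realization R g d l) (r_min : minimal r)
    (r0_pos : posdef (rD r + (rC r)^T *m rJ r *m rC r)) :
  (bounded_seq (Plim r) ->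
   (forall n : nat, (0 < n)%N -> convex_set (Plim r n)) ->
   exists (m : nat) (AA : 'I_g -> 'M[R]_m),
     (0 < m)%N /\ sym_tuples m AA /\
     forall n : nat, (0 < n)%N ->
     forall X : 'I_g -> 'M[R]_n, sym_tuples n X ->
       (Plim r n X <-> posdef (pencil 1%:M AA X)))
  /\
  (bounded_seq (Dalg r) ->
   (forall n : nat, (0 < n)%N -> convex_set (Dalg r n)) ->
   exists (m : nat) (AA : 'I_g -> 'M[R]_m),
     (0 < m)%N /\ sym_tuples m AA /\
     forall n : nat, (0 < n)%N ->
     forall X : 'I_g -> 'M[R]_n, sym_tuples n X ->
       (Dalg r n X <-> posdef (pencil 1%:M AA X))).
Proof.
split=> _ cvx.
  have [m [AA [m0 sA H]]] := lmi_of_real_family (Plim_family r0_pos cvx)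
    (fun n X n0 => Plim_boundary r0_pos (X := X) n0).
  exists m, AA; split=> //; split=> // n n0 X sX.
  exact: iff_trans (H n X n0 sX) (iff_sym (posdef_pencil sA sX)).
have [m [AA [m0 sA H]]] := lmi_of_real_family (Dalg_family r0_pos cvx)
  (fun n X n0 => Dalg_boundary r0_pos cvx (X := X) n0).
exists m, AA; split=> //; split=> // n n0 X sX.
exact: iff_trans (H n X n0 sX) (iff_sym (posdef_pencil sA sX)).
Qed.
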